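(* Let $s, t > 0$ be real numbers, and let $N_{s,t}(B)$ be the number of points $x \in \mathrm{Hilb}^2(\mathbb{P}^2)(\mathbb{Q})$ with $H_{s,t}(x) \le B$. Then, as $B \to \infty$, $$N_{s,t}(B) = c_{s,t}\, B^{3/t} + O\left(B^{2/t} + B^{3/s} \log B\right),$$ where the implied constant may depend on $s,t$ and $$c_{s,t} = \frac{\pi}{3\zeta(3)} \sum_{(a,b,c)} \frac{(a^2+b^2+c^2)^{\frac32 - \frac32 \cdot \frac{s}{t}}}{a^6 + 2b^2a^4 + 2c^2a^4 + 2b^4a^2 + 5c^2b^2a^2 + 2c^4a^2 + b^6 + 2c^2b^4 + 2c^4b^2 + c^6},$$ the sum being over all primitive triples $(a,b,c) \in \mathbb{Z}^3$ (i.e. $\gcd(a,b,c)=1$).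
   Context: For a ring $R$, $\mathrm{Hilb}^2(\mathbb{P}^2)(R)$ is the set of $R$-flat closed subschemes $Z \subset \mathbb{P}^2_R$ such that for every $s \in \mathrm{Spec}(R)$ the fiber $Z_s$ has dimension $0$ and degree $2$; $\mathrm{Hilb}^2(\mathbb{P}^2)$ is the projective $\mathbb{Z}$-scheme representing this functor. Since it is proper, $\mathrm{Hilb}^2(\mathbb{P}^2)(\mathbb{Z}) = \mathrm{Hilb}^2(\mathbb{P}^2)(\mathbb{Q})$. Let $S_{\mathbb{Z}}(d)$ be the lattice of homogeneous degree $d$ polynomials in $\mathbb{Z}[X_0,X_1,X_2]$. For $Z \in \mathrm{Hilb}^2(\mathbb{P}^2)(\mathbb{Z})$, let $I_Z(d) \subset S_{\mathbb{Z}}(d)$ be the sublattice of polynomials vanishing on $Z$. Equip $S_{\mathbb{Z}}(d) \otimes \mathbb{R}$ with the inner product for which the monomials are an orthonormal basis; the covolume of a sublattice with basis $w_1,\dots,w_k$ is $\mathrm{covol} = \det(\langle w_i, w_j\rangle)^{1/2}$. For $s,t \in \mathbb{R}$ define $$H_{s,t}(Z) = (\mathrm{covol}\, I_Z(1))^{s-t} \cdot (\mathrm{covol}\, I_Z(2))^{t},$$ where a rational point is identified with the corresponding integral point. *)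

(* Defs.v *)
From mathcomp Require Import all_boot all_order all_algebra finmap.
From mathcomp Require Import all_classical all_reals all_analysis.
From mathcomp Require mpoly.
(* The notations of mpoly clash with those of MathComp-Analysis. *)
Import -(notations) mpoly.

Set Implicit Arguments.
Unset Strict Implicit.
Unset Printing Implicit Defensive.

Import Order.TTheory GRing.Theory Num.Theory.
Import numFieldNormedType.Exports.

Local Open Scope classical_set_scope.
Local Open Scope ring_scope.

Notation Spoly A := (mpoly 3 A) (only parsing).

Definition varX (A : comNzRingType) (i : 'I_3) : Spoly A := mpolyX A (mnm1 i).

Definition homog (A : comNzRingType) (d : nat) : set (Spoly A) :=
  [set f | f \is ishomog1 d mdeg].

(* Closed subschemes of P^2_A = Proj A[X_0,X_1,X_2] correspond bijectively to
   the homogeneous ideals that are saturated with respect to (X_0,X_1,X_2):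
   Z corresponds to the ideal of the polynomials vanishing on Z. Closed
   subschemes are represented here by their saturated ideals, as sets of
   polynomials. *)

Definition is_ideal (A : comNzRingType) (I : set (Spoly A)) : Prop :=
  [/\ I 0, forall f g, I f -> I g -> I (f + g) & forall f g, I g -> I (f * g)].

Definition is_homogeneous (A : comNzRingType) (I : set (Spoly A)) : Prop :=
  forall f, I f -> forall d, I (pihomog mdeg d f).

Definition saturation (A : comNzRingType) (I : set (Spoly A)) : set (Spoly A) :=
  [set f | forall i, exists n, I (varX A i ^+ n * f)].

Definition closed_subscheme (A : comNzRingType) (I : set (Spoly A)) : Prop :=
  [/\ is_ideal I, is_homogeneous I & saturation I `<=` I].

(* I_Z(d) *)
Definition graded_part (A : comNzRingType) (I : set (Spoly A)) (d : nat) :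
  set (Spoly A) := I `&` homog d.

(* The coordinate ring of the affine open Z \cap {X_i <> 0} is
   A[X_0,X_1,X_2] / (I + (X_i - 1)). *)
Definition chart_ideal (A : comNzRingType) (I : set (Spoly A)) (i : 'I_3) :
  set (Spoly A) := [set f | exists g h, I g /\ f = g + (varX A i - 1) * h].

(* Flatness over A of M = A[X_0,X_1,X_2]/J: the map a (x) M -> M is injective
   for every finitely generated ideal a = (r_1, ..., r_k) of A. Since
   A[X_0,X_1,X_2] is free over A, a (x) M = a A[X_0,X_1,X_2] / a J, so that
   injectivity means that a A[X_0,X_1,X_2] \cap J is contained in a J. *)
Definition flat_quotient (A : comNzRingType) (J : set (Spoly A)) : Prop :=
  forall (k : nat) (r : 'I_k -> A) (g : 'I_k -> Spoly A),
    J (\sum_i r i *: g i) ->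
    exists2 h : 'I_k -> Spoly A, forall i, J (h i) &
      \sum_i r i *: g i = \sum_i r i *: h i.

Definition flat_subscheme (A : comNzRingType) (I : set (Spoly A)) : Prop :=
  forall i, flat_quotient (chart_ideal I i).

(* The ideal generated by the image of I. It is homogeneous and defines the
   base change Z_B, but need not be saturated. *)
Definition base_change (A B : comNzRingType) (phi : A -> B)
    (I : set (Spoly A)) : set (Spoly B) :=
  [set f | exists (k : nat) (a : 'I_k -> Spoly B) (g : 'I_k -> Spoly A),
    (forall i, I (g i)) /\ f = \sum_i a i * map_mpoly phi (g i)].

(* The closed subscheme of P^2_K defined by the homogeneous ideal J has
   dimension 0 and degree n (n > 0), i.e. its Hilbert polynomial is the
   constant n: for d large, K[X_0,X_1,X_2]_d / J_d has a basis e_1, ..., e_n.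
   The condition only depends on the saturation of J. *)
Definition dim0_degree (K : fieldType) (n : nat) (J : set (Spoly K)) : Prop :=
  exists d0, forall d, (d0 <= d)%N ->
    exists2 e : 'I_n -> Spoly K, forall i, homog d (e i) &
      forall f, homog d f ->
        exists! c : 'rV[K]_n, J (f - \sum_i c 0 i *: e i).

(* (K, phi) is the residue field of A at the point ker phi of Spec A. Every
   point of Spec A is obtained, with K unique up to unique isomorphism. *)
Definition is_residue_field (A : comNzRingType) (K : fieldType)
    (phi : {rmorphism A -> K}) : Prop :=
  forall x : K, exists a b, phi b != 0 /\ x = phi a / phi b.

(* Hilb^2(P^2)(A) *)
Definition hilb2 (A : comNzRingType) : set (set (Spoly A)) :=
  [set I | [/\ closed_subscheme I, flat_subscheme I &
    forall (K : fieldType) (phi : {rmorphism A -> K}),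
      is_residue_field phi -> dim0_degree 2 (base_change phi I)]].
Arguments hilb2 A : clear implicits.

(* The integral point I restricts to the rational point J. *)
Definition extends_to (J : set (Spoly rat)) (I : set (Spoly int)) : Prop :=
  hilb2 int I /\ saturation (base_change (intr : int -> rat) I) = J.

(* The inner product for which the monomials are orthonormal. *)
Definition dotp (A : comNzRingType) (f g : Spoly A) : A :=
  \sum_(m <- msupp f) mcoeff m f * mcoeff m g.

Definition lattice_basis (L : set (Spoly int)) (k : nat)
    (w : 'I_k -> Spoly int) : Prop :=
  (forall i, L (w i)) /\
  forall f, L f -> exists! c : 'rV[int]_k, f = \sum_i c 0 i *: w i.

Definition gram (k : nat) (w : 'I_k -> Spoly int) : 'M[int]_k :=
  \matrix_(i, j) dotp (w i) (w j).

(* det(<w_i, w_j>)^(1/2), for any basis w of L. *)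
Definition covol (R : realType) (L : set (Spoly int)) : R :=
  xget 0 [set v : R | exists (k : nat) (w : 'I_k -> Spoly int),
    lattice_basis L w /\ v = Num.sqrt (\det (gram w))%:~R].

Definition height (R : realType) (s t : R) (I : set (Spoly int)) : R :=
  covol R (graded_part I 1) `^ (s - t) * covol R (graded_part I 2) `^ t.

Definition points_le (R : realType) (s t B : R) : set (set (Spoly rat)) :=
  [set J | hilb2 rat J /\ exists2 I, extends_to J I & height s t I <= B].

Definition Ncount (R : realType) (s t B : R) : R :=
  (#|` fset_set (points_le s t B)|)%:R.

Definition primitive_triples : set (int * int * int) :=
  [set v | gcdz (gcdz v.1.1 v.1.2) v.2 = 1].

Definition cterm (R : realType) (s t : R) (v : int * int * int) : R :=
  let a := v.1.1%:~R : R in let b := v.1.2%:~R : R in let c := v.2%:~R : R in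
  (a ^+ 2 + b ^+ 2 + c ^+ 2) `^ (3 / 2 - 3 / 2 * (s / t)) /
  (a ^+ 6 + 2 * b ^+ 2 * a ^+ 4 + 2 * c ^+ 2 * a ^+ 4 + 2 * b ^+ 4 * a ^+ 2
   + 5 * c ^+ 2 * b ^+ 2 * a ^+ 2 + 2 * c ^+ 4 * a ^+ 2 + b ^+ 6
   + 2 * c ^+ 2 * b ^+ 4 + 2 * c ^+ 4 * b ^+ 2 + c ^+ 6).

Definition zeta3 (R : realType) : R := limn (series (riemannR (3 : R))).

Definition cconst (R : realType) (s t : R) : R :=
  pi / (3 * zeta3 R) *
  fine (\esum_(v in primitive_triples) (cterm s t v)%:E).

(* Main.v *)
From HB Require Import structures.
Require Import Defs.
From mathcomp Require Import all_boot all_order all_algebra finmap.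
From mathcomp Require Import all_classical all_reals all_analysis.
From mathcomp Require mpoly ssrcomplements.
Import -(notations) mpoly.
From mathcomp Require Import zify ring lra.
Set Implicit Arguments.
Unset Strict Implicit.
Unset Printing Implicit Defensive.

Import Order.TTheory GRing.Theory Num.Theory.
Import numFieldNormedType.Exports.

Local Open Scope classical_set_scope.
Local Open Scope ring_scope.

(** A subscheme Z of length 2 of the plane over the rationals lies on a unique line,
    and on this line it is the zero locus of a binary quadratic form. Hence the
    rational points correspond to pairs (v, c) of primitive integral triples, each
    up to sign: v gives the equation of the line, and c gives the form in a basis
    of the lattice of integral vectors orthogonal to v ([hilb2_rat_pair],
    [pair_rat_inj]). The ideal generated over the integers by the linear form and
    by the conic of c is flat by the lemma of Gauss, so it is the integral model,
    and a flat saturated model is unique ([pair_extends],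
    [integral_model_unique]).

    Put n = |v|^2. The lattice I_Z(1) is spanned by the equation l of the line and
    has covolume sqrt n. The lattice I_Z(2) is spanned by X_0 l, X_1 l, X_2 l and
    by the conic, so that the square of its covolume is, for a fixed line, a
    positive definite quadratic form G_v in c. A duality between complementary
    minors identifies G_v with the adjugate of a Gram matrix of determinant D(v),
    the polynomial of degree 6 in the denominator of the theorem; in particular
    det G_v = D(v)^2, and if the basis of the lattice of the line is short then all
    the pivots of G_v are at least n / 12 ([gram2], [gram_form_ldl]).

    The condition H <= B reads G_v(c) <= Y with Y = B^(2/t) n^(1 - s/t)
    ([height_le]). Counting the points of an ellipsoid slice by slice, and then
    the primitive ones by induction on the size of the ellipsoid, gives
    4 pi / (3 zeta(3)) Y^(3/2) / D(v) + O(Y / n) primitive triples c for each line,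
    and none at all if 12 Y < n ([ellipsoid_count], [prim_count_asymp],
    [line_count]). As n^(3/2 - 3s/(2t)) / D(v) is the term of the series, and the
    signs of v and c divide everything by 4, the sum over the lines is
    c_{s,t} B^(3/t) up to two errors ([count_error]). Only lines of size
    V = O(B^(1/s)) contribute: the missing tail of the series costs O(1)
    ([main_term_error]), and the errors O(Y / n) add up to
    B^(2/t) times the sum of k^(2 - 2s/t) for k <= V, which is
    O(B^(2/t) + B^(3/s) log B) ([shell_error]). *)

(** * Coordinates adapted to a line *)

Lemma mpoly3_ind (A : comNzRingType) (P : Spoly A -> Prop) :
  (forall c, P (mpolyC 3 c)) -> (forall i, P (varX A i)) ->
  (forall f g, P f -> P g -> P (f + g)) ->
  (forall f g, P f -> P g -> P (f * g)) -> forall f, P f.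
Proof.
move=> PC PX PD PM f; rewrite [f]mpolyE.
elim/big_ind: _ => [|f1 f2|m _]; [by rewrite -(mpolyC0 3 A); exact: PC|exact: PD|].
rewrite -mul_mpolyC; apply: (PM) => //; rewrite mpolyXE_id.
elim/big_ind: _ => [|f1 f2|i _]; [by rewrite -(mpolyC1 3 A); exact: PC|exact: PM|].
elim: (m i) => [|k IH]; first by rewrite expr0 -(mpolyC1 3 A); exact: PC.
by rewrite exprS; apply: (PM) => //; exact: PX.
Qed.

Definition lin (A : comNzRingType) (a : 'I_3 -> A) : Spoly A :=
  \sum_i a i *: varX A i.

(** A line l = 0 together with linear forms x and y that restrict to coordinates
    on it: the points p and p' of the line have coordinates (1, 0) and (0, 1), and
    [frameX] says that X_i = r_i l + p_i x + p'_i y, so that (l, x, y) is another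
    system of coordinates of the polynomial ring. Over the integers p and p' are
    a basis of the lattice of vectors orthogonal to the coefficients of l. *)
Record frame (A : comNzRingType) := Frame {
  fr : 'I_3 -> A; fp : 'I_3 -> A; fp' : 'I_3 -> A;
  fv : 'I_3 -> A; fx : 'I_3 -> A; fy : 'I_3 -> A;
  frameX : forall i j,
    fr i * fv j + fp i * fx j + fp' i * fy j = (i == j)%:R;
  frame_vp : \sum_i fv i * fp i = 0;
  frame_vp' : \sum_i fv i * fp' i = 0;
  frame_xp : \sum_i fx i * fp i = 1;
  frame_xp' : \sum_i fx i * fp' i = 0;
  frame_yp : \sum_i fy i * fp i = 0;
  frame_yp' : \sum_i fy i * fp' i = 1 }.

(** Restriction to the line, X |-> p u + p' w, where u is the inner variable and w
    the outer one. *)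
Definition psi (A : comNzRingType) (F : frame A) : Spoly A -> {poly {poly A}} :=
  mmap ((polyC \o polyC) : {rmorphism A -> {poly {poly A}}})
    (fun i => (fp F i)%:P%:P * ('X)%:P + (fp' F i)%:P%:P * 'X).

HB.instance Definition _ A F := GRing.RMorphism.copy (@psi A F)
  (mmap ((polyC \o polyC) : {rmorphism A -> {poly {poly A}}})
    (fun i => (fp F i)%:P%:P * ('X)%:P + (fp' F i)%:P%:P * 'X)).

(** The section of [psi] that substitutes the linear forms x and y for the two
    variables of a binary form. *)
Definition sigma (A : comNzRingType) (F : frame A) : {poly {poly A}} -> Spoly A :=
  horner_eval (lin (fy F)) \o map_poly (horner_eval (lin (fx F)) \o map_poly (@mpolyC 3 A)).

HB.instance Definition _ A F := GRing.RMorphism.copy (@sigma A F)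
  (horner_eval (lin (fy F)) \o map_poly (horner_eval (lin (fx F)) \o map_poly (@mpolyC 3 A))).

Section Frames.
Variables (A : comNzRingType) (F : frame A).
Implicit Types (f g h q : Spoly A).

Lemma psiC c : psi F (mpolyC 3 c) = c%:P%:P.
Proof. by rewrite /psi mmapC. Qed.

Lemma psiZ c f : psi F (c *: f) = c%:P%:P * psi F f.
Proof. by rewrite /psi mmapZ. Qed.

Lemma psi_varX i : psi F (varX A i) = (fp F i)%:P%:P * ('X)%:P + (fp' F i)%:P%:P * 'X.
Proof.
rewrite /psi /varX mmapX /mmap1 (bigD1 i) //= mnm1E eqxx expr1 big1 ?mulr1 //.
by move=> j ji; rewrite mnm1E eq_sym (negbTE ji) expr0.
Qed.

Lemma psi_lin a :
  psi F (lin a) = (\sum_i a i * fp F i)%:P%:P * ('X)%:P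
                + (\sum_i a i * fp' F i)%:P%:P * 'X.
Proof.
rewrite /lin !rmorph_sum /= !mulr_suml -big_split /=; apply: eq_bigr => i _.
by rewrite psiZ psi_varX mulrDr !mulrA -!polyCM.
Qed.

Let l := lin (fv F).
Let x := lin (fx F).
Let y := lin (fy F).

Lemma psi_l : psi F l = 0.
Proof. by rewrite psi_lin frame_vp frame_vp' !mul0r addr0. Qed.
Lemma psi_x : psi F x = ('X)%:P.
Proof. by rewrite psi_lin frame_xp frame_xp' !polyC1 mul1r mul0r addr0. Qed.
Lemma psi_y : psi F y = 'X.
Proof. by rewrite psi_lin frame_yp frame_yp' !polyC1 mul1r mul0r add0r. Qed.

Lemma varX_frame i : varX A i = fr F i *: l + fp F i *: x + fp' F i *: y.
Proof.
rewrite /l /x /y /lin !scaler_sumr -!big_split /= (bigD1 i) //= big1 => [|j ji].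
  by rewrite !scalerA -!scalerDl frameX eqxx scale1r addr0.
by rewrite !scalerA -!scalerDl frameX eq_sym (negbTE ji) scale0r.
Qed.

Lemma sigmaX : sigma F 'X = y.
Proof. by rewrite /sigma /= map_polyX /horner_eval hornerX. Qed.
Lemma sigmaCX : sigma F ('X)%:P = x.
Proof. by rewrite /sigma /= map_polyC /= /horner_eval hornerC map_polyX hornerX. Qed.
Lemma sigmaCC c : sigma F c%:P%:P = mpolyC 3 c.
Proof. by rewrite /sigma /= map_polyC /= /horner_eval hornerC map_polyC hornerC. Qed.

Lemma psi_sigma (h : {poly {poly A}}) : psi F (sigma F h) = h.
Proof.
elim/poly_ind: h => [|h p IH]; first by rewrite !rmorph0.
rewrite (rmorphD (sigma F)) (rmorphM (sigma F)) (rmorphD (psi F)) (rmorphM (psi F)) /= IH sigmaX psi_y.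
congr (_ + _).
elim/poly_ind: p => [|p c IHp]; first by rewrite polyC0 !rmorph0.
rewrite polyCD polyCM (rmorphD (sigma F)) (rmorphM (sigma F)) (rmorphD (psi F)) (rmorphM (psi F)) /=.
by rewrite IHp sigmaCX sigmaCC psi_x psiC.
Qed.

(** The kernel of the restriction to the line is generated by l: this is stable
    under sums and products, and on the variables it is [varX_frame]. *)
Lemma sigma_psi f : exists a, f = a * l + sigma F (psi F f).
Proof.
elim/mpoly3_ind: f => [c|i|f g [a Ha] [b Hb]|f g [a Ha] [b Hb]].
- by exists 0; rewrite mul0r add0r psiC sigmaCC.
- exists (mpolyC 3 (fr F i)).
  rewrite {1}varX_frame psi_varX (rmorphD (sigma F)) !(rmorphM (sigma F)) /= sigmaX sigmaCX !sigmaCC.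
  by rewrite !mul_mpolyC addrA.
- by exists (a + b); rewrite (rmorphD (psi F)) (rmorphD (sigma F)) mulrDl {1}Ha {1}Hb addrACA.
exists (a * g + sigma F (psi F f) * b).
rewrite (rmorphM (psi F)) (rmorphM (sigma F)) mulrDl {1}Ha {1}mulrDl -!addrA; congr (_ + _).
  by rewrite mulrAC.
by rewrite {1}Hb mulrDr mulrA.
Qed.

Definition idl2 (l q : Spoly A) : set (Spoly A) :=
  [set f | exists a b, f = a * l + b * q].

(** As [psi] identifies the quotient by l with a polynomial ring in two variables,
    membership in (l, q) is divisibility by the restriction of q. *)
Lemma idl2_psi q f : idl2 l q f <-> exists h : {poly {poly A}}, psi F f = psi F q * h.
Proof.
split=> [[a [b ->]]|[h Hh]].
  by exists (psi F b); rewrite (rmorphD (psi F)) !(rmorphM (psi F)) /= psi_l mulr0 add0r mulrC.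
have [a Ha] := sigma_psi f; have [b Hb] := sigma_psi (sigma F h * q).
have E : psi F (sigma F h * q) = psi F f by rewrite (rmorphM (psi F)) /= psi_sigma Hh mulrC.
by exists (a - b), (sigma F h); rewrite Hb E {1}Ha mulrBl addrA subrK.
Qed.

End Frames.

(** * Homogeneous ideals, saturation and flatness of charts *)

Section Ideals.
Variable A : comNzRingType.
Implicit Types (f g h l q : Spoly A) (I : set (Spoly A)).

Lemma idealZ I c f : is_ideal I -> I f -> I (c *: f).
Proof. by case=> _ _ IM If; rewrite -mul_mpolyC; apply: (IM). Qed.

Lemma idealN I f : is_ideal I -> I f -> I (- f).
Proof. by case=> _ _ IM If; rewrite -mulN1r; apply: (IM). Qed.

Lemma idealB I f g : is_ideal I -> I f -> I g -> I (f - g).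
Proof. by move=> II If Ig; case: (II) => _ ID _; apply: ID => //; apply: idealN. Qed.

Lemma ideal_sum I (J : Type) (r : seq J) (P : pred J) (F : J -> Spoly A) :
  is_ideal I -> (forall i, P i -> I (F i)) -> I (\sum_(i <- r | P i) F i).
Proof. by case=> I0 ID _ IF; elim/big_ind: _. Qed.

Lemma idl2_ideal l q : is_ideal (idl2 l q).
Proof.
split=> [|f g [a [b ->]] [a' [b' ->]]|f g [a [b ->]]].
- by exists 0, 0; rewrite !mul0r addr0.
- by exists (a + a'), (b + b'); rewrite !mulrDl addrACA.
- by exists (f * a), (f * b); rewrite mulrDr !mulrA.
Qed.

Lemma idl2_l l q : idl2 l q l.
Proof. by exists 1, 0; rewrite mul1r mul0r addr0. Qed.

Lemma idl2_q l q : idl2 l q q.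
Proof. by exists 0, 1; rewrite mul1r mul0r add0r. Qed.

Lemma idl2_sub l q I : is_ideal I -> I l -> I q -> idl2 l q `<=` I.
Proof. by case=> _ ID IM Il Iq f [a [b ->]]; apply: ID; apply: (IM). Qed.

Lemma homog_varX i : homog 1 (varX A i).
Proof. by rewrite /homog /= /varX dhomogX /= mdeg1. Qed.

Lemma homogZ d c f : homog d f -> homog d (c *: f).
Proof. exact: dhomogZ. Qed.

Lemma homogD d f g : homog d f -> homog d g -> homog d (f + g).
Proof. exact: dhomogD. Qed.

Lemma homog0 d : homog d (0 : Spoly A).
Proof. exact: dhomog0. Qed.

Lemma homog_sum d (J : Type) (r : seq J) (P : pred J) (F : J -> Spoly A) :
  (forall i, P i -> homog d (F i)) -> homog d (\sum_(i <- r | P i) F i).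
Proof. by move=> HF; elim/big_ind: _ => //; [exact: homog0 | exact: homogD]. Qed.

Lemma homogM d e f g : homog d f -> homog e g -> homog (d + e) (f * g).
Proof. exact: dhomogM. Qed.

Lemma homogX d k f : homog d f -> homog (d * k) (f ^+ k).
Proof. exact: dhomogMn. Qed.

Lemma homog_lin a : homog 1 (lin a : Spoly A).
Proof. by apply: homog_sum => i _; apply: homogZ; exact: homog_varX. Qed.

Lemma homogXS d f : homog 1 f -> homog d (f ^+ d).
Proof. by move/(homogX d); rewrite mul1n. Qed.

Lemma pihomogM d e f g : homog e g ->
  pihomog mdeg d (f * g) = if (e <= d)%N then pihomog mdeg (d - e) f * g else 0.
Proof.
move=> hg; rewrite {1}[f]mpolyE mulr_suml !linear_sum /=.
transitivity (\sum_(m <- msupp f)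
    mcoeff m f *: (if (mdeg m + e == d)%N then mpolyX A m * g else 0)).
  apply: eq_bigr => m _; rewrite -scalerAl linearZ /=; congr (_ *: _).
  have hX : homog (mdeg m + e) (mpolyX A m * g).
    by apply: homogM => //; rewrite /homog /= dhomogX.
  case: eqP => [<-|/eqP ne]; first exact: pihomog_dE.
  exact: (pihomog_ne0 ne).
case: leqP => [le|lt]; last first.
  by rewrite big1 // => m _; case: eqP => [E|]; rewrite ?scaler0 //; lia.
rewrite {3}[f]mpolyE linear_sum mulr_suml; apply: eq_bigr => m _ /=.
rewrite linearZ /= -scalerAl pihomogX /=; congr (_ *: _).
have -> : (mdeg m == d - e)%N = (mdeg m + e == d)%N by apply/eqP/eqP; lia.
by case: ifP; rewrite ?mul0r.
Qed.

Lemma idl2_homog l q : homog 1 l -> homog 2 q -> is_homogeneous (idl2 l q).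
Proof.
move=> hl hq f [a [b ->]] d; rewrite linearD /= (pihomogM _ _ hl) (pihomogM _ _ hq).
have [I0 ID IM] := idl2_ideal l q.
by apply: ID; case: ifP => // _; apply: (IM); [exact: idl2_l | exact: idl2_q].
Qed.

Lemma homog_ind d (P : Spoly A -> Prop) : P 0 ->
  (forall c m f, mdeg m = d -> P f -> P (c *: mpolyX A m + f)) ->
  forall f, homog d f -> P f.
Proof.
move=> P0 PD f hf; rewrite [f]mpolyE.
have hs : {in msupp f, forall m, mdeg m = d} by apply/dhomogP.
elim: (msupp f) hs => [|m s IH] hs; first by rewrite big_nil.
rewrite big_cons; apply: PD; first by apply: hs; rewrite inE eqxx.
by apply: IH => m' m's; apply: hs; rewrite inE m's orbT.
Qed.

Lemma mdegS_split d (m : multinom 3) : mdeg m = d.+1 ->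
  exists i m', mdeg m' = d /\ mpolyX A m = varX A i * mpolyX A m'.
Proof.
move=> Hm; have [i Hi] : exists i, m i != 0%N.
  apply/existsP; rewrite -negb_forall; apply/negP => /forallP m0.
  by move: Hm; rewrite mdegE big1 // => i _; apply/eqP/m0.
exists i, (mnm_sub m (mnm1 i)); have le : mpoly.lem (mnm1 i) m by rewrite lep1mP.
rewrite /varX -mpolyXD; split.
  have := congr1 mdeg (submK le); rewrite mdegD mdeg1 Hm; lia.
by rewrite mpoly.addmC submK.
Qed.

Lemma homogS_split d f : homog d.+1 f ->
  exists2 g : 'I_3 -> Spoly A, forall i, homog d (g i) & f = \sum_i varX A i * g i.
Proof.
move: f; apply: homog_ind => [|c m f Hm [g Hg ->]].
  exists (fun _ => 0) => [i|]; first exact: homog0.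
  by rewrite big1 // => i _; rewrite mulr0.
have [i [m' [Hm' ->]]] := mdegS_split Hm.
exists (fun j => (if j == i then c *: mpolyX A m' else 0) + g j) => [j|].
  apply: homogD => //; case: ifP => _; last exact: homog0.
  by apply: homogZ; rewrite /homog /= dhomogX /= Hm'.
under [RHS]eq_bigr do rewrite mulrDr.
rewrite big_split /= [X in _ = X + _](bigD1 i) //= eqxx [X in _ = _ + X + _]big1 => [|j /negbTE ->].
  by rewrite addr0 scalerAr.
by rewrite mulr0.
Qed.

Lemma sat_pow I g h f n m : is_ideal I -> I (g ^+ n * f) -> I (h ^+ m * f) ->
  I ((g + h) ^+ (n + m) * f).
Proof.
move=> II Ig Ih; rewrite exprDn mulr_suml; apply: ideal_sum => // i _.
case: (II) => _ _ IM; rewrite mulrnAl -mulr_natl; apply: (IM).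
case: (leqP m i) => [le|lt].
  have -> : g ^+ (n + m - i) * h ^+ i * f =
      g ^+ (n + m - i) * h ^+ (i - m) * (h ^+ m * f).
    by rewrite -{2}(subnK le) exprD -!mulrA.
  exact: IM.
have le : (n <= n + m - i)%N by lia.
have -> : g ^+ (n + m - i) * h ^+ i * f =
    g ^+ (n + m - i - n) * h ^+ i * (g ^+ n * f).
  by rewrite -{1}(subnK le) exprD -!mulrA; congr (_ * _); rewrite mulrCA.
exact: IM.
Qed.

(** Saturation only mentions the variables, but by the binomial theorem a power of
    any linear form also multiplies f into I; the frame coordinates x and y can
    then be used in place of the X_i. *)
Lemma sat_lin I f a : is_ideal I -> saturation I f -> exists n, I (lin a ^+ n * f).
Proof.
move=> II sf; rewrite /lin; elim/big_ind: _ => [|g h [n Hn] [m Hm]|i _].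
- by exists 1%N; rewrite expr1 mul0r; case: II.
- by exists (n + m)%N; apply: sat_pow.
have [n Hn] := sf i; exists n; rewrite exprZn -scalerAl; exact: idealZ.
Qed.

Lemma sat_mono I f g n m : is_ideal I -> (n <= m)%N -> I (g ^+ n * f) -> I (g ^+ m * f).
Proof.
by move=> [_ _ IM] le Hn; rewrite -(subnK le) exprD -mulrA; apply: (IM).
Qed.

Lemma sat_sub I : is_ideal I -> I `<=` saturation I.
Proof. by move=> [_ _ IM] f If i; exists 0%N; apply: (IM). Qed.

(** The homogenisation of f to degree D with respect to X_i, provided that the degree
    of f is less than D. *)
Definition hom_at (i : 'I_3) D f := \sum_(d < D) varX A i ^+ (D - d) * pihomog mdeg d f.

Lemma hom_atB i D f g : hom_at i D (f - g) = hom_at i D f - hom_at i D g.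
Proof. by rewrite /hom_at -sumrB; apply: eq_bigr => d _; rewrite linearB mulrBr. Qed.

Lemma hom_atD i D f g : hom_at i D (f + g) = hom_at i D f + hom_at i D g.
Proof. by rewrite /hom_at -big_split; apply: eq_bigr => d _; rewrite linearD mulrDr. Qed.

Lemma hom_at_sum i D k (r : 'I_k -> A) (g : 'I_k -> Spoly A) :
  hom_at i D (\sum_j r j *: g j) = \sum_j r j *: hom_at i D (g j).
Proof.
elim/big_ind2: _ => [|f f' g1 g' <- <-|j _]; last 1 first.
- rewrite /hom_at scaler_sumr; apply: eq_bigr => d _.
  by rewrite linearZ /= scalerAr.
- by rewrite /hom_at big1 // => d _; rewrite linear0 mulr0.
- exact: hom_atD.
Qed.

Lemma hom_at_chart i D f : (msize f <= D)%N ->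
  exists h, f = hom_at i D f + (varX A i - 1) * h.
Proof.
move=> le; rewrite {1}(pihomog_partitionE le).
exists (\sum_(d < D) - (\sum_(e < D - d) varX A i ^+ e) * pihomog mdeg d f).
rewrite mulr_sumr /hom_at -big_split; apply: eq_bigr => d _ /=.
by rewrite mulrA mulrN -subrX1 -mulrDl opprB addrC subrK mul1r.
Qed.

(** Homogenising kills X_i - 1: the contributions of X_i h and of h telescope, up
    to the top degree component of h, which vanishes. *)
Lemma hom_at_cancel i D h : (msize h < D)%N -> hom_at i D ((varX A i - 1) * h) = 0.
Proof.
case: D => // D; rewrite ltnS => le; rewrite mulrBl mul1r hom_atB /hom_at.
rewrite big_ord_recl /= [X in _ - X]big_ord_recr /=.
have -> : pihomog mdeg D h = 0.
  rewrite pihomogE big_seq_cond big_pred0 // => m.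
  by apply/negP => /andP[/msize_mdeg_lt lt /eqP Em]; have := leq_trans lt le;
    rewrite Em ltnn.
have pX d : pihomog mdeg d (varX A i * h) =
    if (1 <= d)%N then pihomog mdeg (d - 1) h * varX A i else 0.
  by rewrite mulrC (pihomogM _ _ (homog_varX i)).
rewrite mulr0 addr0 pX /= mulr0 add0r -sumrB big1 // => d _.
rewrite pX /bump /= add1n subSS subn1 /= [pihomog _ _ _ * _]mulrC mulrA -exprSr.
by rewrite -subSn ?subrr // ltnW.
Qed.

Lemma hom_at_ideal I i D f : is_ideal I -> is_homogeneous I -> I f -> I (hom_at i D f).
Proof.
by move=> II HI If; apply: ideal_sum => // d _; case: (II) => _ _ IM; apply/IM/HI.
Qed.

Lemma chart_hom I i f : is_ideal I -> is_homogeneous I -> chart_ideal I i f ->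
  exists D0, forall D, (D0 <= D)%N -> I (hom_at i D f).
Proof.
move=> II HI [g [h [Ig ->]]]; exists (msize h).+1 => D le.
by rewrite hom_atD hom_at_cancel // addr0; apply: hom_at_ideal.
Qed.

(** A linear relation in a chart becomes, after homogenisation, a relation in I
    itself, to which the flatness of the quotient by I applies; the difference
    between a polynomial and its homogenisation lies in (X_i - 1). *)
Lemma flat_charts I : is_ideal I -> is_homogeneous I -> flat_quotient I ->
  flat_subscheme I.
Proof.
move=> II HI fI i k r g /(chart_hom II HI) [D0 HD].
pose D := maxn D0 (\max_j msize (g j)).
have le j : (msize (g j) <= D)%N.
  by rewrite leq_max (leq_bigmax (F := fun j => msize (g j)) j) orbT.
have := HD D (leq_maxl _ _); rewrite hom_at_sum => /fI[h Ih Eh].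
exists (fun j => h j + (g j - hom_at i D (g j))) => [j|].
  have [e He] := hom_at_chart i (le j).
  by exists (h j), e; split=> //; congr (_ + _); apply/eqP; rewrite subr_eq addrC; apply/eqP.
under [RHS]eq_bigr do rewrite scalerDr scalerBr.
by rewrite big_split /= sumrB -Eh [RHS]addrC subrK.
Qed.

End Ideals.

(** * The ideal of a quadratic form on a line *)

Section QuadOnLine.
Variables (A : comNzRingType) (F : frame A).

Definition quad (c0 c1 c2 : A) : Spoly A :=
  c0 *: lin (fx F) ^+ 2 + c1 *: (lin (fx F) * lin (fy F)) + c2 *: lin (fy F) ^+ 2.

(** The subscheme of the line l = 0 cut out by the binary quadratic form with
    coefficients c0, c1, c2 in the coordinates x and y of the frame. *)
Definition hyp c0 c1 c2 : set (Spoly A) := idl2 (lin (fv F)) (quad c0 c1 c2).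

Definition bform (c0 c1 c2 : A) : {poly {poly A}} :=
  c0%:P%:P * ('X)%:P ^+ 2 + c1%:P%:P * ('X%:P * 'X) + c2%:P%:P * 'X ^+ 2.

Lemma psi_quad c0 c1 c2 : psi F (quad c0 c1 c2) = bform c0 c1 c2.
Proof.
rewrite /quad !(rmorphD (psi F)) /= !psiZ !(rmorphXn (psi F)) (rmorphM (psi F)) /=.
by rewrite psi_x psi_y.
Qed.

Lemma homog_quad c0 c1 c2 : homog 2 (quad c0 c1 c2).
Proof.
have hx := homog_lin (fx F); have hy := homog_lin (fy F).
apply: homogD; first apply: homogD; apply: homogZ.
- exact: homogXS.
- exact: (homogM hx hy).
- exact: homogXS.
Qed.

Lemma hyp_ideal c0 c1 c2 : is_ideal (hyp c0 c1 c2).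
Proof. exact: idl2_ideal. Qed.

Lemma hyp_homog c0 c1 c2 : is_homogeneous (hyp c0 c1 c2).
Proof. by apply: idl2_homog; [exact: homog_lin | exact: homog_quad]. Qed.

Lemma hypP c0 c1 c2 f :
  hyp c0 c1 c2 f <-> exists h : {poly {poly A}}, psi F f = bform c0 c1 c2 * h.
Proof. by rewrite -psi_quad; exact: idl2_psi. Qed.

Lemma coef_bform c0 c1 c2 :
  [/\ (bform c0 c1 c2)`_0 = c0 *: 'X^2, (bform c0 c1 c2)`_1 = c1 *: 'X
    & (bform c0 c1 c2)`_2 = c2%:P].
Proof.
rewrite /bform -!mul_polyC -[_%:P ^+ 2]polyC_exp -!polyCM mulrA.
rewrite -polyCM; split.
- by rewrite !coefD !coefCM !coefX coefXn coefC /= !mulr0 !addr0.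
- by rewrite !coefD !coefCM !coefX coefXn coefC /= mulr0 mulr1 addr0 add0r.
- by rewrite !coefD !coefCM !coefX coefXn coefC /= mulr0 mulr1 !add0r.
Qed.

Lemma bform_inj c0 c1 c2 d0 d1 d2 : bform c0 c1 c2 = bform d0 d1 d2 ->
  [/\ c0 = d0, c1 = d1 & c2 = d2].
Proof.
have [a0 a1 a2] := coef_bform c0 c1 c2; have [b0 b1 b2] := coef_bform d0 d1 d2.
move=> E; move: a0 a1 a2; rewrite E b0 b1 b2 => a0 a1 a2; split.
- by have := congr1 (fun p : {poly A} => p`_2) a0; rewrite !coefZ coefXn /= !mulr1.
- by have := congr1 (fun p : {poly A} => p`_1) a1; rewrite !coefZ coefX /= !mulr1.
- exact: polyC_inj (esym a2).
Qed.

Lemma bform0 : bform 0 0 0 = 0.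
Proof. by rewrite /bform !polyC0 !mul0r !addr0. Qed.

Lemma lin_comb (a : 'I_3 -> A) :
  lin a = (\sum_i a i * fr F i) *: lin (fv F) + (\sum_i a i * fp F i) *: lin (fx F)
        + (\sum_i a i * fp' F i) *: lin (fy F).
Proof.
rewrite {1}/lin !scaler_suml -!big_split; apply: eq_bigr => i _ /=.
by rewrite (varX_frame F) !scalerDr !scalerA.
Qed.

End QuadOnLine.

(** The two variables of a binary form are coprime. *)
Lemma XN_cancel (A : idomainType) (h h' : {poly {poly A}}) N :
  ('X)%:P ^+ N * h = 'X ^+ N * h' -> exists h2, h = 'X ^+ N * h2.
Proof.
move=> E; suff: forall k, (k <= N)%N -> exists h2, h = 'X ^+ k * h2 by apply.
elim=> [|k IH] lt; first by exists h; rewrite expr0 mul1r.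
have [h2 H2] := IH (ltnW lt).
have E2 : ('X)%:P ^+ N * h2 = 'X ^+ (N - k) * h'.
  have nz : 'X ^+ k != 0 :> {poly {poly A}} by rewrite expf_neq0 ?polyX_eq0.
  apply: (mulfI nz); rewrite mulrCA -H2 E mulrA -exprD subnKC //; exact: ltnW.
have := congr1 (fun p => p.[0]) E2.
rewrite !hornerM hornerXn expr0n subn_eq0 leqNgt lt mul0r -polyC_exp hornerC.
move/eqP; rewrite mulf_eq0 expf_eq0 polyX_eq0 andbF /= => /factor_theorem [h3 H3].
by exists h3; rewrite H2 H3 subr0 mulrA mulrAC -exprSr.
Qed.

Lemma bform_neq0 (A : comNzRingType) (c0 c1 c2 : A) :
  (c0, c1, c2) != (0, 0, 0) -> bform c0 c1 c2 != 0.
Proof.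
apply: contra => /eqP; rewrite -(bform0 A) => /bform_inj[-> -> ->]; exact: eqxx.
Qed.

(** If the binary form divides u^N g and w^N g then it divides g, because u and w
    are coprime and a nonzero form is not a zero divisor. *)
Lemma hyp_saturated (A : idomainType) (F : frame A) c0 c1 c2 :
  (c0, c1, c2) != (0, 0, 0) -> saturation (hyp F c0 c1 c2) `<=` hyp F c0 c1 c2.
Proof.
move=> nz f sf; have HI := hyp_ideal F c0 c1 c2.
have [n Hn] := sat_lin (fx F) HI sf; have [m Hm] := sat_lin (fy F) HI sf.
pose N := maxn n m.
have /hypP[h Hh] := sat_mono HI (leq_maxl n m) Hn.
have /hypP[h' Hh'] := sat_mono HI (leq_maxr n m) Hm.
move: Hh Hh'; rewrite -/N !(rmorphM (psi F)) !(rmorphXn (psi F)) /= psi_x psi_y.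
move=> Hh Hh'; have q0 := bform_neq0 nz.
have [h2 H2] : exists h2, h' = 'X ^+ N * h2.
  apply: (@XN_cancel _ _ h); apply: (mulfI q0).
  by rewrite mulrCA -Hh' [RHS]mulrCA -Hh mulrCA.
apply/hypP; exists h2.
have nX : 'X ^+ N != 0 :> {poly {poly A}} by rewrite expf_neq0 ?polyX_eq0.
by apply: (mulfI nX); rewrite Hh' H2 mulrCA.
Qed.

Lemma hyp_closed (A : idomainType) (F : frame A) c0 c1 c2 :
  (c0, c1, c2) != (0, 0, 0) -> closed_subscheme (hyp F c0 c1 c2).
Proof.
by move=> nz; split; [exact: hyp_ideal|exact: hyp_homog|exact: hyp_saturated].
Qed.

(** When the coefficient of y^2 is nonzero, y^2 can be eliminated, so that x^d and
    x^(d-1) y span the quotient in degree d; they are independent because a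
    multiple of the form has degree at least 2 in y. *)
Lemma hyp_dim_main (K : fieldType) (F : frame K) c0 c1 c2 : c2 != 0 ->
  dim0_degree 2 (hyp F c0 c1 c2).
Proof.
move=> c20; exists 1%N => d d1.
have [k ->] : exists k, d = k.+1 by exists d.-1; rewrite prednK.
set x := lin (fx F); set y := lin (fy F).
have HI := hyp_ideal F c0 c1 c2; have [I0 ID IM] := HI.
exists (fun i => if i == ord0 then x ^+ k.+1 else x ^+ k * y).
  move=> i; case: ifP => _; first exact: homogXS (homog_lin _).
  by rewrite -addn1; apply: homogM; [exact: homogXS (homog_lin _)|exact: homog_lin].
have ex f : homog k.+1 f -> exists a b,
    hyp F c0 c1 c2 (f - (a *: x ^+ k.+1 + b *: (x ^+ k * y))).
  have hl : hyp F c0 c1 c2 (lin (fv F)) by exact: idl2_l.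
  have hq : hyp F c0 c1 c2 (quad F c0 c1 c2) by exact: idl2_q.
  elim: k f {d1} => [|k IH] f hf.
    have [g Hg ->] := homogS_split hf.
    have gC i : g i = mpolyC 3 (mcoeff (@mnm0 3) (g i)).
      apply/mpolyP => m; rewrite mcoeffC; case: eqP => [->|/eqP ne]; first by rewrite mulr1.
      by rewrite mulr0 (dhomog_nemf_coeff (Hg i)) // mdeg_eq0.
    exists (\sum_i mcoeff (@mnm0 3) (g i) * fp F i), (\sum_i mcoeff (@mnm0 3) (g i) * fp' F i).
    have -> : \sum_i varX K i * g i = lin (fun i => mcoeff (@mnm0 3) (g i)).
      by apply: eq_bigr => i _; rewrite mulrC {1}gC mul_mpolyC.
    rewrite (lin_comb F) expr0 mul1r expr1 -/x -/y -[X in X - _]addrA addrK.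
    exact: idealZ.
  have [g Hg ->] := homogS_split hf.
  have /choice[a Ha] : forall i, exists a b,
      hyp F c0 c1 c2 (g i - (a *: x ^+ k.+1 + b *: (x ^+ k * y))) by move=> i; exact: IH.
  have {Ha}/choice[b Hab] := Ha.
  have yy : hyp F c0 c1 c2 (y ^+ 2 - (- (c0 / c2) *: x ^+ 2 + - (c1 / c2) *: (x * y))).
    have -> : y ^+ 2 - (- (c0 / c2) *: x ^+ 2 + - (c1 / c2) *: (x * y)) = c2^-1 *: quad F c0 c1 c2.
      rewrite /quad !scalerDr !scalerA mulVf // scale1r !scaleNr opprD !opprK addrC.
      by rewrite ![c2^-1 * _]mulrC.
    exact: idealZ.
  pose al i := fp F i * a i - fp' F i * b i * (c0 / c2).
  pose be i := fp F i * b i + fp' F i * a i - fp' F i * b i * (c1 / c2).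
  exists (\sum_i al i), (\sum_i be i).
  rewrite !scaler_suml -big_split -sumrB; apply: ideal_sum => // i _ /=.
  have -> : varX K i * g i - (al i *: x ^+ k.+2 + be i *: (x ^+ k.+1 * y)) =
      varX K i * (g i - (a i *: x ^+ k.+1 + b i *: (x ^+ k * y))) +
      (fr F i *: (a i *: x ^+ k.+1 + b i *: (x ^+ k * y))) * lin (fv F) +
      (fp' F i * b i) *: x ^+ k *
        (y ^+ 2 - (- (c0 / c2) *: x ^+ 2 + - (c1 / c2) *: (x * y))).
    rewrite (varX_frame F i) -/x -/y /al /be -!mul_mpolyC !(mpolyCD, mpolyCM, mpolyCN, mpolyCB) !exprS.
    ring.
  by apply: (ID); [apply: (ID); apply: (IM)|apply: (IM)].
move=> f /ex[a [b Hab]].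
exists (\row_i if i == ord0 then a else b); split.
  by rewrite big_ord_recl big_ord1 !mxE /=.
move=> c Hc; apply/rowP => i; rewrite mxE.
have : hyp F c0 c1 c2 ((c 0 0 - a) *: x ^+ k.+1 + (c 0 1 - b) *: (x ^+ k * y)).
  move: Hc; rewrite big_ord_recl big_ord1 /= => Hc.
  have := idealB HI Hab Hc; congr hyp.
  have -> : lift ord0 ord0 = 1 :> 'I_2 by apply: val_inj.
  have -> : ord0 = 0 :> 'I_2 by apply: val_inj.
  have sb (u v w : Spoly K) : (u - v) - (u - w) = w - v by rewrite opprB addrC addrA subrK.
  by rewrite sb !scalerBl opprD addrACA.
rewrite hypP => -[h]; rewrite (rmorphD (psi F)) /= !psiZ (rmorphM (psi F)) !(rmorphXn (psi F)) /=.
rewrite psi_x psi_y => Hh.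
have h0 : h = 0.
  apply/eqP; apply: contraT => h0.
  have sb : size (bform c0 c1 c2) = 3%N.
    apply/eqP; rewrite eqn_leq; apply/andP; split.
      apply/leq_sizeP => j; rewrite /bform -[_%:P ^+ 2]polyC_exp mulrA -!polyCM.
      case: j => [|[|[|j]]] // _.
      by rewrite !coefD !coefCM !coefX coefXn coefC /= !mulr0 !addr0.
    rewrite ltnNge; apply/negP => /leq_sizeP/(_ 2%N isT); have [_ _ ->] := coef_bform c0 c1 c2.
    by apply/eqP; rewrite polyC_eq0.
  have := congr1 (fun p : {poly {poly K}} => size p) Hh.
  rewrite size_mul // ?bform_neq0 //; last first.
    by apply: contra c20 => /eqP[_ _ ->].
  rewrite sb => E; have : (size h > 0)%N by rewrite size_poly_gt0.
  suff: (size ((c 0 0 - a)%:P%:P * ('X)%:P ^+ k.+1 +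
      (c 0 1 - b)%:P%:P * (('X)%:P ^+ k * 'X) : {poly {poly K}})%R <= 2)%N by rewrite E addSn /= !addSn add0n !ltnS leqn0 => /eqP ->.
  apply/leq_sizeP => j; case: j => [|[|j]] // _.
  by rewrite mulrA -!polyC_exp -!polyCM !coefD !coefCM coefX coefC /= !mulr0 addr0.
move: Hh; rewrite h0 mulr0 mulrA -!polyC_exp -!polyCM => Hh.
have := congr1 (fun p : {poly {poly K}} => p`_0) Hh.
have := congr1 (fun p : {poly {poly K}} => p`_1) Hh.
rewrite !coefD !coefCM !coefX !coefC /= !mulr0 mulr1 addr0 add0r ?coef0.
move/eqP; rewrite mulf_eq0 expf_eq0 polyX_eq0 andbF orbF polyC_eq0 subr_eq0 => /eqP E1.
move/eqP; rewrite mulf_eq0 expf_eq0 polyX_eq0 andbF orbF polyC_eq0 subr_eq0 => /eqP E0.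
case: (unliftP ord0 i) => [j ->|->] /=; last by rewrite -E0; congr (c _ _); apply: val_inj.
by rewrite -E1; congr (c _ _); apply: val_inj; rewrite /= ord1.
Qed.

(** * Base change and integral points *)

Section FrameOps.
Variables (A : comNzRingType) (F : frame A).

Program Definition swap_frame : frame A :=
  @Frame A (fr F) (fp' F) (fp F) (fv F) (fy F) (fx F) _ _ _ _ _ _ _.
Next Obligation. by move=> i j; rewrite -(frameX F); ring. Qed.
Next Obligation. exact: frame_vp'. Qed.
Next Obligation. exact: frame_vp. Qed.
Next Obligation. exact: frame_yp'. Qed.
Next Obligation. exact: frame_yp. Qed.
Next Obligation. exact: frame_xp'. Qed.
Next Obligation. exact: frame_xp. Qed.

Program Definition shear_frame : frame A :=
  @Frame A (fr F) (fp F) (fun i => fp F i + fp' F i) (fv F)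
    (fun i => fx F i - fy F i) (fy F) _ _ _ _ _ _ _.
Next Obligation. by move=> i j; rewrite -(frameX F); ring. Qed.
Next Obligation. exact: frame_vp. Qed.
Next Obligation.
by under eq_bigr do rewrite mulrDr; rewrite big_split /= frame_vp frame_vp' addr0.
Qed.
Next Obligation.
by under eq_bigr do rewrite mulrBl; rewrite sumrB frame_xp frame_yp subr0.
Qed.
Next Obligation.
under eq_bigr do rewrite mulrBl !mulrDr.
by rewrite sumrB !big_split /= frame_xp frame_xp' frame_yp frame_yp' add0r addr0 subrr.
Qed.
Next Obligation. exact: frame_yp. Qed.
Next Obligation.
by under eq_bigr do rewrite mulrDr; rewrite big_split /= frame_yp frame_yp' add0r.
Qed.

Lemma hyp_swap c0 c1 c2 : hyp swap_frame c0 c1 c2 = hyp F c2 c1 c0.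
Proof.
rewrite /hyp; suff -> : quad swap_frame c0 c1 c2 = quad F c2 c1 c0 by [].
by rewrite /quad /= [lin (fy F) * _]mulrC addrC [X in _ + X]addrC addrA.
Qed.

Lemma hyp_shear c : hyp shear_frame 0 c c = hyp F 0 c 0.
Proof.
rewrite /hyp; suff -> : quad shear_frame 0 c c = quad F 0 c 0 by [].
rewrite /quad /= !scale0r !add0r addr0 -scalerDr.
have -> : lin (fun i => fx F i - fy F i) = lin (fx F) - lin (fy F) :> Spoly A.
  by rewrite /lin -sumrB; apply: eq_bigr => i _; rewrite scalerBl.
by rewrite mulrBl expr2 subrK.
Qed.

End FrameOps.

(** Some coordinate change on the line makes the coefficient of y^2 nonzero:
    exchanging x and y or, for a multiple of x y, replacing x by x - y. *)
Lemma hyp_dim (K : fieldType) (F : frame K) c0 c1 c2 :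
  (c0, c1, c2) != (0, 0, 0) -> dim0_degree 2 (hyp F c0 c1 c2).
Proof.
case: (eqVneq c2 0) => [->|c20 _]; last exact: hyp_dim_main.
case: (eqVneq c0 0) => [->|c00 _]; last by rewrite -hyp_swap; exact: hyp_dim_main.
case: (eqVneq c1 0) => [->|c10 _]; first by rewrite eqxx.
by rewrite -hyp_shear; exact: hyp_dim_main.
Qed.

Section BaseChange.
Variables (A B : comNzRingType) (phi : {rmorphism A -> B}).

Program Definition map_frame (F : frame A) : frame B :=
  @Frame B (phi \o fr F) (phi \o fp F) (phi \o fp' F) (phi \o fv F)
    (phi \o fx F) (phi \o fy F) _ _ _ _ _ _ _.
Next Obligation. by move=> F i j; rewrite /= -!rmorphM -!rmorphD frameX rmorph_nat. Qed.
Next Obligation.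
move=> F; transitivity (phi (\sum_i fv F i * fp F i)); last by rewrite frame_vp rmorph0.
by rewrite rmorph_sum; apply: eq_bigr => i _; rewrite rmorphM.
Qed.
Next Obligation.
move=> F; transitivity (phi (\sum_i fv F i * fp' F i)); last by rewrite frame_vp' rmorph0.
by rewrite rmorph_sum; apply: eq_bigr => i _; rewrite rmorphM.
Qed.
Next Obligation.
move=> F; transitivity (phi (\sum_i fx F i * fp F i)); last by rewrite frame_xp rmorph1.
by rewrite rmorph_sum; apply: eq_bigr => i _; rewrite rmorphM.
Qed.
Next Obligation.
move=> F; transitivity (phi (\sum_i fx F i * fp' F i)); last by rewrite frame_xp' rmorph0.
by rewrite rmorph_sum; apply: eq_bigr => i _; rewrite rmorphM.
Qed.
Next Obligation.
move=> F; transitivity (phi (\sum_i fy F i * fp F i)); last by rewrite frame_yp rmorph0.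
by rewrite rmorph_sum; apply: eq_bigr => i _; rewrite rmorphM.
Qed.
Next Obligation.
move=> F; transitivity (phi (\sum_i fy F i * fp' F i)); last by rewrite frame_yp' rmorph1.
by rewrite rmorph_sum; apply: eq_bigr => i _; rewrite rmorphM.
Qed.

Lemma map_lin a : map_mpoly phi (lin a) = lin (phi \o a).
Proof.
rewrite /lin rmorph_sum; apply: eq_bigr => i _ /=.
by rewrite map_mpolyZ /varX map_mpolyX.
Qed.

Lemma map_quad F c0 c1 c2 :
  map_mpoly phi (quad F c0 c1 c2) = quad (map_frame F) (phi c0) (phi c1) (phi c2).
Proof.
by rewrite /quad !rmorphD /= !map_mpolyZ !rmorphXn rmorphM /= !map_lin.
Qed.

Lemma base_change_ideal (I : set (Spoly A)) : is_ideal (base_change phi I).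
Proof.
split.
- by exists 0%N, (fun _ => 0), (fun _ => 0); split=> [[]//|]; rewrite big_ord0.
- move=> _ _ [k [a [g [Ig ->]]]] [k' [a' [g' [Ig' ->]]]].
  exists (k + k')%N, (fun i => match fintype.split i with inl j => a j | inr j => a' j end),
    (fun i => match fintype.split i with inl j => g j | inr j => g' j end).
  split=> [i|]; first by case: splitP.
  rewrite big_split_ord /=; congr (_ + _); apply: eq_bigr => i _.
    by case: splitP => j /=; [move/val_inj-> | have := ltn_ord i; lia].
  by case: splitP => j /=; [have := ltn_ord j; lia | move/addnI/val_inj->].
- move=> f _ [k [a [g [Ig ->]]]]; exists k, (fun i => f * a i), g; split=> //.
  by rewrite mulr_sumr; apply: eq_bigr => i _; rewrite mulrA.
Qed.

Lemma base_change_sub (I : set (Spoly A)) (J : set (Spoly B)) : is_ideal J ->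
  (forall f, I f -> J (map_mpoly phi f)) -> base_change phi I `<=` J.
Proof.
move=> HJ HI _ [k [a [g [Ig ->]]]]; apply: ideal_sum => // i _.
by case: HJ => _ _ JM; apply/JM/HI.
Qed.

Lemma base_change_in (I : set (Spoly A)) f : I f -> base_change phi I (map_mpoly phi f).
Proof.
by move=> If; exists 1%N, (fun _ => 1), (fun _ => f); split=> //; rewrite big_ord1 mul1r.
Qed.

Lemma base_change_hyp F c0 c1 c2 : base_change phi (hyp F c0 c1 c2) =
  hyp (map_frame F) (phi c0) (phi c1) (phi c2).
Proof.
apply/seteqP; split.
  apply: base_change_sub; first exact: hyp_ideal.
  move=> f [a [b ->]]; exists (map_mpoly phi a), (map_mpoly phi b).
  by rewrite rmorphD !rmorphM /= map_lin map_quad.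
apply: idl2_sub; first exact: base_change_ideal.
- by rewrite -map_lin; apply/base_change_in/idl2_l.
- by rewrite -map_quad; apply/base_change_in/idl2_q.
Qed.

End BaseChange.

Lemma base_change_id (A : comNzRingType) (I : set (Spoly A)) : is_ideal I ->
  base_change (idfun : {rmorphism A -> A}) I = I.
Proof.
move=> HI.
have E f : map_mpoly (idfun : {rmorphism A -> A}) f = f.
  by apply/mpolyP => m; rewrite mcoeff_map_mpoly.
apply/seteqP; split; first by apply: base_change_sub => // f; rewrite E.
by move=> f If; rewrite -[f]E; exact: base_change_in.
Qed.

Lemma flat_quotient_field (K : fieldType) (I : set (Spoly K)) : is_ideal I ->
  flat_quotient I.
Proof.
move=> HI k r g Ig; case: (pselect (exists j, r j != 0)) => [[j rj]|nr].
  exists (fun i => if i == j then (r j)^-1 *: \sum_i r i *: g i else 0) => [i|].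
    by case: ifP => _; [exact: idealZ | case: HI].
  rewrite [RHS](bigD1 j) //= eqxx scalerA divff // scale1r [X in _ + X]big1 ?addr0 // => i /negbTE ->.
  by rewrite scaler0.
exists (fun _ => 0) => [_|]; first by case: HI.
rewrite !big1 // => i _; rewrite ?scaler0 //; have [->|ri] := eqVneq (r i) 0.
  by rewrite scale0r.
by case: nr; exists i.
Qed.

Lemma bezout_family k (r : 'I_k -> int) : exists (d : int) (s m : 'I_k -> int),
  (forall i, r i = d * m i) /\ d = \sum_i r i * s i.
Proof.
pose d := (\big[gcdn/0%N]_i `|r i|%N); exists d%:Z.
have [s Hs] : exists s : 'I_k -> int, d%:Z = \sum_i r i * s i.
  rewrite /d; elim/big_ind: _ => [|x y [s Hs] [s' Hs']|i _].
  - by exists (fun _ => 0); rewrite big1 // => i _; rewrite mulr0.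
  - have [u [w E]] := Bezoutz x%:Z y%:Z.
    exists (fun i => s i * u + s' i * w).
    under eq_bigr do rewrite mulrDr !mulrA.
    rewrite big_split /= -!mulr_suml -Hs -Hs'.
    by move: E; rewrite /gcdz /= mulrC [w * _]mulrC => ->.
  - exists (fun j => if j == i then sgz (r i) else 0).
    rewrite (bigD1 i) //= eqxx big1 => [|j /negbTE ->]; last by rewrite mulr0.
    by rewrite addr0 mulrC abszEsg.
exists s, (fun i => (r i %/ d%:Z)%Z); split=> // i.
have dv : (d%:Z %| r i)%Z by rewrite /dvdz /=; exact: biggcdn_inf.
by rewrite mulrC divzK.
Qed.

(** Every finitely generated ideal of the integers is principal, so flatness is
    absence of torsion. *)
Lemma flat_quotient_int (I : set (Spoly int)) : is_ideal I ->
  (forall (n : int) f, n != 0 -> I (n *: f) -> I f) -> flat_quotient I.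
Proof.
move=> HI tf k r g; have [d [s [m [Hm Hd]]]] := bezout_family r.
have -> : \sum_i r i *: g i = d *: \sum_i m i *: g i.
  by rewrite scaler_sumr; apply: eq_bigr => i _; rewrite Hm scalerA.
have [d0|dn] := eqVneq d 0.
  move=> _; exists (fun _ => 0) => [_|]; first by case: HI.
  by rewrite d0 scale0r big1 // => i _; rewrite scaler0.
move=> /(tf _ _ dn) IG; exists (fun i => s i *: \sum_i m i *: g i) => [i|].
  exact: idealZ.
by rewrite {1}Hd scaler_suml; apply: eq_bigr => i _; rewrite scalerA.
Qed.

Lemma intr_Fp_dvd p (x : int) : prime p -> (x%:~R == 0 :> 'F_p) = (p%:Z %| x)%Z.
Proof. by move=> pp; rewrite (dvdz_pcharf (pchar_Fp pp)). Qed.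

(** Gauss's lemma, by removing from n one prime p at a time: modulo p the product
    q h vanishes and q does not. *)
Lemma gauss_content (q g h : {poly {poly int}}) (n : nat) : (0 < n)%N ->
  (forall p, prime p -> map_poly (map_poly (intr : int -> 'F_p)) q != 0) ->
  n%:R * g = q * h -> exists h', h = n%:R * h'.
Proof.
move=> n0 qp; elim/ltn_ind: n n0 g h => n IH n0 g h E.
have [n1|n1] := leqP n 1; first by exists h; have -> : n = 1%N by [lia]; rewrite mul1r.
have pp := pdiv_prime n1; set p := pdiv n in pp.
have /dvdnP[m Em] : (p %| n)%N by exact: pdiv_dvd.
have [h1 H1] : exists h1, h = p%:R * h1.
  have := congr1 (map_poly (map_poly (intr : int -> 'F_p))) E.
  rewrite !rmorphM /= rmorph_nat.
  have -> : n%:R = 0 :> {poly {poly 'F_p}}.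
    by rewrite Em mulnC natrM -[p%:R]polyC_natr -[p%:R]polyC_natr pchar_Fp_0 // !polyC0 mul0r.
  rewrite mul0r => /esym/eqP; rewrite mulf_eq0 (negbTE (qp _ pp)) /= => /eqP h0.
  exists (map_poly (map_poly (fun x => (x %/ p%:Z)%Z)) h).
  apply/polyP => i; apply/polyP => j.
  have dv : (p%:Z %| h`_i`_j)%Z.
    rewrite -intr_Fp_dvd //; have := congr1 (fun f : {poly {poly 'F_p}} => f`_i`_j) h0.
    by rewrite !coef_map /= !coef0 => ->.
  rewrite -[p%:R]polyC_natr -[p%:R]polyC_natr !coefCM !coef_map_id0 ?div0z ?map_poly0 //.
  by rewrite natz mulrC divzK.
have p0 : p%:R != 0 :> {poly {poly int}}.
  rewrite -[p%:R]polyC_natr -[p%:R]polyC_natr !polyC_eq0 natz.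
  by rewrite eqz_nat -lt0n prime_gt0.
have m0 : (0 < m)%N by lia.
have mn : (m < n)%N by rewrite Em; have := prime_gt1 pp; nia.
have E1 : m%:R * g = q * h1.
  by apply: (mulfI p0); rewrite mulrA -natrM mulnC -Em E H1 mulrCA.
have [h' H'] := IH m mn m0 g h1 E1.
by exists h'; rewrite H1 H' mulrA -natrM mulnC -Em.
Qed.

(** The Bezout relation makes the form nonzero modulo every prime, and
    [gauss_content] applies to it. *)
Lemma hyp_torsion_free (F : frame int) (c0 c1 c2 s0 s1 s2 : int) :
  c0 * s0 + c1 * s1 + c2 * s2 = 1 ->
  forall (n : int) f, n != 0 -> hyp F c0 c1 c2 (n *: f) -> hyp F c0 c1 c2 f.
Proof.
move=> E n f n0 /hypP[h]; rewrite psiZ => Hh.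
have [k [k0 [e [e0 Hk]]]] : exists k : nat, (0 < k)%N /\
    exists e : int, e * e = 1 /\ n = e * k%:Z.
  exists `|n|%N; split; first by rewrite absz_gt0.
  exists (sgz n); split; first by rewrite mulz_sg n0.
  exact: intEsg.
have E1 : k%:R * psi F f = bform c0 c1 c2 * (e%:P%:P * h).
  rewrite mulrCA -Hh mulrA -!polyCM Hk mulrA e0 mul1r -polyC_natr -polyC_natr natz //.
have [] := gauss_content k0 _ E1.
  move=> p pp; apply/eqP => q0.
  have dv (c : int) : c%:~R = 0 :> 'F_p -> (p%:Z %| c)%Z.
    by rewrite -intr_Fp_dvd // => ->.
  have [a0 a1 a2] := coef_bform c0 c1 c2.
  have cf i j : ((bform c0 c1 c2)`_i`_j)%:~R = 0 :> 'F_p.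
    have := congr1 (fun f : {poly {poly 'F_p}} => f`_i`_j) q0.
    by rewrite !coef_map /= !coef0.
  have d0 := dv _ (cf 0%N 2%N); have d1 := dv _ (cf 1%N 1%N); have d2 := dv _ (cf 2%N 0%N).
  move: d0 d1 d2; rewrite a0 a1 a2 !coefZ coefXn coefX coefC /= !mulr1 => d0 d1 d2.
  have : (p%:Z %| 1%R)%Z by rewrite -E !rpredD // dvdz_mulr.
  by rewrite dvdz1 /=; have := prime_gt1 pp; lia.
move=> h' Hh'; apply/hypP; exists h'.
have nk : k%:R != 0 :> {poly {poly int}}.
  by rewrite -[k%:R]polyC_natr -[k%:R]polyC_natr !polyC_eq0 natz eqz_nat -lt0n.
by apply: (mulfI nk); rewrite E1 Hh' mulrCA.
Qed.

(** The Bezout relation survives in every residue field, so that all the fibres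
    are cut out by a nonzero binary quadratic form. *)
Lemma hilb2_hyp_int (F : frame int) (c0 c1 c2 s0 s1 s2 : int) :
  c0 * s0 + c1 * s1 + c2 * s2 = 1 -> hilb2 int (hyp F c0 c1 c2).
Proof.
move=> E; split.
- apply: hyp_closed; apply/eqP => -[z0 z1 z2].
  by move: E; rewrite z0 z1 z2 !mul0r !addr0.
- apply: flat_charts; [exact: hyp_ideal|exact: hyp_homog|].
  by apply: flat_quotient_int; [exact: hyp_ideal | exact: hyp_torsion_free E].
- move=> K phi _; rewrite base_change_hyp; apply: hyp_dim.
  apply/eqP => -[z0 z1 z2]; have := congr1 phi E.
  by rewrite !rmorphD !rmorphM z0 z1 z2 !mul0r !addr0 rmorph1 => /eqP; rewrite eq_sym oner_eq0.
Qed.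

Lemma hilb2_hyp_rat (F : frame rat) c0 c1 c2 : (c0, c1, c2) != (0, 0, 0) ->
  hilb2 rat (hyp F c0 c1 c2).
Proof.
move=> nz; split.
- exact: hyp_closed.
- apply: flat_charts; [exact: hyp_ideal|exact: hyp_homog|].
  by apply: flat_quotient_field; exact: hyp_ideal.
- move=> K phi _; rewrite base_change_hyp; apply: hyp_dim.
  by apply: contra nz => /eqP[] /eqP + /eqP + /eqP; rewrite !fmorph_eq0 => /eqP-> /eqP-> /eqP->.
Qed.

Lemma hyp_extends (F : frame int) (c0 c1 c2 s0 s1 s2 : int) :
  c0 * s0 + c1 * s1 + c2 * s2 = 1 ->
  extends_to (hyp (map_frame (intr : {rmorphism int -> rat}) F) c0%:~R c1%:~R c2%:~R)
    (hyp F c0 c1 c2).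
Proof.
move=> E; split; first exact: hilb2_hyp_int E.
rewrite (base_change_hyp (intr : {rmorphism int -> rat})); apply/seteqP; split.
  apply: hyp_saturated; apply/eqP => -[] /eqP + /eqP + /eqP.
  rewrite !intr_eq0 => /eqP z0 /eqP z1 /eqP z2.
  by move: E; rewrite z0 z1 z2 !mul0r !addr0.
by apply: sat_sub; exact: hyp_ideal.
Qed.

(** * Uniqueness of the integral model *)

Section Restriction.

Local Notation mapQ := (map_mpoly (intr : int -> rat)).

Lemma mapQD (f g : Spoly int) : mapQ (f + g) = mapQ f + mapQ g.
Proof. exact: (rmorphD (map_mpoly (intr : {rmorphism int -> rat}))). Qed.

Lemma mapQM (f g : Spoly int) : mapQ (f * g) = mapQ f * mapQ g.
Proof. exact: (rmorphM (map_mpoly (intr : {rmorphism int -> rat}))). Qed.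

Lemma mapQXn (f : Spoly int) n : mapQ (f ^+ n) = mapQ f ^+ n.
Proof. exact: (rmorphXn (map_mpoly (intr : {rmorphism int -> rat}))). Qed.

Lemma mapQZ (n : int) (f : Spoly int) : mapQ (n *: f) = n%:~R *: mapQ f.
Proof. exact: (map_mpolyZ (intr : {rmorphism int -> rat})). Qed.

Lemma mapQ0 : mapQ (0 : Spoly int) = 0.
Proof. exact: (rmorph0 (map_mpoly (intr : {rmorphism int -> rat}))). Qed.

Lemma mapQX i : mapQ (varX int i) = varX rat i.
Proof. exact: (map_mpolyX (intr : {rmorphism int -> rat})). Qed.

Lemma map_int_inj : injective (map_mpoly (intr : int -> rat) : Spoly int -> Spoly rat).
Proof.
move=> f g E; apply/mpolyP => m; have := congr1 (mcoeff m) E.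
by rewrite !mcoeff_map_mpoly => /intr_inj.
Qed.

Lemma map_pihomog (A B : comNzRingType) (phi : {rmorphism A -> B}) d (f : Spoly A) :
  pihomog mdeg d (map_mpoly phi f) = map_mpoly phi (pihomog mdeg d f).
Proof.
rewrite {1}[f]mpolyE [in RHS]pihomogE !rmorph_sum /= linear_sum /=.
rewrite [RHS]big_mkcond; apply: eq_bigr => m _.
rewrite !map_mpolyZ map_mpolyX linearZ /= pihomogX.
by case: ifP; rewrite ?scaler0.
Qed.

Lemma mpoly_denom (f : Spoly rat) :
  exists (n : int) (g : Spoly int), n != 0 /\ n%:~R *: f = map_mpoly intr g.
Proof.
elim/mpoly3_ind: f => [c|i|f g [n [f' [n0 Hf]]] [m [g' [m0 Hg]]]|f g [n [f' [n0 Hf]]] [m [g' [m0 Hg]]]].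
- exists (denq c), (mpolyC 3 (numq c)); split; first exact: denq_neq0.
  rewrite map_mpolyC -mul_mpolyC -mpolyCM; congr mpolyC.
  by rewrite mulrC -[X in X * _](divq_num_den c) divfK // intr_eq0 denq_neq0.
- exists 1, (varX int i); split=> //.
  by rewrite scale1r mapQX.
- exists (n * m), (m *: f' + n *: g'); split; first by rewrite mulf_neq0.
  rewrite mapQD !mapQZ -Hf -Hg !scalerA scalerDr.
  by rewrite !intrM [m%:~R * _]mulrC.
- exists (n * m), (f' * g'); split; first by rewrite mulf_neq0.
  by rewrite mapQM -Hf -Hg -scalerAl -scalerAr scalerA intrM.
Qed.

Lemma base_change_denom (I : set (Spoly int)) f : is_ideal I ->
  base_change (intr : int -> rat) I f ->
  exists (n : int) (g : Spoly int), [/\ n != 0, I g & n%:~R *: f = map_mpoly intr g].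
Proof.
move=> HI [k [a [g [Ig ->]]]]; elim/big_ind: _ => [|f1 f2 [n [f' [n0 If Hf]]] [m [g' [m0 Ig' Hg]]]|i _].
- by exists 1, 0; split=> //; [case: HI | rewrite scaler0 mapQ0].
- exists (n * m), (m *: f' + n *: g'); split; first by rewrite mulf_neq0.
    by case: (HI) => _ ID _; apply: ID; exact: idealZ.
  rewrite mapQD !mapQZ -Hf -Hg !scalerA scalerDr.
  by rewrite !intrM [m%:~R * _]mulrC.
- have [n [h [n0 Hh]]] := mpoly_denom (a i).
  exists n, (h * g i); split=> //; first by case: HI => _ _; apply.
  by rewrite mapQM -Hh scalerAl.
Qed.

Lemma chart_ideal_sub (A : comNzRingType) (I : set (Spoly A)) i n f : is_ideal I ->
  I (varX A i ^+ n * f) -> chart_ideal I i f.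
Proof.
move=> HI If; exists (varX A i ^+ n * f), (- (\sum_(e < n) varX A i ^+ e) * f).
split=> //; rewrite mulrA mulrN -subrX1 -mulrDl opprB addrC subrK mul1r //.
Qed.

(** Flatness for the principal ideal (n) shows that f is in every chart ideal, hence
    that a power of each variable multiplies f into I; saturation concludes. *)
Lemma flat_torsion_free (I : set (Spoly int)) (n : int) f : closed_subscheme I ->
  flat_subscheme I -> forall d, homog d f -> n != 0 -> I (n *: f) -> I f.
Proof.
move=> [HI HH sI] fI d hf n0 Inf; apply: sI => i.
have [] := fI i 1%N (fun _ => n) (fun _ => f).
  rewrite big_ord1; apply: (@chart_ideal_sub _ _ _ 0) => //.
  by rewrite expr0 mul1r.
move=> h Ih; rewrite !big_ord1 => E.
have {}E : f = h ord0.
  apply/mpolyP => m; have := congr1 (mcoeff m) E; rewrite !mcoeffZ.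
  exact: mulfI.
have [D0 HD] := chart_hom HI HH (Ih ord0); rewrite -E in HD.
exists (maxn D0 d.+1 - d)%N; have := HD (maxn D0 d.+1) (leq_maxl _ _).
rewrite /hom_at (bigD1 (Ordinal (leq_maxr D0 d.+1))) //= pihomog_dE // big1 ?addr0 //.
move=> j /eqP nj; rewrite (pihomog_ne0 _ hf) ?mulr0 //.
by apply/eqP => E2; apply: nj; apply: val_inj; exact: esym E2.
Qed.

(** An integral point is recovered from its generic fibre J as the ideal of the
    integral polynomials in J: clear the denominators, then divide by them using
    [flat_torsion_free]. *)
Lemma integral_model (I : set (Spoly int)) (J : set (Spoly rat)) :
  hilb2 rat J -> extends_to J I -> forall f, I f <-> J (map_mpoly intr f).
Proof.
move=> [[JI JH _] _ _] [[[HI HH sI] fI _] EJ] f; split=> [If|].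
  by rewrite -EJ; apply: sat_sub; [exact: base_change_ideal|exact: base_change_in].
move=> Jf; rewrite (pihomog_partitionE (leqnn (msize f))); apply: ideal_sum => // d _.
have {Jf} := JH _ Jf d; rewrite map_pihomog -EJ => Jd.
apply: (sI) => i; have [n Hn] := Jd i; exists n.
have [m [g [m0 Ig Eg]]] := base_change_denom HI Hn.
have hX : homog (n + d) (varX int i ^+ n * pihomog mdeg d f).
  by apply: homogM; [exact: homogXS (homog_varX _ _)|exact: pihomogP].
apply: (flat_torsion_free _ fI hX m0) => //.
suff -> : m *: (varX int i ^+ n * pihomog mdeg d f) = g by [].
apply: map_int_inj; by rewrite -Eg mapQZ mapQM mapQXn mapQX.
Qed.

Lemma integral_model_unique (I I' : set (Spoly int)) (J : set (Spoly rat)) :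
  hilb2 rat J -> extends_to J I -> extends_to J I' -> I = I'.
Proof.
move=> HJ e e'; apply/seteqP.
by split=> f; rewrite (integral_model HJ e) (integral_model HJ e').
Qed.

End Restriction.

(** * Length-two subschemes over a field *)

Section Field.
Variable K : fieldType.
Implicit Types (J : set (Spoly K)) (f g : Spoly K).

Lemma ideal_cong J f g : is_ideal J -> J (f - g) -> J g -> J f.
Proof. by case=> _ ID _ Jfg Jg; rewrite -(subrK g f); apply: ID. Qed.

Lemma ideal_sub_trans J f g h : is_ideal J -> J (f - g) -> J (g - h) -> J (f - h).
Proof. by move=> [_ ID _] a b; rewrite -(subrK g f) -addrA; apply: ID. Qed.

Definition comb n (e : 'I_n -> Spoly K) (c : 'rV[K]_n) := \sum_i c 0 i *: e i.

Lemma comb_mul n (e e' : 'I_n -> Spoly K) (M : 'M[K]_n) J g c : is_ideal J ->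
  (forall j, J (g * e j - comb e' (row j M))) ->
  J (g * comb e c - comb e' (c *m M)).
Proof.
move=> HJ HM.
have -> : g * comb e c - comb e' (c *m M) = \sum_j c 0 j *: (g * e j - comb e' (row j M)).
  under [RHS]eq_bigr do rewrite scalerBr; rewrite sumrB /comb mulr_sumr; congr (_ - _).
    by apply: eq_bigr => j _; rewrite scalerAr.
  under eq_bigr do rewrite mxE scaler_suml.
  rewrite exchange_big; apply: eq_bigr => j _ /=; rewrite scaler_sumr.
  by apply: eq_bigr => k _; rewrite scalerA mxE.
by apply: ideal_sum => // j _; exact: idealZ.
Qed.

Lemma combB n (e : 'I_n -> Spoly K) c c' : comb e c - comb e c' = comb e (c - c').
Proof. by rewrite /comb -sumrB; apply: eq_bigr => i _; rewrite !mxE scalerBl. Qed.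

Lemma comb0 n (e : 'I_n -> Spoly K) : comb e 0 = 0.
Proof. by rewrite /comb big1 // => i _; rewrite mxE scale0r. Qed.

Lemma comb_delta n (e : 'I_n -> Spoly K) i : comb e (delta_mx 0 i) = e i.
Proof.
rewrite /comb (bigD1 i) //= mxE !eqxx scale1r big1 ?addr0 // => j /negbTE ji.
by rewrite mxE ji andbF scale0r.
Qed.

Lemma comb_homog n d (e : 'I_n -> Spoly K) c : (forall i, homog d (e i)) -> homog d (comb e c).
Proof. by move=> he; apply: homog_sum => i _; exact: homogZ. Qed.

Definition basis_mod J d n (e : 'I_n -> Spoly K) :=
  [/\ forall i, homog d (e i), forall f, homog d f -> exists c, J (f - comb e c)
    & forall c, J (comb e c) -> c = 0].

Lemma dim0_basis J n : is_ideal J -> dim0_degree n J ->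
  exists d0, forall d, (d0 <= d)%N -> exists e : 'I_n -> Spoly K, basis_mod J d e.
Proof.
move=> HJ [d0 H]; exists d0 => d /H[e he He]; exists e; split=> // [f /He[c [Jc _]]|c Jc].
  by exists c.
have hc : homog d (comb e c) by exact: comb_homog.
have [c' [_ U]] := He _ hc.
by rewrite -(U c) ?(U 0) //; rewrite -/(comb _ _) ?comb0 ?subr0 ?subrr //; case: HJ.
Qed.

(** The matrix of the multiplication by g from degree d to degree d' of the quotient
    by J. *)
Lemma mult_matrix J d d' n (e e' : 'I_n -> Spoly K) g k : homog k g -> (d' = k + d)%N ->
  basis_mod J d e -> basis_mod J d' e' ->
  exists M : 'M[K]_n, forall j, J (g * e j - comb e' (row j M)).
Proof.
move=> hg E [he _ _] [_ Hc _].
have /choice[c HM] : forall j, exists c, J (g * e j - comb e' c).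
  by move=> j; apply: Hc; rewrite E; apply: homogM.
by exists (\matrix_j c j) => j; rewrite rowK.
Qed.

(** In large degrees the quotients by J and J' have the same dimension, so the
    projection between them is an isomorphism; saturated ideals that agree in
    large degrees are equal. *)
Lemma closed_dim_eq J J' n : closed_subscheme J -> closed_subscheme J' ->
  dim0_degree n J -> dim0_degree n J' -> J `<=` J' -> J = J'.
Proof.
move=> [HJ HH sJ] [HJ' HH' _] /(dim0_basis HJ)[d0 H] /(dim0_basis HJ')[d0' H'] sub.
have key d f : (maxn d0 d0' <= d)%N -> homog d f -> J' f -> J f.
  rewrite geq_max => /andP[/H[e [he He Ue]] /H'[e' [he' He' Ue']]] hf J'f.
  have [c Hc] := He f hf; suff c0 : c = 0 by move: Hc; rewrite c0 comb0 subr0.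
  have be : basis_mod J d e by []. have be' : basis_mod J' d e' by [].
  have h1 : homog 0 (1 : Spoly K) by exact: dhomog1.
  have /choice[m Hm] : forall k, exists c, J (e' k - comb e c) by move=> k; exact: He.
  have /choice[p Hp] : forall k, exists c, J' (e k - comb e' c) by move=> k; exact: He'.
  pose M := \matrix_k m k; pose N := \matrix_k p k.
  have HM k : J' (1 * e' k - comb e (row k M)) by rewrite mul1r rowK; exact: sub.
  have HN k : J' (1 * e k - comb e' (row k N)) by rewrite mul1r rowK.
  have MN : M *m N = 1%:M.
    apply/row_matrixP => k; rewrite row1 row_mul.
    have a := comb_mul (row k M) HJ' HN; have b := HM k.
    rewrite mul1r in a; rewrite mul1r in b.
    have := ideal_sub_trans HJ' b a; rewrite -{1}[e' k]comb_delta combB.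
    by move/Ue'/eqP; rewrite subr_eq0 => /eqP ->.
  have NM := mulmx1C MN.
  have J'c : J' (comb e c).
    by apply: ideal_cong J'f => //; rewrite -opprB; apply: idealN => //; exact: sub.
  have := comb_mul c HJ' HN; rewrite mul1r => a.
  have : J' (comb e' (c *m N)).
    by apply: ideal_cong J'c => //; rewrite -opprB; exact: idealN.
  by move/Ue' => cN; rewrite -[c]mulmx1 -NM mulmxA cN mul0mx.
apply/seteqP; split=> // f J'f.
rewrite (pihomog_partitionE (leqnn (msize f))); apply: ideal_sum => // d _.
apply: sJ => i; exists (maxn d0 d0'); apply: (key (maxn d0 d0' + d)%N).
- exact: leq_addr.
- by apply: homogM; [exact: homogXS (homog_varX _ _)|exact: pihomogP].
- by case: HJ' => _ _; apply; exact: HH'.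
Qed.

Lemma addmxE m n (M N : 'M[K]_(m, n)) i j : (M + N) i j = M i j + N i j.
Proof. by rewrite mxE. Qed.

Lemma det2 (M : 'M[K]_2) : \det M = M 0 0 * M 1 1 - M 0 1 * M 1 0.
Proof.
rewrite (expand_det_row _ 0) big_ord_recl big_ord1 /cofactor !det_mx11 !mxE /=.
rewrite !addn0 !expr0 !mul1r expr1 mulN1r mulrN.
by congr (_ * M _ _ - M _ _ * M _ _); apply: val_inj.
Qed.

(** A singular 2 x 2 matrix is a product of a column and a row. *)
Lemma singular2 (M : 'M[K]_2) (u : 'rV_2) (z : 'cV_2) k l : \det M = 0 ->
  (u *m M) 0 k * (M *m z) l 0 = (u *m M *m z) 0 0 * M l k.
Proof.
rewrite det2 => /eqP; rewrite subr_eq0 => /eqP E.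
have R a b c d : M a b * M c d = M a d * M c b.
  have o2 (i : 'I_2) : i = 0 \/ i = 1.
    by case: i => -[|[|//]] p; [left|right]; apply: val_inj.
  by case: (o2 a) => ->; case: (o2 b) => ->; case: (o2 c) => ->; case: (o2 d) => ->;
    first [exact: E | exact: esym E | exact: mulrC | by []
          | by rewrite mulrC E mulrC | by rewrite mulrC -E mulrC].
rewrite !mxE mulr_suml [RHS]mulr_suml.
under eq_bigr do rewrite mulr_sumr.
under [RHS]eq_bigr do rewrite mxE mulr_suml mulr_suml.
rewrite [RHS]exchange_big; apply: eq_bigr => a _; apply: eq_bigr => b _ /=.
have -> : u 0 a * M a k * (M l b * z b 0) = u 0 a * (M a k * M l b) * z b 0 by rewrite !mulrA.
by rewrite R mulrA mulrAC.
Qed.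

(** A linear system of singular 2 x 2 matrices has a common left kernel or a common
    right kernel. Taking M i0 nonzero with kernel vectors u and z, [singular2]
    applied to M i0 + M i gives u (M i) z = 0, and then, applied to M i, that
    u M i or M i z vanishes. If u M i and M j z are nonzero it follows that
    M i z = 0 and u M j = 0, which contradicts [singular2] for M i + M j. Only the
    M i and their pairwise sums are used, so that the field may be finite. *)
Lemma nonsingular_member (M : 'I_3 -> 'M[K]_2) :
  (forall u : 'rV_2, u != 0 -> exists i, u *m M i != 0) ->
  (forall z : 'cV_2, z != 0 -> exists i, M i *m z != 0) ->
  exists t : 'I_3 -> K, \det (\sum_i t i *: M i) != 0.
Proof.
move=> Hu Hz; apply: contrapT => nt.
have sg t : \det (\sum_i t i *: M i) = 0.
  by apply/eqP; apply: contraT => d; case: nt; exists t.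
have s1 i : \det (M i) = 0.
  rewrite -(sg (fun j => (j == i)%:R)) (bigD1 i) //= eqxx scale1r big1 ?addr0 //.
  by move=> j /negbTE ->; rewrite scale0r.
have s2 i j : \det (M i + M j) = 0.
  rewrite -(sg (fun k => (k == i)%:R + (k == j)%:R)).
  under eq_bigr do rewrite scalerDl.
  rewrite big_split /= (bigD1 i) //= eqxx scale1r big1 ?addr0 => [|k /negbTE ->]; last by rewrite scale0r.
  rewrite (bigD1 j) //= eqxx scale1r big1 ?addr0 // => k /negbTE ->; by rewrite scale0r.
have nzrow : (const_mx 1 : 'rV[K]_2) != 0.
  by apply/eqP => /rowP/(_ 0)/eqP; rewrite !mxE oner_eq0.
have [i0 P0] := Hu _ nzrow.
have [[k0 l0] /= Pkl] : exists kl, M i0 kl.1 kl.2 != 0.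
  apply: contrapT => h; case/eqP: P0; suff -> : M i0 = 0 by rewrite mulmx0.
  by apply/matrixP => a b; rewrite mxE; apply/eqP; apply: contraT => d; case: h; exists (a, b).
have [u u0 uP] : exists2 u : 'rV_2, u != 0 & u *m M i0 = 0.
  by move/eqP: (s1 i0) => /det0P.
have [z z0 Pz] : exists2 z : 'cV_2, z != 0 & M i0 *m z = 0.
  have /eqP/det0P[w w0 wE] : \det (M i0)^T = 0 by rewrite det_tr.
  exists w^T; first by apply: contra w0 => /eqP/(congr1 trmx); rewrite trmxK trmx0 => ->.
  by apply: trmx_inj; rewrite trmx_mul trmxK wE trmx0.
have uMz i : (u *m M i *m z) 0 0 = 0.
  have := singular2 u z l0 k0 (s1 i); have := singular2 u z l0 k0 (s2 i0 i).
  rewrite !mulmxDr !mulmxDl uP Pz !mul0mx !add0r => -> /eqP.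
  by rewrite [(M i0 + M i) _ _]mxE mulrDr -subr_eq0 addrK mulf_eq0 (negbTE Pkl) orbF => /eqP.
have [i ui] := Hu _ u0; have [j jz] := Hz _ z0.
have uk : exists k, (u *m M i) 0 k != 0.
  apply: contrapT => h; case/eqP: ui; apply/rowP => k; rewrite [RHS]mxE.
  by apply/eqP; apply: contraT => d; case: h; exists k.
have zl : exists l, (M j *m z) l 0 != 0.
  apply: contrapT => h; case/eqP: jz; apply/colP => k; rewrite [RHS]mxE.
  by apply/eqP; apply: contraT => d; case: h; exists k.
case: uk => k uk; case: zl => l zl.
have iz l' : (M i *m z) l' 0 = 0.
  have /eqP := singular2 u z k l' (s1 i).
  by rewrite uMz mul0r mulf_eq0 (negbTE uk) /= => /eqP.
have uj k' : (u *m M j) 0 k' = 0.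
  have /eqP := singular2 u z k' l (s1 j).
  by rewrite uMz mul0r mulf_eq0 (negbTE zl) orbF => /eqP.
have /eqP := singular2 u z k l (s2 i j).
rewrite !mulmxDr !mulmxDl !addmxE !uMz addr0 mul0r uj iz addr0 add0r.
by rewrite mulf_eq0 (negbTE uk) (negbTE zl).
Qed.

(** Multiplication by X_0, X_1 and X_2 from degree d to degree d + 1 of the quotient
    is given by three 2 x 2 matrices: they have no common left kernel since J is
    saturated and no common right kernel since the variables generate the
    polynomials of positive degree. By [nonsingular_member] some linear form acts
    bijectively in one large degree, therefore surjectively and, by dimension,
    bijectively in all larger ones. *)
Lemma exists_nonzero_divisor J : closed_subscheme J -> dim0_degree 2 J ->
  exists t : 'I_3 -> K, forall e g, homog e g -> J (lin t * g) -> J g.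
Proof.
move=> [HJ HH sJ] /(dim0_basis HJ)[d0 H]; have [J0 JD JM] := HJ.
have [e be] := H d0 (leqnn _); have [e' be'] := H d0.+1 (leqnSn _).
have /choice[M HM] : forall i, exists M : 'M[K]_2,
    forall j, J (varX K i * e j - comb e' (row j M)).
  by move=> i; apply: (mult_matrix (homog_varX K i) _ be be').
have [t Ht] : exists t : 'I_3 -> K, \det (\sum_i t i *: M i) != 0.
  apply: nonsingular_member => [u u0|z z0]; apply: contrapT => h.
    have uM i : u *m M i = 0.
      by apply/eqP; apply: contraT => d; case: h; exists i.
    case/eqP: u0; case: be => _ _; apply; apply: sJ => i; exists 1%N.
    have := comb_mul u HJ (HM i); rewrite uM comb0 subr0 expr1; exact.
  have Mz i : M i *m z = 0.
    by apply/eqP; apply: contraT => d; case: h; exists i.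
  have [he' _ Ue'] := be'; have [_ He _] := be.
  case/eqP: z0; apply/colP => k; rewrite [RHS]mxE.
  have [g hg Eg] := homogS_split (he' k).
  have /choice[c Hc] : forall i, exists c, J (g i - comb e c) by move=> i; exact: He.
  have : J (e' k - comb e' (\sum_i c i *m M i)).
    have -> : comb e' (\sum_i c i *m M i) = \sum_i comb e' (c i *m M i).
      rewrite /comb exchange_big; apply: eq_bigr => j _ /=.
      by rewrite summxE scaler_suml.
    rewrite Eg -sumrB; apply: ideal_sum => // i _.
    apply: (ideal_sub_trans (g := varX K i * comb e (c i))) => //.
      by rewrite -mulrBr; apply: JM.
    exact: comb_mul.
  rewrite -{1}[e' k]comb_delta combB => /Ue'/eqP; rewrite subr_eq0 => /eqP E.
  have : (delta_mx 0 k *m z : 'M[K]_(1, 1)) = 0.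
    rewrite E mulmx_suml big1 // => i _; by rewrite -mulmxA Mz mulmx0.
  by rewrite -rowE => /matrixP/(_ 0 0); rewrite !mxE.
exists t; set x := lin t.
have hx : homog 1 x by exact: homog_lin.
have sur d : (d0 <= d)%N -> forall f, homog d.+1 f -> exists2 g, homog d g & J (f - x * g).
  move=> /subnK <-; elim: (d - d0)%N => [|k IH] f.
    rewrite add0n => hf; have [he' He' _] := be'; have [c Hc] := He' f hf.
    pose P := \sum_i t i *: M i.
    have uP : P \in unitmx by rewrite unitmxE unitfE.
    exists (comb e (c *m invmx P)); first by case: be => he _ _; exact: comb_homog.
    apply: (ideal_sub_trans HJ Hc); rewrite -opprB; apply: idealN => //.
    rewrite -{2}[c]mulmx1 -(mulVmx uP) mulmxA; apply: comb_mul => // j.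
    rewrite /x /lin mulr_suml /P.
    have -> : comb e' (row j (\sum_i t i *: M i)) = \sum_i t i *: comb e' (row j (M i)).
      rewrite /comb; under [RHS]eq_bigr do rewrite scaler_sumr.
      rewrite exchange_big; apply: eq_bigr => k _ /=.
      by rewrite mxE summxE scaler_suml; apply: eq_bigr => i _; rewrite !mxE scalerA.
    rewrite -sumrB; apply: ideal_sum => // i _.
    by rewrite -scalerAl -scalerBr; exact: idealZ.
  move=> hf; have [g hg ->] := homogS_split hf.
  have /choice[p Hp] : forall i, exists q, homog (k + d0) q /\ J (g i - x * q).
    by move=> i; have [q] := IH (g i) (hg i); exists q.
  exists (\sum_i varX K i * p i).
    apply: homog_sum => i _; rewrite addSn -add1n; apply: homogM; first exact: homog_varX.
    by case: (Hp i).
  rewrite mulr_sumr -sumrB; apply: ideal_sum => // i _.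
  by rewrite mulrCA -mulrBr; apply: (JM); case: (Hp i).
have inj d g : (d0 <= d)%N -> homog d g -> J (x * g) -> J g.
  move=> le hg Jxg; have [b bb] := H d le; have [b' bb'] := H d.+1 (leqW le).
  have [P HP] := mult_matrix hx (esym (add1n d)) bb bb'.
  have [hb Hb Ub] := bb; have [hb' Hb' Ub'] := bb'.
  have /choice[m Hm] : forall k, exists c, J (b' k - x * comb b c).
    move=> k; have [q hq Jq] := sur d le _ (hb' k); have [c Hc] := Hb q hq.
    by exists c; apply: (ideal_sub_trans HJ Jq); rewrite -mulrBr; apply: JM.
  pose N := \matrix_k m k.
  have NP : N *m P = 1%:M.
    apply/row_matrixP => k; rewrite row1 row_mul rowK.
    have := ideal_sub_trans HJ (Hm k) (comb_mul (m k) HJ HP).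
    by rewrite -{1}[b' k]comb_delta combB => /Ub'/eqP; rewrite subr_eq0 => /eqP ->.
  have PN := mulmx1C NP.
  have [c Hc] := Hb g hg; suff c0 : c = 0 by move: Hc; rewrite c0 comb0 subr0.
  have : J (comb b' (c *m P)).
    apply: (ideal_cong HJ (g := x * comb b c)).
      by rewrite -opprB; apply: idealN => //; exact: comb_mul.
    apply: (ideal_cong HJ (g := x * g)) => //; rewrite -mulrBr; apply: (JM).
    by rewrite -opprB; exact: idealN.
  by move/Ub' => cP; rewrite -[c]mulmx1 -PN mulmxA cP mul0mx.
move=> d g hg Jxg; apply: sJ => i; exists d0; apply: (inj (d0 + d)%N).
- exact: leq_addr.
- by apply: homogM => //; exact: homogXS (homog_varX _ _).
- by rewrite mulrCA; apply: JM.
Qed.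

(** Multiplication by a power of a linear nonzero divisor embeds the degree d part of
    the quotient into a space of dimension 2. *)
Lemma three_dependent J d (f : 'I_3 -> Spoly K) : closed_subscheme J ->
  dim0_degree 2 J -> (forall i, homog d (f i)) ->
  exists2 a : 'I_3 -> K, exists i, a i != 0 & J (\sum_i a i *: f i).
Proof.
move=> cJ dJ hf; have [HJ _ _] := cJ; have [J0 JD JM] := HJ.
have [t Ht] := exists_nonzero_divisor cJ dJ; set x := lin t in Ht.
have hx : homog 1 x by exact: homog_lin.
have [d0 H] := dim0_basis HJ dJ.
have [e [he He Ue]] := H (d0 + d)%N (leq_addr _ _).
have /choice[c Hc] : forall i, exists c, J (x ^+ d0 * f i - comb e c).
  by move=> i; apply: He; apply: homogM => //; exact: homogXS.
pose C : 'M[K]_(3, 2) := \matrix_i c i.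
have [w w0 wC] : exists2 w : 'rV[K]_3, w != 0 & w *m C = 0.
  have : (0 < \rank (kermx C))%N by rewrite mxrank_ker subn_gt0 (leq_ltn_trans (rank_leq_col C)).
  rewrite lt0n mxrank_eq0 => /rowV0Pn[w /sub_kermxP wC w0]; by exists w.
exists (fun i => w 0 i).
  apply: contrapT => h; case/eqP: w0; apply/rowP => i; rewrite [RHS]mxE.
  by apply/eqP; apply: contraT => n; case: h; exists i.
have cancel k g : homog d g -> J (x ^+ k * g) -> J g.
  elim: k g => [|k IH] g hg; first by rewrite expr0 mul1r.
  rewrite exprS -mulrA => /(Ht (k + d)%N) Jk; apply: (IH g hg); apply: Jk.
  by apply: homogM => //; exact: homogXS.
apply: (cancel d0); first by apply: homog_sum => i _; exact: homogZ.
have -> : x ^+ d0 * (\sum_i w 0 i *: f i) =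
    \sum_i w 0 i *: (x ^+ d0 * f i - comb e (c i)) + comb e (w *m C).
  have -> : comb e (w *m C) = \sum_i w 0 i *: comb e (c i).
    rewrite /comb; under [RHS]eq_bigr do rewrite scaler_sumr.
    rewrite exchange_big; apply: eq_bigr => k _ /=.
    by rewrite mxE scaler_suml; apply: eq_bigr => i _; rewrite !mxE scalerA.
  rewrite -big_split mulr_sumr; apply: eq_bigr => i _ /=.
  by rewrite -scalerDr subrK scalerAr.
by rewrite wC comb0 addr0; apply: ideal_sum => // i _; exact: idealZ.
Qed.

End Field.

(** * Primitive integral triples *)

Section Triples.
Variable A : comNzRingType.
Definition tri (v : A * A * A) (i : 'I_3) : A := [:: v.1.1; v.1.2; v.2]`_i.
Definition dot3 (u v : A * A * A) : A := u.1.1 * v.1.1 + u.1.2 * v.1.2 + u.2 * v.2.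
Definition cross3 (u v : A * A * A) : A * A * A :=
  (u.1.2 * v.2 - u.2 * v.1.2, u.2 * v.1.1 - u.1.1 * v.2, u.1.1 * v.1.2 - u.1.2 * v.1.1).

Lemma sum_tri u v : \sum_i tri u i * tri v i = dot3 u v.
Proof. by rewrite !big_ord_recl big_ord0 /tri /= addr0 addrA. Qed.

Lemma tri_inj u v : tri u =1 tri v -> u = v.
Proof.
case: u => -[a b] c; case: v => -[a' b'] c' E.
by have := E (@Ordinal 3 0 isT); have := E (@Ordinal 3 1 isT); have := E (@Ordinal 3 2 isT);
  rewrite /tri /= => -> -> ->.
Qed.

(** The dual basis of (r, p, p'), by cross products. *)
Program Definition cross_frame (p p' r : A * A * A) (h : dot3 r (cross3 p p') = 1) : frame A :=
  @Frame A (tri r) (tri p) (tri p') (tri (cross3 p p')) (tri (cross3 p' r)) (tri (cross3 r p))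
   _ _ _ _ _ _ _.
Next Obligation.
move=> [[a b] c] [[a' b'] c'] [[x y] z]; rewrite /dot3 /cross3 /= => h.
by case=> -[|[|[|//]]] i; case=> -[|[|[|//]]] j; rewrite /tri /= ?(eqxx, mulr1n) /=;
  rewrite -?h; ring.
Qed.
Next Obligation.
by move=> [[a b] c] [[a' b'] c'] [[x y] z] _; rewrite sum_tri /dot3 /cross3 /=; ring.
Qed.
Next Obligation.
by move=> [[a b] c] [[a' b'] c'] [[x y] z] _; rewrite sum_tri /dot3 /cross3 /=; ring.
Qed.
Next Obligation.
move=> [[a b] c] [[a' b'] c'] [[x y] z]; rewrite sum_tri /dot3 /cross3 /= => <-; ring.
Qed.
Next Obligation.
by move=> [[a b] c] [[a' b'] c'] [[x y] z] _; rewrite sum_tri /dot3 /cross3 /=; ring.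
Qed.
Next Obligation.
by move=> [[a b] c] [[a' b'] c'] [[x y] z] _; rewrite sum_tri /dot3 /cross3 /=; ring.
Qed.
Next Obligation.
move=> [[a b] c] [[a' b'] c'] [[x y] z]; rewrite sum_tri /dot3 /cross3 /= => <-; ring.
Qed.

End Triples.

Lemma gcdz_ge0 m n : 0 <= gcdz m n.
Proof. by []. Qed.

(** A short basis of the lattice orthogonal to v = (a, b, c) = (g a1, g b1, c): the
    first vector is (b1, - a1, 0), and the second is shifted by a multiple of the
    first so that their scalar product e satisfies 0 <= e < |p|^2; the length of
    the second then follows from |p|^2 |p'|^2 = |v|^2 + e^2. *)
Lemma lattice_frame v : primitive_triples v -> exists p p' r : int * int * int,
  [/\ cross3 p p' = v, dot3 r v = 1, dot3 p p <= dot3 v v & dot3 p' p' <= 2 * dot3 v v].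
Proof.
case: v => -[a b] c; rewrite /primitive_triples /= => g1.
have [/andP[/eqP a0 /eqP b0]|ab] := boolP ((a == 0) && (b == 0)).
  move: g1; rewrite a0 b0 gcd0z /= => /esym c1.
  have cc : c * c = 1.
    by move: c1; rewrite gcd0z => c1; have := intEsg c; nia.
  exists (1, 0, 0), (0, c, 0), (0, 0, c).
  by rewrite /cross3 /dot3 /= cc !mulr0 !mul0r !mulr1 !mul1r; split=> //; rewrite !subr0.
have [u [w E]] := Bezoutz a b; set g := gcdz a b in E g1.
have [s [t E2]] := Bezoutz g c; rewrite g1 in E2.
have g0 : 0 < g.
  rewrite lt_neqAle gcdz_ge0 andbT eq_sym; apply: contra ab => /eqP g00.
  by move/eqP: g00; rewrite gcdz_eq0.
have [a1 Ea] : exists a1, a = g * a1.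
  by exists (a %/ g)%Z; rewrite mulrC divzK ?dvdz_gcdl.
have [b1 Eb] : exists b1, b = g * b1.
  by exists (b %/ g)%Z; rewrite mulrC divzK ?dvdz_gcdr.
have E1 : u * a1 + w * b1 = 1.
  by apply: (mulfI (lt0r_neq0 g0)); rewrite mulr1 -[RHS]E Ea Eb; ring.
pose P := b1 * b1 + a1 * a1.
have P0 : 0 < P by rewrite /P; nia.
pose k := ((b1 * (u * c) - a1 * (w * c)) %/ P)%Z.
pose e := ((b1 * (u * c) - a1 * (w * c)) %% P)%Z.
have Ee : b1 * (u * c) - a1 * (w * c) = k * P + e by rewrite [LHS](divz_eq _ P).
have e0 : 0 <= e by apply: modz_ge0; exact: lt0r_neq0.
have eP : e < P by apply: ltz_pmod.
exists (b1, - a1, 0), (u * c - k * b1, w * c + k * a1, - g), (s * u, s * w, t).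
have C : cross3 (b1, - a1, 0) (u * c - k * b1, w * c + k * a1, - g) = (a, b, c).
  rewrite /cross3 /= Ea Eb; congr (_, _, _); try ring.
  by rewrite -[RHS]mulr1 -E1; ring.
pose n := a * a + b * b + c * c.
have Pn : P <= n.
  have -> : n = g * g * P + c * c by rewrite /n /P Ea Eb; ring.
  have gg : 1 <= g * g by nia.
  have := ler_wpM2r (ltW P0) gg; rewrite mul1r => h.
  by apply: le_trans h _; rewrite lerDl -expr2 sqr_ge0.
split=> //; rewrite /dot3 /= -?/n.
- by rewrite -E2 -E; ring.
- by rewrite mulrNN mulr0 addr0.
set Q := (X in X <= _).
have L : P * Q = n + e * e.
  have -> : e = b1 * (u * c - k * b1) - a1 * (w * c + k * a1).
    by apply: (addrI (k * P)); rewrite -Ee /P; ring.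
  have -> : n = dot3 (a, b, c) (a, b, c) by [].
  by rewrite -C /dot3 /cross3 /= /P /Q; ring.
have : P * Q <= P * (2 * n).
  have -> : P * (2 * n) = P * n + P * n by ring.
  rewrite L; apply: lerD.
    by rewrite ler_peMl // ?(le_trans (ltW P0)) //; lia.
  apply: (@le_trans _ _ (P * P)); last by rewrite ler_pM2l.
  by apply: ler_pM => //; exact: ltW.
by rewrite ler_pM2l.
Qed.

(** A choice of sign: the first nonzero entry is positive. *)
Definition pos3 (v : int * int * int) : bool :=
  (0 < v.1.1) || (v.1.1 == 0) && ((0 < v.1.2) || (v.1.2 == 0) && (0 < v.2)).

Definition opp3 (v : int * int * int) := (- v.1.1, - v.1.2, - v.2).

Lemma pos3_opp v : v != (0, 0, 0) -> pos3 (opp3 v) = ~~ pos3 v.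
Proof.
case: v => -[a b] c nz; rewrite /pos3 /opp3 /= !oppr_gt0 !oppr_eq0.
case: (ltgtP a 0) => //= a0; case: (ltgtP b 0) => //= b0; case: (ltgtP c 0) => //= c0.
by move: nz; rewrite a0 b0 c0 eqxx.
Qed.

Lemma prim_neq0 v : primitive_triples v -> v != (0, 0, 0).
Proof. by move=> pv; apply/eqP => v0; move: pv; rewrite /primitive_triples /= v0. Qed.

Lemma prim_opp v : primitive_triples v -> primitive_triples (opp3 v).
Proof. by rewrite /primitive_triples /= /gcdz /= !abszN. Qed.

Lemma prim_lin v : primitive_triples v ->
  exists s0 s1 s2 : int, v.1.1 * s0 + v.1.2 * s1 + v.2 * s2 = 1.
Proof.
case: v => -[a b] c; rewrite /primitive_triples /= => g1.
have [u [w E]] := Bezoutz a b; have [s [t E2]] := Bezoutz (gcdz a b) c.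
by exists (u * s), (w * s), t; rewrite -[RHS]g1 -E2 -E; ring.
Qed.

Lemma prim_dvd v (n d : int) (w : int * int * int) : primitive_triples v ->
  (forall i, n * tri v i = d * tri w i) -> (d %| n)%Z.
Proof.
move=> /prim_lin[s0 [s1 [s2 E]]] H.
have H0 := H (@Ordinal 3 0 isT); have H1 := H (@Ordinal 3 1 isT).
have H2 := H (@Ordinal 3 2 isT); rewrite /tri /= in H0 H1 H2.
apply/dvdzP; exists (w.1.1 * s0 + w.1.2 * s1 + w.2 * s2).
by rewrite -[n]mulr1 -E !mulrDr !mulrA H0 H1 H2; ring.
Qed.

Lemma prim_scale (a : 'I_3 -> rat) : (exists i, a i != 0) ->
  exists v (k : rat), [/\ primitive_triples v, pos3 v, k != 0
    & forall i, a i = k * (tri v i)%:~R].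
Proof.
move=> [i0 ai0].
pose D : int := \prod_i denq (a i).
have D0 : D != 0 by apply/prodf_neq0 => i _; exact: denq_neq0.
have /choice[z Hz] : forall i, exists z : int, D%:~R * a i = z%:~R.
  move=> i; exists (numq (a i) * \prod_(j | j != i) denq (a j)).
  rewrite /D (bigD1 i) //= !intrM mulrAC; congr (_ * _).
  by rewrite mulrC -[X in X * _]divq_num_den divfK // intr_eq0 denq_neq0.
pose w : int * int * int := (z (@Ordinal 3 0 isT), z (@Ordinal 3 1 isT), z (@Ordinal 3 2 isT)).
have wz i : tri w i = z i.
  by case: i => -[|[|[|//]]] p; rewrite /tri /=; congr z; apply: val_inj.
pose g := gcdz (gcdz w.1.1 w.1.2) w.2.
have zi0 : z i0 != 0.
  by rewrite -(intr_eq0 rat) -Hz mulf_neq0 // intr_eq0.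
have g0 : g != 0.
  rewrite !gcdz_eq0; apply: contra zi0 => /andP[/andP[/eqP A /eqP B] /eqP C].
  by rewrite -wz; case: (i0) => -[|[|[|//]]] p; apply/eqP.
have dv i : (g %| tri w i)%Z.
  have d01 : (g %| gcdz w.1.1 w.1.2)%Z by exact: dvdz_gcdl.
  case: i => -[|[|[|//]]] p; rewrite /tri /=.
  - exact: dvdz_trans d01 (dvdz_gcdl _ _).
  - exact: dvdz_trans d01 (dvdz_gcdr _ _).
  - exact: dvdz_gcdr.
pose v : int * int * int := ((w.1.1 %/ g)%Z, (w.1.2 %/ g)%Z, (w.2 %/ g)%Z).
have vw i : tri w i = g * tri v i.
  have := dv i; rewrite mulrC; case: i => -[|[|[|//]]] p; rewrite /tri /= => d;
    by rewrite divzK.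
have gg : 0 < g by rewrite lt_neqAle eq_sym g0 gcdz_ge0.
have pv : primitive_triples v.
  rewrite /primitive_triples /=; apply: (mulfI g0); rewrite mulr1.
  have Eg := gtr0_norm gg.
  have E0 := vw (@Ordinal 3 0 isT); have E1 := vw (@Ordinal 3 1 isT).
  have E2 := vw (@Ordinal 3 2 isT); rewrite /tri /= in E0 E1 E2.
  by rewrite -{1}Eg mulz_gcdr -E2 -{1}Eg mulz_gcdr -E0 -E1.
have [pp|np] := boolP (pos3 v).
  exists v, (g%:~R / D%:~R); split=> //.
    by rewrite mulf_neq0 ?invr_eq0 ?intr_eq0.
  move=> i; rewrite mulrAC -intrM -vw wz -Hz mulrC mulKf // intr_eq0 //.
exists (opp3 v), (- (g%:~R / D%:~R)); split.
- exact: prim_opp.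
- by rewrite pos3_opp // prim_neq0.
- by rewrite oppr_eq0 mulf_neq0 ?invr_eq0 ?intr_eq0.
- move=> i; have -> : tri (opp3 v) i = - tri v i.
    by case: i => -[|[|[|//]]] p.
  rewrite rmorphN mulrNN mulrAC -intrM -vw wz -Hz mulrC mulKf // intr_eq0 //.
Qed.

Lemma prim_proportional v w (k : rat) : primitive_triples v -> primitive_triples w ->
  pos3 v -> pos3 w -> (forall i, (tri v i)%:~R = k * (tri w i)%:~R) -> v = w.
Proof.
move=> pv pw posv posw H.
have Hn i : denq k * tri v i = numq k * tri w i.
  apply: (@intr_inj rat); rewrite !intrM H mulrA; congr (_ * _).
  by rewrite mulrC -{1}[k]divq_num_den divfK // intr_eq0 denq_neq0.
have d1 := prim_dvd pv Hn.
have d2 := prim_dvd pw (fun i => esym (Hn i)).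
have /orP[/eqP E|/eqP E] : (numq k == denq k) || (numq k == - denq k).
  move: d1 d2; rewrite !dvdzE => d1 d2.
  have : `|numq k|%N = `|denq k|%N by apply/eqP; rewrite eqn_dvd d1 d2.
  by have := denq_gt0 k; lia.
- apply: tri_inj => i; have := Hn i; rewrite E => /mulfI; apply; exact: denq_neq0.
have vw : v = opp3 w.
  apply: tri_inj => i; apply: (mulfI (denq_neq0 k)); rewrite Hn E mulNr -mulrN.
  by congr (_ * _); case: i => -[|[|[|//]]] p.
by move: posv; rewrite vw pos3_opp ?prim_neq0 // posw.
Qed.

(** * Rational points as pairs of primitive triples *)

Lemma lattice_frames : exists Fr : int * int * int -> frame int,
  forall v, primitive_triples v -> exists p p',
    [/\ [/\ fv (Fr v) = tri v, fp (Fr v) = tri p & fp' (Fr v) = tri p'],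
        cross3 p p' = v, dot3 p p <= dot3 v v & dot3 p' p' <= 2 * dot3 v v].
Proof.
suff /choice[Fr H] : forall v, exists F, primitive_triples v -> exists p p',
    [/\ [/\ fv F = tri v, fp F = tri p & fp' F = tri p'],
        cross3 p p' = v, dot3 p p <= dot3 v v & dot3 p' p' <= 2 * dot3 v v].
  by exists Fr.
move=> v.
have [pv|np] := pselect (primitive_triples v); last first.
  have h : dot3 (0, 0, 1) (cross3 (1, 0, 0) (0, 1, 0)) = 1 :> int by [].
  by exists (cross_frame h) => /np.
have [p [p' [r [C h b b']]]] := lattice_frame pv; rewrite -{1}C in h.
by exists (cross_frame h) => _; exists p, p'; rewrite /= C.
Qed.

Definition line_frame := projT1 (cid lattice_frames).

Lemma line_frameP v : primitive_triples v -> exists p p',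
  [/\ [/\ fv (line_frame v) = tri v, fp (line_frame v) = tri p & fp' (line_frame v) = tri p'],
      cross3 p p' = v, dot3 p p <= dot3 v v & dot3 p' p' <= 2 * dot3 v v].
Proof. exact: (projT2 (cid lattice_frames)). Qed.

Lemma fv_line_frame v : primitive_triples v -> fv (line_frame v) = tri v.
Proof. by case/line_frameP => p [p' [[]]]. Qed.

(** The integral point given by the line v . X = 0 and by the binary quadratic form
    of coefficients c in the chosen basis of the lattice of the line. *)
Definition pair_int (v c : int * int * int) : set (Spoly int) :=
  hyp (line_frame v) c.1.1 c.1.2 c.2.

Definition pair_rat (v c : int * int * int) : set (Spoly rat) :=
  hyp (map_frame (intr : {rmorphism int -> rat}) (line_frame v))
    c.1.1%:~R c.1.2%:~R c.2%:~R.

Lemma intr_triple_neq0 c : primitive_triples c ->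
  (c.1.1%:~R, c.1.2%:~R, c.2%:~R) != (0, 0, 0) :> rat * rat * rat.
Proof.
move=> pc; apply/eqP => -[] /eqP + /eqP + /eqP; rewrite !intr_eq0 => /eqP a /eqP b /eqP d.
by have := prim_neq0 pc; case: c pc a b d => -[? ?] ? /= _ -> -> ->; rewrite eqxx.
Qed.

Lemma pair_rat_hilb v c : primitive_triples c -> hilb2 rat (pair_rat v c).
Proof. by move=> pc; apply/hilb2_hyp_rat/intr_triple_neq0. Qed.

Lemma pair_extends v c : primitive_triples c -> extends_to (pair_rat v c) (pair_int v c).
Proof. by move=> /prim_lin[s0 [s1 [s2 E]]]; exact: (hyp_extends _ E). Qed.

Lemma hilb2_fibre (K : fieldType) (J : set (Spoly K)) : hilb2 K J ->
  closed_subscheme J /\ dim0_degree 2 J.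
Proof.
move=> [cJ _ H]; split=> //; have [HJ _ _] := cJ.
rewrite -[J](base_change_id HJ); apply: H => x; exists x, 1.
by rewrite oner_neq0 divr1.
Qed.

(** The three variables are dependent modulo J, which gives the line, and so are the
    three quadratic monomials on that line, which gives the form; the ideal they
    generate is all of J by [closed_dim_eq]. *)
Lemma hilb2_rat_pair J : hilb2 rat J -> exists v c,
  [/\ primitive_triples v /\ pos3 v, primitive_triples c /\ pos3 c & J = pair_rat v c].
Proof.
move=> HJ; have [cJ dJ] := hilb2_fibre HJ; have [IJ _ _] := cJ.
have [a an Ja] := three_dependent cJ dJ (homog_varX rat).
have [v [k [pv posv k0 Ha]]] := prim_scale an.
pose F := map_frame (intr : {rmorphism int -> rat}) (line_frame v).
have Jl : J (lin (fv F)).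
  have -> : lin (fv F) = k^-1 *: \sum_i a i *: varX rat i.
    rewrite scaler_sumr; apply: eq_bigr => i _.
    by rewrite scalerA Ha mulKf //= fv_line_frame.
  exact: idealZ.
pose x := lin (fx F); pose y := lin (fy F).
have hx : homog 1 x by exact: homog_lin. have hy : homog 1 y by exact: homog_lin.
have [] := @three_dependent _ J 2 (tri (x ^+ 2, x * y, y ^+ 2)) cJ dJ.
  by case=> -[|[|[|//]]] p; rewrite /tri /=;
    [exact: homogXS | exact: (homogM hx hy) | exact: homogXS].
move=> b bn Jb; have [c [m [pc posc m0 Hb]]] := prim_scale bn.
exists v, c; split=> //; apply/esym.
apply: (@closed_dim_eq _ _ _ 2) => //.
- exact/hyp_closed/intr_triple_neq0.
- exact/hyp_dim/intr_triple_neq0.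
apply: idl2_sub => //.
have -> : quad F c.1.1%:~R c.1.2%:~R c.2%:~R = m^-1 *: \sum_i b i *: tri (x ^+ 2, x * y, y ^+ 2) i.
  rewrite scaler_sumr; under eq_bigr do rewrite scalerA Hb mulKf //.
  by rewrite !big_ord_recl big_ord0 /tri /= addr0 addrA.
exact: idealZ.
Qed.

Lemma homog0_const (A : comNzRingType) (f : Spoly A) : homog 0 f ->
  f = mpolyC 3 (mcoeff (@mnm0 3) f).
Proof.
move=> hf; apply/mpolyP => m; rewrite mcoeffC; case: eqP => [->|/eqP ne]; first by rewrite mulr1.
by rewrite mulr0 (dhomog_nemf_coeff hf) // mdeg_eq0.
Qed.

Lemma hyp_deg1 (A : comNzRingType) (F : frame A) c0 c1 c2 f : homog 1 f ->
  hyp F c0 c1 c2 f -> exists k, f = k *: lin (fv F).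
Proof.
move=> hf [a [b E]]; exists (mcoeff (@mnm0 3) (pihomog mdeg 0 a)).
have := congr1 (pihomog mdeg 1) E; rewrite (pihomog_dE hf) linearD /=.
rewrite (pihomogM _ _ (homog_lin _)) (pihomogM _ _ (homog_quad _ _ _ _)) /= addr0 => ->.
by rewrite {1}[pihomog _ _ _](homog0_const (pihomogP _ _ _)) mul_mpolyC.
Qed.

Lemma hyp_deg2 (A : comNzRingType) (F : frame A) c0 c1 c2 f : homog 2 f ->
  hyp F c0 c1 c2 f -> exists (g : Spoly A) k, homog 1 g /\
    f = g * lin (fv F) + k *: quad F c0 c1 c2.
Proof.
move=> hf [a [b E]]; exists (pihomog mdeg 1 a), (mcoeff (@mnm0 3) (pihomog mdeg 0 b)).
split; first exact: pihomogP.
have := congr1 (pihomog mdeg 2) E; rewrite (pihomog_dE hf) linearD /=.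
rewrite (pihomogM _ _ (homog_lin _)) (pihomogM _ _ (homog_quad _ _ _ _)) /= => ->.
by congr (_ + _); rewrite {1}[pihomog _ _ b](homog0_const (pihomogP _ _ _)) mul_mpolyC.
Qed.

Lemma lin_inj (A : comNzRingType) (a b : 'I_3 -> A) : lin a = lin b -> a =1 b.
Proof.
move=> E i; have := congr1 (mcoeff (mnm1 i)) E.
have C (u : 'I_3 -> A) : mcoeff (mnm1 i) (lin u) = u i.
  rewrite /lin raddf_sum /= (bigD1 i) //= mcoeffZ /varX mcoeffX eqxx mulr1 big1 ?addr0 //.
  by move=> j /negbTE ji; rewrite mcoeffZ mcoeffX eq_mnm1 ji mulr0.
by rewrite !C.
Qed.

(** The degree 1 part determines v and the degree 2 part, restricted to the line,
    determines c, each up to a scalar. *)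
Lemma pair_rat_inj v c v' c' :
  primitive_triples v /\ pos3 v -> primitive_triples c /\ pos3 c ->
  primitive_triples v' /\ pos3 v' -> primitive_triples c' /\ pos3 c' ->
  pair_rat v c = pair_rat v' c' -> (v, c) = (v', c').
Proof.
move=> [pv posv] [pc posc] [pv' posv'] [pc' posc'] E.
have vv : v = v'.
  have : pair_rat v' c' (lin (fv (map_frame (intr : {rmorphism int -> rat}) (line_frame v)))).
    by rewrite -E; exact: idl2_l.
  move/(hyp_deg1 (homog_lin _)) => [k]; rewrite /lin scaler_sumr.
  under [RHS]eq_bigr do rewrite scalerA.
  move/lin_inj => H; apply: (prim_proportional (k := k)) => // i.
  by have := H i; rewrite /= !fv_line_frame.
rewrite -vv in E *; congr (_, _).
have : pair_rat v c' (quad (map_frame (intr : {rmorphism int -> rat}) (line_frame v))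
    c.1.1%:~R c.1.2%:~R c.2%:~R) by rewrite -E; exact: idl2_q.
move/(hyp_deg2 (homog_quad _ _ _ _)) => [g [k [_]]].
set F := map_frame _ _.
move/(congr1 (psi F)); rewrite psi_quad (rmorphD (psi F)) (rmorphM (psi F)) /= psiZ !psi_quad psi_l mulr0 add0r.
have -> : forall d0 d1 d2 : rat, k%:P%:P * bform d0 d1 d2 = bform (k * d0) (k * d1) (k * d2).
  by move=> d0 d1 d2; rewrite /bform !mulrDr !mulrA -!polyCM.
move=> /bform_inj[H0 H1 H2]; apply: (prim_proportional (k := k)) => //.
by case=> -[|[|[|//]]] p.
Qed.

(** * Covolumes and bases of the graded parts *)

Section Dotp.
Variable A : comNzRingType.
Implicit Types f g : Spoly A.

(** A sum over a range of monomials that is independent of f makes bilinearity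
    available. *)
Lemma dotpE k f g : (msize f <= k)%N ->
  dotp f g = \sum_(m : bmultinom 3 k) mcoeff m f * mcoeff m g.
Proof.
move=> le; pose I : subFinType _ := bmultinom 3 k.
rewrite /dotp (ssrcomplements.big_mksub I) ?msupp_uniq //=; last first.
  by move=> x /msize_mdeg_lt /leq_trans; apply.
rewrite big_rmcond //= => j /memN_msupp_eq0 ->.
by rewrite mul0r.
Qed.

Lemma dotpC f g : dotp f g = dotp g f.
Proof.
rewrite (dotpE (k := maxn (msize f) (msize g))) ?leq_maxl //.
rewrite (dotpE (k := maxn (msize f) (msize g)) f) ?leq_maxr //.
by apply: eq_bigr => m _; rewrite mulrC.
Qed.

Lemma dotp_sumr (J : finType) f (c : J -> A) (g : J -> Spoly A) :
  dotp f (\sum_j c j *: g j) = \sum_j c j * dotp f (g j).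
Proof.
rewrite /dotp; under [RHS]eq_bigr do rewrite mulr_sumr.
rewrite exchange_big; apply: eq_bigr => m _ /=.
rewrite raddf_sum mulr_sumr; apply: eq_bigr => j _.
by rewrite /= mcoeffZ mulrCA.
Qed.

Lemma dotp_suml (J : finType) g (c : J -> A) (f : J -> Spoly A) :
  dotp (\sum_j c j *: f j) g = \sum_j c j * dotp (f j) g.
Proof. by rewrite dotpC dotp_sumr; apply: eq_bigr => j _; rewrite dotpC. Qed.

Lemma dotpX m m' : dotp (mpolyX A m) (mpolyX A m') = (m == m')%:R.
Proof. by rewrite /dotp msuppX big_seq1 !mcoeffX eqxx mul1r eq_sym. Qed.

End Dotp.

Lemma gram_change k k' (w : 'I_k -> Spoly int) (w' : 'I_k' -> Spoly int) (U : 'M[int]_(k', k)) :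
  (forall i, w' i = \sum_j U i j *: w j) -> gram w' = U *m gram w *m U^T.
Proof.
move=> H; apply/matrixP => i j; rewrite !mxE !H dotp_suml.
under [RHS]eq_bigr do rewrite mxE mulr_suml.
rewrite exchange_big; apply: eq_bigr => a _ /=; rewrite dotp_sumr mulr_sumr.
by apply: eq_bigr => b _; rewrite !mxE; ring.
Qed.

(** The two changes of basis are inverse to each other, which forces k = k' and
    determinants +1 or -1. *)
Lemma gram_invariant L k k' (w : 'I_k -> Spoly int) (w' : 'I_k' -> Spoly int) :
  lattice_basis L w -> lattice_basis L w' -> \det (gram w') = \det (gram w).
Proof.
move=> [Lw Hw] [Lw' Hw'].
have /choice[u Hu] : forall i, exists c : 'rV_k, w' i = \sum_j c 0 j *: w j.
  by move=> i; have [c [E _]] := Hw _ (Lw' i); exists c.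
have /choice[u' Hu'] : forall i, exists c : 'rV_k', w i = \sum_j c 0 j *: w' j.
  by move=> i; have [c [E _]] := Hw' _ (Lw i); exists c.
pose U := \matrix_(i, j) u i 0 j; pose U' := \matrix_(i, j) u' i 0 j.
have HU i : w' i = \sum_j U i j *: w j by rewrite Hu; apply: eq_bigr => j _; rewrite mxE.
have HU' i : w i = \sum_j U' i j *: w' j by rewrite Hu'; apply: eq_bigr => j _; rewrite mxE.
have key n n' (z : 'I_n -> Spoly int) (z' : 'I_n' -> Spoly int) (P : 'M[int]_(n', n)) (P' : 'M[int]_(n, n')) :
    lattice_basis L z' -> (forall i, z' i = \sum_j P i j *: z j) ->
    (forall i, z i = \sum_j P' i j *: z' j) -> P *m P' = 1%:M.
  move=> [Lz' Hz'] HP HP'; apply/row_matrixP => i; rewrite row1.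
  have [c [_ U0]] := Hz' _ (Lz' i).
  rewrite -(U0 (row i (P *m P'))) ?(U0 (delta_mx 0 i)) //.
    rewrite (bigD1 i) //= mxE !eqxx scale1r big1 ?addr0 // => j /negbTE ji.
    by rewrite mxE ji andbF scale0r.
  rewrite {1}HP; under eq_bigr do rewrite HP' scaler_sumr.
  rewrite exchange_big; apply: eq_bigr => j _ /=; rewrite !mxE scaler_suml.
  by apply: eq_bigr => a _; rewrite scalerA.
have UU' := key _ _ _ _ _ _ (conj Lw' Hw') HU HU'.
have U'U := key _ _ _ _ _ _ (conj Lw Hw) HU' HU.
have kk : k' = k by apply/eqP; rewrite eqn_leq (mulmx1_min UU') (mulmx1_min U'U).
rewrite (gram_change HU); move: (gram w) => G.
move: U U' UU' {U'U HU HU'}; rewrite kk => U U' UU'.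
rewrite !det_mulmx det_tr mulrAC.
have := congr1 determinant UU'; rewrite det_mulmx det1 => dd.
suff -> : \det U * \det U = 1 by rewrite mul1r.
have : \det U \is a GRing.unit by apply/unitrPr; exists (\det U').
by rewrite qualifE /= => /pred2P[] ->.
Qed.

Lemma covolE (R : realType) L k (w : 'I_k -> Spoly int) : lattice_basis L w ->
  covol R L = Num.sqrt (\det (gram w))%:~R.
Proof.
move=> bw; apply: xget_unique; first by exists k, w.
by move=> _ [k' [w' [bw' ->]]]; rewrite (gram_invariant bw bw').
Qed.

Lemma homog1_lin (A : comNzRingType) (f : Spoly A) : homog 1 f -> exists a, f = lin a.
Proof.
move=> hf; have [g Hg ->] := homogS_split hf.
exists (fun i => mcoeff (@mnm0 3) (g i)).
by apply: eq_bigr => i _; rewrite mulrC {1}(homog0_const (Hg i)) mul_mpolyC.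
Qed.

Lemma lin0_eq (A : comNzRingType) (a : 'I_3 -> A) : lin a = 0 -> forall i, a i = 0.
Proof.
have -> : 0 = lin (fun _ => 0) :> Spoly A by rewrite /lin big1 // => i _; rewrite scale0r.
by move/lin_inj.
Qed.

Lemma linB (A : comNzRingType) (a b : 'I_3 -> A) : lin a - lin b = lin (fun i => a i - b i).
Proof. by rewrite /lin -sumrB; apply: eq_bigr => i _; rewrite scalerBl. Qed.

Lemma dotp_lin (A : comNzRingType) (a b : 'I_3 -> A) : dotp (lin a) (lin b) = \sum_i a i * b i.
Proof.
rewrite /lin dotp_suml; apply: eq_bigr => i _; rewrite dotp_sumr (bigD1 i) //= big1.
  by rewrite addr0 dotpX eqxx mulr1.
by move=> j ji; rewrite dotpX eq_mnm1 eq_sym (negbTE ji) mulr0.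
Qed.

Section Bases.
Variables (v c : int * int * int) (R : realType).
Hypotheses (pv : primitive_triples v) (pc : primitive_triples c).
Let F := line_frame v.
Let l := lin (tri v).
Let q := quad F c.1.1 c.1.2 c.2.

Lemma lin_v_neq0 : l != 0.
Proof.
apply/eqP => /lin0_eq H; have := prim_neq0 pv.
by rewrite (_ : v = (0, 0, 0)) ?eqxx //; apply: tri_inj => i; rewrite H;
  case: i => -[|[|[|//]]] p.
Qed.

Lemma basis1 : lattice_basis (graded_part (pair_int v c) 1) (fun _ : 'I_1 => l).
Proof.
split=> [_|f [If hf]].
  split; last exact: homog_lin.
  by rewrite /l -(fv_line_frame pv); exact: idl2_l.
have [k E] := hyp_deg1 hf If; rewrite (fv_line_frame pv) in E.
exists (const_mx k); split; first by rewrite big_ord1 mxE.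
move=> d; rewrite big_ord1 E => /eqP; rewrite -subr_eq0 -scalerBl -mul_mpolyC mulf_eq0 (negbTE lin_v_neq0) orbF mpolyC_eq0.
by rewrite subr_eq0 => /eqP kd; apply/rowP => i; rewrite mxE kd (ord1 i).
Qed.

Lemma covol1 : covol R (graded_part (pair_int v c) 1) = Num.sqrt (dot3 v v)%:~R.
Proof. by rewrite (covolE _ basis1) det_mx11 mxE dotp_lin sum_tri. Qed.

(** The conics containing Z are spanned by the conics l X_0, l X_1, l X_2 that
    contain the line and by q. *)
Definition basis2_fun (i : 'I_4) : Spoly int :=
  if unlift ord_max i is Some j then l * varX int j else q.

Lemma sum_basis2 (d : 'I_4 -> int) : \sum_i d i *: basis2_fun i =
  lin (fun j : 'I_3 => d (lift ord_max j)) * l + d ord_max *: q.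
Proof.
rewrite big_ord_recr /=; congr (_ + _); last by rewrite /basis2_fun unlift_none.
rewrite /lin mulr_suml; apply: eq_bigr => i _.
have -> : widen_ord (leqnSn 3) i = lift ord_max i by apply: val_inj; rewrite /= /bump leqNgt ltn_ord.
by rewrite /basis2_fun liftK mulrC -scalerAl mulrC scalerAr.
Qed.

Lemma basis2 : lattice_basis (graded_part (pair_int v c) 2) basis2_fun.
Proof.
have HI := hyp_ideal F c.1.1 c.1.2 c.2; have [_ _ IM] := HI.
have Il : pair_int v c l by rewrite /l -(fv_line_frame pv); exact: idl2_l.
split=> [i|f [If hf]].
  rewrite /basis2_fun; case: unliftP => [j _|_]; split.
  - by rewrite mulrC; apply: IM.
  - exact: (homogM (homog_lin _) (homog_varX _ _)).
  - exact: idl2_q.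
  - exact: homog_quad.
have [g [k [hg E]]] := hyp_deg2 hf If; rewrite (fv_line_frame pv) in E.
have [a Ea] := homog1_lin hg.
exists (\row_i if unlift ord_max i is Some j then a j else k); split.
  rewrite sum_basis2 E Ea mxE unlift_none; congr (_ * _ + _).
  by rewrite /lin; apply: eq_bigr => i _; rewrite mxE liftK.
move=> d; rewrite sum_basis2 E Ea => /eqP; rewrite -subr_eq0 opprD addrACA -mulrBl -scalerBl linB.
move/eqP => Z; have := congr1 (psi F) Z.
rewrite (rmorphD (psi F)) (rmorphM (psi F)) (rmorph0 (psi F)) /= psiZ psi_quad.
rewrite -(fv_line_frame pv) psi_l mulr0 add0r => /eqP.
rewrite mulf_eq0 !polyC_eq0 (negbTE (bform_neq0 _)) ?orbF; last first.
  by apply: contra (prim_neq0 pc); case: (c) => -[? ?] ?.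
rewrite subr_eq0 => /eqP kd; move: Z; rewrite kd subrr scale0r addr0 => /eqP.
rewrite mulf_eq0 (negbTE lin_v_neq0) orbF => /eqP/lin0_eq H.
apply/rowP => i; rewrite mxE; case: unliftP => [j ->|->] //.
by apply/eqP; rewrite -subr_eq0 H.
Qed.

End Bases.

(** * Coefficients of conics *)

Section QuadricCoefficients.
Variable A : comNzRingType.

(** The quadratic monomials in the order X_0^2, X_1^2, X_2^2, X_0 X_1, X_0 X_2,
    X_1 X_2. *)
Definition monomial2 (k : 'I_6) : multinom 3 :=
  let: (i, j) := nth (0%N, 0%N) [:: (0, 0); (1, 1); (2, 2); (0, 1); (0, 2); (1, 2)]%N k in
  mnm_add (mnm1 (inord i)) (mnm1 (inord j)).

Lemma monomial2_inj : injective monomial2.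
Proof.
move=> k k' /mnmP E.
have := E (@inord 2 0); have := E (@inord 2 1); have := E (@inord 2 2).
have e i j : (i < 3)%N -> (j < 3)%N -> (inord i == inord j :> 'I_3) = (i == j).
  by move=> li lj; rewrite -val_eqE /= !inordK.
case: k {E} => -[|[|[|[|[|[|//]]]]]] p; case: k' => -[|[|[|[|[|[|//]]]]]] p' //=;
  rewrite /monomial2 /= !mnmDE !mnm1E !e //= => *; try exact: val_inj; by [].
Qed.

Definition quadric (Q : nat -> A) : Spoly A := \sum_(k < 6) Q k *: mpolyX A (monomial2 k).

(** Functions on the natural numbers stand for vectors with six entries, so that
    they can be written as explicit sequences and expanded by computation. *)
Definition dot6 (P Q : nat -> A) : A :=
  P 0%N * Q 0%N + P 1%N * Q 1%N + P 2 * Q 2 + P 3 * Q 3 + P 4 * Q 4 + P 5 * Q 5.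

Lemma dotp_quadric P Q : dotp (quadric P) (quadric Q) = dot6 P Q.
Proof.
rewrite /quadric dotp_suml.
transitivity (\sum_(k < 6) P k * Q k).
  apply: eq_bigr => k _; rewrite dotp_sumr (bigD1 k) //= big1.
    by rewrite addr0 dotpX eqxx mulr1.
  by move=> j jk; rewrite dotpX (inj_eq monomial2_inj) eq_sym (negbTE jk) mulr0.
by rewrite !big_ord_recr big_ord0 /= add0r.
Qed.

Definition seqf (s : seq A) (k : nat) := nth 0 s k.

Lemma lin_mul (a b : 'I_3 -> A) : lin a * lin b = quadric (seqf
  [:: a 0 * b 0; a 1 * b 1; a 2%:R * b 2%:R; a 0 * b 1 + a 1 * b 0;
      a 0 * b 2%:R + a 2%:R * b 0; a 1 * b 2%:R + a 2%:R * b 1]).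
Proof.
have X i j : mpolyX A (mnm_add (mnm1 i) (mnm1 j)) = varX A i * varX A j.
  by rewrite /varX -mpolyXD.
have i0 : inord 0 = 0 :> 'I_3 by apply: val_inj; rewrite /= inordK.
have i1 : inord 1 = 1 :> 'I_3 by apply: val_inj; rewrite /= inordK.
have i2 : inord 2 = 2%:R :> 'I_3 by apply: val_inj; rewrite /= inordK.
rewrite /quadric !big_ord_recl big_ord0 /monomial2 /= /bump /= !X i0 i1 i2.
rewrite /lin !big_ord_recl !big_ord0 /seqf /=.
have -> : lift ord0 ord0 = 1 :> 'I_3 by apply: val_inj.
have -> : lift ord0 (lift ord0 ord0) = 2%:R :> 'I_3 by apply: val_inj.
have -> : ord0 = 0 :> 'I_3 by apply: val_inj.
rewrite -!mul_mpolyC !mpolyCD !mpolyCM; ring.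
Qed.

Lemma quadricD P Q : quadric P + quadric Q = quadric (fun k => P k + Q k).
Proof. by rewrite /quadric -big_split; apply: eq_bigr => k _; rewrite scalerDl. Qed.

Lemma quadricZ c P : c *: quadric P = quadric (fun k => c * P k).
Proof. by rewrite /quadric scaler_sumr; apply: eq_bigr => k _; rewrite scalerA. Qed.

Lemma det_expand n (f : nat -> nat -> A) :
  \det (\matrix_(i < n.+1, j < n.+1) f i j) =
  \sum_(j < n.+1) (-1) ^+ j * f 0%N j * \det (\matrix_(i < n, k < n) f i.+1 (bump j k)).
Proof.
rewrite (expand_det_row _ ord0); apply: eq_bigr => j _; rewrite mxE /cofactor add0n.
rewrite mulrCA mulrA; congr (_ * determinant _); apply/matrixP => i k.
by rewrite !mxE.
Qed.

Lemma det2_expand (f : nat -> nat -> A) :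
  \det (\matrix_(i < 2, j < 2) f i j) = f 0%N 0%N * f 1%N 1%N - f 0%N 1%N * f 1%N 0%N.
Proof.
rewrite det_expand !big_ord_recl big_ord0 !det_mx11 !mxE /bump /=; ring.
Qed.

Lemma det3_expand (f : nat -> nat -> A) :
  \det (\matrix_(i < 3, j < 3) f i j) =
    f 0%N 0%N * (f 1%N 1%N * f 2 2 - f 1%N 2 * f 2 1%N)
  - f 0%N 1%N * (f 1%N 0%N * f 2 2 - f 1%N 2 * f 2 0%N)
  + f 0%N 2 * (f 1%N 0%N * f 2 1%N - f 1%N 1%N * f 2 0%N).
Proof.
rewrite det_expand !big_ord_recl big_ord0 /= !(det2_expand (fun i j => f i.+1 (bump _ j))).
rewrite /bump /=; ring.
Qed.

Definition det3 (f : nat -> nat -> A) : A :=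
    f 0%N 0%N * (f 1%N 1%N * f 2 2 - f 1%N 2 * f 2 1%N)
  - f 0%N 1%N * (f 1%N 0%N * f 2 2 - f 1%N 2 * f 2 0%N)
  + f 0%N 2 * (f 1%N 0%N * f 2 1%N - f 1%N 1%N * f 2 0%N).

Lemma det4_expand (f : nat -> nat -> A) :
  \det (\matrix_(i < 4, j < 4) f i j) =
    f 0%N 0%N * det3 (fun i j => f i.+1 (bump 0 j))
  - f 0%N 1%N * det3 (fun i j => f i.+1 (bump 1 j))
  + f 0%N 2 * det3 (fun i j => f i.+1 (bump 2 j))
  - f 0%N 3 * det3 (fun i j => f i.+1 (bump 3 j)).
Proof.
rewrite det_expand !big_ord_recl big_ord0 /= !(det3_expand (fun i j => f i.+1 (bump _ j))).
rewrite /det3 /bump /=; ring.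
Qed.

End QuadricCoefficients.

(** * Gram determinants and complementary minors *)

Section GramIdentities.
Variable A : comNzRingType.
Implicit Types a b c al be ga : A.

(** The monomials at p: the scalar product with the coefficients of a conic q is
    q(p), and with [polar_veronese] it is the polar form of q at (p, p'). *)
Definition veronese (p : A * A * A) : nat -> A := let: (x, y, z) := p in
  seqf [:: x * x; y * y; z * z; x * y; x * z; y * z].

Definition polar_veronese (p p' : A * A * A) : nat -> A :=
  let: (x, y, z) := p in let: (x', y', z') := p' in
  seqf [:: x * x' *+ 2; y * y' *+ 2; z * z' *+ 2; x * y' + y * x'; x * z' + z * x'; y * z' + z * y'].

(** The quadratic form of the adjugate of the symmetric matrix (e_ij). *)
Definition ternary (e11 e12 e13 e22 e23 e33 al be ga : A) : A :=
    (e22 * e33 - e23 * e23) * al ^+ 2 + (e11 * e33 - e13 * e13) * be ^+ 2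
  + (e11 * e22 - e12 * e12) * ga ^+ 2 + ((e13 * e23 - e12 * e33) * (al * be)) *+ 2
  + ((e12 * e23 - e13 * e22) * (al * ga)) *+ 2 + ((e12 * e13 - e11 * e23) * (be * ga)) *+ 2.

(** The adjugate form of the Gram matrix of the three vectors whose scalar products
    with a conic are the coefficients of its restriction to the line through p
    and p'. *)
Definition gram_form (p p' : A * A * A) (al be ga : A) : A :=
  let n1 := veronese p in let n2 := polar_veronese p p' in let n3 := veronese p' in
  ternary (dot6 n1 n1) (dot6 n1 n2) (dot6 n1 n3) (dot6 n2 n2) (dot6 n2 n3) (dot6 n3 n3) al be ga.

Definition gram_disc (p p' : A * A * A) : A :=
  let n1 := veronese p in let n2 := polar_veronese p p' in let n3 := veronese p' in
  det3 (fun i j => dot6 (nth n1 [:: n1; n2; n3] i) (nth n1 [:: n1; n2; n3] j)).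

Definition det4 (f : nat -> nat -> A) : A :=
    f 0%N 0%N * det3 (fun i j => f i.+1 (bump 0 j))
  - f 0%N 1%N * det3 (fun i j => f i.+1 (bump 1 j))
  + f 0%N 2 * det3 (fun i j => f i.+1 (bump 2 j))
  - f 0%N 3 * det3 (fun i j => f i.+1 (bump 3 j)).

Definition mult_rows a b c (q : nat -> A) : nat -> nat -> A :=
  nth q [:: seqf [:: a; 0; 0; b; c; 0]; seqf [:: 0; b; 0; a; 0; c]; seqf [:: 0; 0; c; 0; a; b]].

(** The Cauchy-Binet formula for four vectors in dimension 6. *)
Lemma gram4_minors a b c q0 q1 q2 q3 q4 q5 :
  let W := mult_rows a b c (seqf [:: q0; q1; q2; q3; q4; q5]) in
  det4 (fun i j => dot6 (W i) (W j)) =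
  \sum_(S <- [:: [:: 0; 1; 2; 3]%N; [:: 0; 1; 2; 4]%N; [:: 0; 1; 2; 5]%N; [:: 0; 1; 3; 4]%N; [:: 0; 1; 3; 5]%N; [:: 0; 1; 4; 5]%N; [:: 0; 2; 3; 4]%N; [:: 0; 2; 3; 5]%N; [:: 0; 2; 4; 5]%N; [:: 0; 3; 4; 5]%N; [:: 1; 2; 3; 4]%N; [:: 1; 2; 3; 5]%N; [:: 1; 2; 4; 5]%N; [:: 1; 3; 4; 5]%N; [:: 2; 3; 4; 5]%N]) det4 (fun i j => W i (nth 0%N S j)) ^+ 2.
Proof. by move=> W; rewrite /W !big_cons big_nil /det4 /det3 /dot6 /mult_rows /seqf /bump /=; ring. Qed.

(** The Cauchy-Binet formula for the three multiples of the line. *)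
Lemma gram3_minors a b c q :
  let W := mult_rows a b c q in
  det3 (fun i j => dot6 (W i) (W j)) =
  \sum_(S <- [:: [:: 0; 1; 2]%N; [:: 0; 1; 3]%N; [:: 0; 1; 4]%N; [:: 0; 1; 5]%N; [:: 0; 2; 3]%N; [:: 0; 2; 4]%N; [:: 0; 2; 5]%N; [:: 0; 3; 4]%N; [:: 0; 3; 5]%N; [:: 0; 4; 5]%N; [:: 1; 2; 3]%N; [:: 1; 2; 4]%N; [:: 1; 2; 5]%N; [:: 1; 3; 4]%N; [:: 1; 3; 5]%N; [:: 1; 4; 5]%N; [:: 2; 3; 4]%N; [:: 2; 3; 5]%N; [:: 2; 4; 5]%N; [:: 3; 4; 5]%N]) det3 (fun i j => W i (nth 0%N S j)) ^+ 2.
Proof. by move=> W; rewrite /W !big_cons big_nil /det3 /dot6 /mult_rows /seqf /bump /=; ring. Qed.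

Definition minor2 (f g : nat -> A) (s t : nat) : A := f s * g t - f t * g s.

Definition minor_dot (f g f' g' : nat -> A) : A :=
  minor2 f g 4%N 5%N * minor2 f' g' 4%N 5%N + minor2 f g 3%N 5%N * minor2 f' g' 3%N 5%N + minor2 f g 3%N 4%N * minor2 f' g' 3%N 4%N + minor2 f g 2%N 5%N * minor2 f' g' 2%N 5%N + minor2 f g 2%N 4%N * minor2 f' g' 2%N 4%N + minor2 f g 2%N 3%N * minor2 f' g' 2%N 3%N + minor2 f g 1%N 5%N * minor2 f' g' 1%N 5%N + minor2 f g 1%N 4%N * minor2 f' g' 1%N 4%N + minor2 f g 1%N 3%N * minor2 f' g' 1%N 3%N + minor2 f g 1%N 2%N * minor2 f' g' 1%N 2%N + minor2 f g 0%N 5%N * minor2 f' g' 0%N 5%N + minor2 f g 0%N 4%N * minor2 f' g' 0%N 4%N + minor2 f g 0%N 3%N * minor2 f' g' 0%N 3%N + minor2 f g 0%N 2%N * minor2 f' g' 0%N 2%N + minor2 f g 0%N 1%N * minor2 f' g' 0%N 1%N.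

Lemma lagrange_identity (f g f' g' : nat -> A) :
  dot6 f f' * dot6 g g' - dot6 f g' * dot6 g f' = minor_dot f g f' g'.
Proof. by rewrite /minor_dot /minor2 /dot6; ring. Qed.

Lemma dot6C (f g : nat -> A) : dot6 f g = dot6 g f.
Proof. by rewrite /dot6; ring. Qed.

Definition dual_minor (n1 n2 n3 : nat -> A) al be ga (s t : nat) : A :=
  al * minor2 n2 n3 s t - be * minor2 n1 n3 s t + ga * minor2 n1 n2 s t.

Lemma ternary_minors (n1 n2 n3 : nat -> A) al be ga :
  ternary (dot6 n1 n1) (dot6 n1 n2) (dot6 n1 n3) (dot6 n2 n2) (dot6 n2 n3) (dot6 n3 n3) al be ga =
  dual_minor n1 n2 n3 al be ga 4%N 5%N ^+ 2 + dual_minor n1 n2 n3 al be ga 3%N 5%N ^+ 2 + dual_minor n1 n2 n3 al be ga 3%N 4%N ^+ 2 + dual_minor n1 n2 n3 al be ga 2%N 5%N ^+ 2 + dual_minor n1 n2 n3 al be ga 2%N 4%N ^+ 2 + dual_minor n1 n2 n3 al be ga 2%N 3%N ^+ 2 + dual_minor n1 n2 n3 al be ga 1%N 5%N ^+ 2 + dual_minor n1 n2 n3 al be ga 1%N 4%N ^+ 2 + dual_minor n1 n2 n3 al be ga 1%N 3%N ^+ 2 + dual_minor n1 n2 n3 al be ga 1%N 2%N ^+ 2 + dual_minor n1 n2 n3 al be ga 0%N 5%N ^+ 2 + dual_minor n1 n2 n3 al be ga 0%N 4%N ^+ 2 + dual_minor n1 n2 n3 al be ga 0%N 3%N ^+ 2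 + dual_minor n1 n2 n3 al be ga 0%N 2%N ^+ 2 + dual_minor n1 n2 n3 al be ga 0%N 1%N ^+ 2.
Proof.
rewrite /ternary.
have -> : dot6 n2 n2 * dot6 n3 n3 - dot6 n2 n3 * dot6 n2 n3 = minor_dot n2 n3 n2 n3.
  by rewrite -lagrange_identity (dot6C n3 n2).
have -> : dot6 n1 n1 * dot6 n3 n3 - dot6 n1 n3 * dot6 n1 n3 = minor_dot n1 n3 n1 n3.
  by rewrite -lagrange_identity (dot6C n3 n1).
have -> : dot6 n1 n1 * dot6 n2 n2 - dot6 n1 n2 * dot6 n1 n2 = minor_dot n1 n2 n1 n2.
  by rewrite -lagrange_identity (dot6C n2 n1).
have -> : dot6 n1 n3 * dot6 n2 n3 - dot6 n1 n2 * dot6 n3 n3 = - minor_dot n2 n3 n1 n3.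
  by rewrite -lagrange_identity (dot6C n2 n1) (dot6C n3 n1); ring.
have -> : dot6 n1 n2 * dot6 n2 n3 - dot6 n1 n3 * dot6 n2 n2 = minor_dot n2 n3 n1 n2.
  by rewrite -lagrange_identity (dot6C n2 n1) (dot6C n3 n1) (dot6C n3 n2); ring.
have -> : dot6 n1 n2 * dot6 n1 n3 - dot6 n1 n1 * dot6 n2 n3 = - minor_dot n1 n3 n1 n2.
  by rewrite -lagrange_identity (dot6C n3 n1) (dot6C n3 n2); ring.
rewrite /minor_dot /dual_minor; ring.
Qed.

Lemma disc_minors (n1 n2 n3 : nat -> A) :
  let N i := nth n1 [:: n1; n2; n3] i in
  det3 (fun i j => dot6 (N i) (N j)) =
  \sum_(S <- [:: [:: 3; 4; 5]%N; [:: 2; 4; 5]%N; [:: 2; 3; 5]%N; [:: 2; 3; 4]%N; [:: 1; 4; 5]%N; [:: 1; 3; 5]%N; [:: 1; 3; 4]%N; [:: 1; 2; 5]%N; [:: 1; 2; 4]%N; [:: 1; 2; 3]%N; [:: 0; 4; 5]%N; [:: 0; 3; 5]%N; [:: 0; 3; 4]%N; [:: 0; 2; 5]%N; [:: 0; 2; 4]%N; [:: 0; 2; 3]%N; [:: 0; 1; 5]%N; [:: 0; 1; 4]%N; [:: 0; 1; 3]%N; [:: 0; 1; 2]%N]) det3 (fun i j => N i (nth 0%N S j)) ^+ 2.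
Proof. by move=> N; rewrite /N !big_cons big_nil /det3 /dot6 /=; ring. Qed.

Lemma add_eq (x y z t : A) : x = y -> z = t -> x + z = y + t.
Proof. by move=> -> ->. Qed.

Lemma sqr_eq (x y : A) : x = y -> x ^+ 2 = y ^+ 2.
Proof. by move=> ->. Qed.

Lemma sqr_eqN (x y : A) : x = - y -> x ^+ 2 = y ^+ 2.
Proof. by move=> ->; rewrite sqrrN. Qed.

(** The span of l X_0, l X_1, l X_2 is the orthogonal of the span of the vectors
    n1, n2, n3 of [gram_form]. Hence the 4 x 4 minors of the rows l X_i, q are, up
    to sign, the complementary entries of the combination of the 2 x 2 minors of
    n1, n2, n3 whose coefficients are the scalar products of q with these vectors,
    and the sums of squares agree term by term. *)
Lemma gram4_dual p p' q0 q1 q2 q3 q4 q5 :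
  let q := seqf [:: q0; q1; q2; q3; q4; q5] in
  let v := cross3 p p' in let W := mult_rows v.1.1 v.1.2 v.2 q in
  det4 (fun i j => dot6 (W i) (W j)) =
  gram_form p p' (dot6 q (veronese p)) (dot6 q (polar_veronese p p')) (dot6 q (veronese p')).
Proof.
case: p => -[x y] z; case: p' => -[x' y'] z' q v W.
rewrite /W /v /q /cross3 /= gram4_minors /gram_form; cbv zeta.
rewrite ternary_minors !big_cons big_nil addr0 !addrA.
do 14 (apply: add_eq; last (rewrite /det4 /det3 /dual_minor /minor2 /dot6 /mult_rows /veronese
  /polar_veronese /seqf /bump /=; first [by apply: sqr_eq; ring | by apply: sqr_eqN; ring])).
by rewrite /det4 /det3 /dual_minor /minor2 /dot6 /mult_rows /veronese /polar_veronese /seqf /bump /=;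
  apply: sqr_eqN; ring.
Qed.

(** Complementary minors again, for the two orthogonal subspaces of dimension 3. *)
Lemma gram3_dual p p' q :
  let v := cross3 p p' in let W := mult_rows v.1.1 v.1.2 v.2 q in
  det3 (fun i j => dot6 (W i) (W j)) = gram_disc p p'.
Proof.
case: p => -[x y] z; case: p' => -[x' y'] z' v W.
rewrite /W /v /cross3 /= gram3_minors /gram_disc; cbv zeta.
rewrite disc_minors !big_cons !big_nil !addr0 !addrA.
do 19 (apply: add_eq; last (rewrite /det3 /dot6 /mult_rows /veronese
  /polar_veronese /seqf /bump /=; first [by apply: sqr_eq; ring | by apply: sqr_eqN; ring])).
by rewrite /det3 /dot6 /mult_rows /veronese /polar_veronese /seqf /bump /=;
  apply: sqr_eqN; ring.
Qed.

End GramIdentities.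

(** * The ternary quadratic form attached to a line *)

Definition plane_disc (A : comNzRingType) (v : A * A * A) : A :=
  let a := v.1.1 in let b := v.1.2 in let c := v.2 in
  a ^+ 6 + 2 * b ^+ 2 * a ^+ 4 + 2 * c ^+ 2 * a ^+ 4 + 2 * b ^+ 4 * a ^+ 2
   + 5 * c ^+ 2 * b ^+ 2 * a ^+ 2 + 2 * c ^+ 4 * a ^+ 2 + b ^+ 6
   + 2 * c ^+ 2 * b ^+ 4 + 2 * c ^+ 4 * b ^+ 2 + c ^+ 6.

(** The determinant is computed on the multiples of the line, where only v occurs. *)
Lemma gram_disc_plane (A : comNzRingType) (p p' : A * A * A) :
  gram_disc p p' = plane_disc (cross3 p p').
Proof.
rewrite -(gram3_dual p p' (fun=> 0)); move: (cross3 p p') => [[a b] c].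
by rewrite /plane_disc /det3 /dot6 /mult_rows /seqf /=; ring.
Qed.

Lemma quad_quadric (A : comNzRingType) (F : frame A) c0 c1 c2 :
  exists q0 q1 q2 q3 q4 q5, let q := seqf [:: q0; q1; q2; q3; q4; q5] in
  quad F c0 c1 c2 = quadric q /\ forall p : A * A * A,
  dot6 q (veronese p) = c0 * (\sum_i fx F i * tri p i) ^+ 2
    + c1 * ((\sum_i fx F i * tri p i) * (\sum_i fy F i * tri p i))
    + c2 * (\sum_i fy F i * tri p i) ^+ 2 /\ forall p',
  dot6 q (polar_veronese p p') = c0 * ((\sum_i fx F i * tri p i) * (\sum_i fx F i * tri p' i)) *+ 2
    + c1 * ((\sum_i fx F i * tri p i) * (\sum_i fy F i * tri p' i)
           + (\sum_i fy F i * tri p i) * (\sum_i fx F i * tri p' i))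
    + c2 * ((\sum_i fy F i * tri p i) * (\sum_i fy F i * tri p' i)) *+ 2.
Proof.
set x := fx F; set y := fy F.
pose m (a b : 'I_3 -> A) := seqf [:: a 0 * b 0; a 1 * b 1; a 2%:R * b 2%:R;
  a 0 * b 1 + a 1 * b 0; a 0 * b 2%:R + a 2%:R * b 0; a 1 * b 2%:R + a 2%:R * b 1].
pose q k := c0 * m x x k + c1 * m x y k + c2 * m y y k.
exists (q 0%N), (q 1%N), (q 2), (q 3), (q 4), (q 5); move=> q'; split.
  rewrite /quad !expr2 !lin_mul !quadricZ !quadricD -/x -/y.
  by apply: eq_bigr => -[[|[|[|[|[|[|//]]]]]] i] _.
have e (a : 'I_3 -> A) (p : A * A * A) : \sum_i a i * tri p i = a 0 * p.1.1 + a 1 * p.1.2 + a 2%:R * p.2.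
  rewrite !big_ord_recl big_ord0 /tri /= addr0 addrA.
  by congr (a _ * _ + a _ * _ + a _ * _); apply: val_inj.
case=> -[p0 p1] p2; split=> [|[[p0' p1'] p2']];
  rewrite !e /q' /q /dot6 /veronese /polar_veronese /seqf /m /seqf /=; ring.
Qed.

Lemma gram2 v c p p' : primitive_triples v ->
  fp (line_frame v) = tri p -> fp' (line_frame v) = tri p' -> cross3 p p' = v ->
  \det (gram (basis2_fun v c)) = gram_form p p' c.1.1 c.1.2 c.2.
Proof.
move=> pv Ep Ep' C; set F := line_frame v in Ep Ep'.
have [q0 [q1 [q2 [q3 [q4 [q5 /= [Eq H]]]]]]] := quad_quadric F c.1.1 c.1.2 c.2.
set q := seqf _ in Eq H; pose W := mult_rows (cross3 p p').1.1 (cross3 p p').1.2 (cross3 p p').2 q.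
have bE i : basis2_fun v c i = quadric (W i).
  rewrite /basis2_fun; case: unliftP => [j ->|->]; last by rewrite Eq.
  have -> : varX int j = lin (fun i => (i == j)%:R).
    rewrite /lin (bigD1 j) //= eqxx scale1r big1 ?addr0 // => k /negbTE ->.
    by rewrite scale0r.
  rewrite lin_mul; apply: eq_bigr => k _; congr (_ *: _).
  case: j => -[|[|[|//]]] pj; rewrite /W C /mult_rows /tri /= /seqf;
  by case: k => -[|[|[|[|[|[|//]]]]]] pk /=; rewrite ?mulr0 ?mulr1 ?addr0 ?add0r.
have -> : gram (basis2_fun v c) = \matrix_(i < 4, j < 4) dot6 (W i) (W j).
  by apply/matrixP => i j; rewrite !mxE !bE dotp_quadric.
transitivity (det4 (fun i j => dot6 (W i) (W j))).
  exact: (det4_expand (fun i j => dot6 (W i) (W j))).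
have -> := gram4_dual p p' q0 q1 q2 q3 q4 q5; rewrite -/q.
have [Hp Hpp] := H p; have [Hp' _] := H p'.
rewrite Hp Hpp Hp' -Ep -Ep' frame_xp frame_yp frame_xp' frame_yp'.
by congr gram_form; ring.
Qed.

Section Ternary.
Variable R : realFieldType.
Implicit Types p v : R * R * R.

(** Completing squares; the three leading coefficients multiply to D^2, D being the
    determinant of (e_ij). *)
Lemma ternary_ldl (e11 e12 e13 e22 e23 e33 al be ga : R) :
  let D := e11 * (e22 * e33 - e23 * e23) - e12 * (e12 * e33 - e23 * e13)
         + e13 * (e12 * e23 - e22 * e13) in
  let g := e22 * e33 - e23 * e23 in g != 0 -> e33 != 0 ->
  ternary e11 e12 e13 e22 e23 e33 al be ga =
  g * (al + (e13 * e23 - e12 * e33) / g * be + (e12 * e23 - e13 * e22) / g * ga) ^+ 2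
  + D * e33 / g * (be - e23 / e33 * ga) ^+ 2 + D / e33 * ga ^+ 2.
Proof. by move=> D g g0 e0; rewrite /ternary /D; move: g0; rewrite /g => g0; field; rewrite g0 e0. Qed.

Lemma dot6_ge0 (f : nat -> R) : 0 <= dot6 f f.
Proof. by rewrite /dot6; nra. Qed.

Lemma minor_dot_ge0 (f g : nat -> R) : 0 <= minor_dot f g f g.
Proof. by rewrite /minor_dot -!expr2 !addr_ge0 // ?sqr_ge0. Qed.

Lemma plane_disc_ge v : 2 * dot3 v v ^+ 3 <= 3 * plane_disc v.
Proof.
case: v => -[a b] c; rewrite /plane_disc /dot3 /= -!expr2.
have -> : a ^+ 6 = (a ^+ 2) ^+ 3 by rewrite -exprM.
have -> : b ^+ 6 = (b ^+ 2) ^+ 3 by rewrite -exprM.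
have -> : c ^+ 6 = (c ^+ 2) ^+ 3 by rewrite -exprM.
have -> : a ^+ 4 = (a ^+ 2) ^+ 2 by rewrite -exprM.
have -> : b ^+ 4 = (b ^+ 2) ^+ 2 by rewrite -exprM.
have -> : c ^+ 4 = (c ^+ 2) ^+ 2 by rewrite -exprM.
have := sqr_ge0 a; have := sqr_ge0 b; have := sqr_ge0 c.
move: (a ^+ 2) (b ^+ 2) (c ^+ 2) => x y z z0 y0 x0.
rewrite -subr_ge0.
have -> : 3 * (x ^+ 3 + 2 * y * x ^+ 2 + 2 * z * x ^+ 2 + 2 * y ^+ 2 * x + 5 * z * y * x
    + 2 * z ^+ 2 * x + y ^+ 3 + 2 * z * y ^+ 2 + 2 * z ^+ 2 * y + z ^+ 3)
    - 2 * (x + y + z) ^+ 3 = x ^+ 3 + y ^+ 3 + z ^+ 3 + 3 * (x * y * z) by ring.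
by rewrite !addr_ge0 ?mulr_ge0 ?exprn_ge0.
Qed.

(** The pivots g, D e33 / g and D / e33 of [ternary_ldl] are at least D / e11,
    D / e22 and D / e33. As D is at least 2 n^3 / 3 and the e_ii are at most 8 n^2,
    since p and p' are short, the pivots are at least n / 12. *)
Lemma gram_form_ldl p p' n : let v := cross3 p p' in n = dot3 v v -> 0 < n ->
  dot3 p p <= n -> dot3 p' p' <= 2 * n ->
  exists a b c r s t : R, [/\ n / 12 <= a /\ n / 12 <= b, n / 12 <= c,
    a * b * c = plane_disc v ^+ 2 &
    forall x y z, gram_form p p' x y z =
      a * (x + r * y + s * z) ^+ 2 + b * (y + t * z) ^+ 2 + c * z ^+ 2].
Proof.
move=> v En n0 bp bp'; rewrite /gram_form; set n1 := veronese p; set n2 := polar_veronese p p'.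
set n3 := veronese p'; set e11 := dot6 n1 n1; set e12 := dot6 n1 n2; set e13 := dot6 n1 n3.
set e22 := dot6 n2 n2; set e23 := dot6 n2 n3; set e33 := dot6 n3 n3.
pose g := e22 * e33 - e23 * e23; pose D := plane_disc v.
have DE : D = e11 * (e22 * e33 - e23 * e23) - e12 * (e12 * e33 - e23 * e13)
         + e13 * (e12 * e23 - e22 * e13).
  rewrite /D -gram_disc_plane /gram_disc -/n1 -/n2 -/n3 /det3 /=.
  by rewrite (dot6C n2 n1) (dot6C n3 n1) (dot6C n3 n2).
have D_ge : 2 * n ^+ 3 <= 3 * D by rewrite En; exact: plane_disc_ge.
have n3_0 : 0 < n ^+ 3 by rewrite exprn_gt0.
have D0 : 0 < D by lra.
have e11_0 : 0 <= e11 by exact: dot6_ge0.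
have e22_0 : 0 <= e22 by exact: dot6_ge0.
have e33_0 : 0 <= e33 by exact: dot6_ge0.
have g_0 : 0 <= g.
  by rewrite /g /e23 {2}(dot6C n2 n3) lagrange_identity minor_dot_ge0.
(* The square norm of e12 n3 - e13 n2: it gives D <= e11 g. *)
have bra : 0 <= e12 ^+ 2 * e33 - (e12 * e13 * e23) *+ 2 + e13 ^+ 2 * e22.
  have := dot6_ge0 (fun k => e12 * n3 k - e13 * n2 k).
  by rewrite {1}/dot6 /e33 /e23 /e22 /dot6; congr (_ <= _); ring.
have Dg : D <= e11 * g by rewrite DE /g; lra.
have e11p : 0 < e11.
  by rewrite lt_neqAle eq_sym e11_0 andbT; apply/eqP => z; move: Dg; rewrite z mul0r; lra.
have gp : 0 < g.
  by rewrite lt_neqAle eq_sym g_0 andbT; apply/eqP => z; move: Dg; rewrite z mulr0; lra.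
have gle : g <= e22 * e33 by rewrite /g lerBlDr lerDl -expr2 sqr_ge0.
have e33p : 0 < e33.
  by rewrite lt_neqAle eq_sym e33_0 andbT; apply/eqP => z; move: gle; rewrite z mulr0; lra.
have e22p : 0 < e22.
  by rewrite lt_neqAle eq_sym e22_0 andbT; apply/eqP => z; move: gle; rewrite z mul0r; lra.
have sqle (u : R * R * R) : dot6 (veronese u) (veronese u) <= dot3 u u ^+ 2.
  case: u => -[x y] z; rewrite /dot6 /veronese /seqf /dot3 /= -subr_ge0.
  have -> : (x * x + y * y + z * z) ^+ 2 - (x * x * (x * x) + y * y * (y * y) + z * z * (z * z)
     + x * y * (x * y) + x * z * (x * z) + y * z * (y * z)) =
     (x * y) ^+ 2 + (x * z) ^+ 2 + (y * z) ^+ 2 by ring.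
  by rewrite !addr_ge0 ?sqr_ge0.
have d0 (u : R * R * R) : 0 <= dot3 u u by rewrite /dot3 !addr_ge0 // -expr2 sqr_ge0.
have b11 : e11 <= n ^+ 2.
  by apply: le_trans (sqle _) _; rewrite lerXn2r // nnegrE ?d0 // ltW.
have b33 : e33 <= 4 * n ^+ 2.
  apply: le_trans (sqle _) _; have -> : 4 * n ^+ 2 = (2 * n) ^+ 2 by ring.
  by rewrite lerXn2r // nnegrE ?d0 // mulr_ge0 // ltW.
have b22 : e22 <= 8 * n ^+ 2.
  have : e22 <= 4 * (dot3 p p * dot3 p' p').
    rewrite /e22 /n2; case: (p) => -[x y] z; case: (p') => -[x' y'] z'.
    rewrite /dot6 /polar_veronese /seqf /dot3 /= -subr_ge0.
    have -> : 4 * ((x * x + y * y + z * z) * (x' * x' + y' * y' + z' * z')) -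
      (x * x' *+ 2 * (x * x' *+ 2) + y * y' *+ 2 * (y * y' *+ 2) + z * z' *+ 2 * (z * z' *+ 2)
       + (x * y' + y * x') * (x * y' + y * x') + (x * z' + z * x') * (x * z' + z * x')
       + (y * z' + z * y') * (y * z' + z * y')) =
      2 * (x * y') ^+ 2 + 2 * (y * x') ^+ 2 + (x * y' - y * x') ^+ 2
      + 2 * (x * z') ^+ 2 + 2 * (z * x') ^+ 2 + (x * z' - z * x') ^+ 2
      + 2 * (y * z') ^+ 2 + 2 * (z * y') ^+ 2 + (y * z' - z * y') ^+ 2 by ring.
    have s2 (t : R) : 0 <= 2 * t ^+ 2 by apply: mulr_ge0; rewrite ?ler0n ?sqr_ge0.
    by rewrite !addr_ge0 ?s2 ?sqr_ge0.
  have : dot3 p p * dot3 p' p' <= n * (2 * n) by apply: ler_pM.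
  by rewrite expr2; lra.
exists g, (D * e33 / g), (D / e33), ((e13 * e23 - e12 * e33) / g),
  ((e12 * e23 - e13 * e22) / g), (- (e23 / e33)); split.
- split.
    have : n * e11 <= 12 * (e11 * g).
      have : n * e11 <= n * n ^+ 2 by rewrite ler_pM2l.
      by rewrite -exprS; lra.
    have -> : 12 * (e11 * g) = e11 * (12 * g) by ring.
    by rewrite mulrC ler_pM2l // => h; lra.
  rewrite ler_pdivlMr //.
  have h1 : n * g <= n * (e22 * e33) by rewrite ler_pM2l.
  have h2 : n * e22 * e33 <= 8 * n ^+ 3 * e33.
    rewrite ler_pM2r //; have : n * e22 <= n * (8 * n ^+ 2) by rewrite ler_pM2l.
    by rewrite mulrCA -exprS.
  have h3 : 8 * n ^+ 3 * e33 <= 12 * D * e33 by rewrite ler_pM2r //; lra.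
  by rewrite mulrA in h1; lra.
- rewrite ler_pdivlMr //.
  have : n * e33 <= n * (4 * n ^+ 2) by rewrite ler_pM2l.
  by rewrite mulrCA -exprS; lra.
- have cancel (u w t : R) : u != 0 -> t != 0 -> u * (w * t / u) * (w / t) = w ^+ 2.
    by move=> u0 t0; field; rewrite u0 t0.
  by apply: cancel; rewrite gt_eqF.
move=> x y z; rewrite ternary_ldl -?DE ?gt_eqF //.
by rewrite -/g mulNr.
Qed.

End Ternary.

(** * Sums of profiles over the integers *)

Section FiniteSupportSums.
Variables (R : zmodType) (T : eqType).

Lemma sum_support (s1 s2 : seq T) (f : T -> R) : uniq s1 -> uniq s2 ->
  (forall z, f z != 0 -> z \in s1) -> (forall z, f z != 0 -> z \in s2) ->
  \sum_(z <- s1) f z = \sum_(z <- s2) f z.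
Proof.
move=> u1 u2 h1 h2.
have E s : \sum_(z <- s) f z = \sum_(z <- [seq z <- s | f z != 0]) f z.
  rewrite big_filter [RHS]big_mkcond; apply: eq_bigr => z _.
  by case: eqP => [->|].
rewrite E [RHS]E; apply: perm_big; apply: uniq_perm; rewrite ?filter_uniq // => z.
by rewrite !mem_filter; case: (boolP (f z != 0)) => //= nz; rewrite h1 ?h2.
Qed.

End FiniteSupportSums.

Section Profiles.
Variable R : realType.

Definition irange (M : nat) : seq int := [seq i%:Z - M%:Z | i <- iota 0 (M.*2.+1)].

Lemma irange_uniq M : uniq (irange M).
Proof. by rewrite map_inj_uniq ?iota_uniq // => i j /addIr[]. Qed.

Lemma mem_irange M z : (z \in irange M) = (`|z| <= M)%N.
Proof.
apply/mapP/idP => [[i]|le]; first by rewrite mem_iota => + ->; lia.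
by exists (absz (z + M%:Z)); rewrite ?mem_iota; lia.
Qed.

(** The n integers on each side of a break point between k - 1 and k, listed by
    increasing distance to it. *)
Definition two_sided (k : int) (n : nat) : seq int :=
  [seq k + i%:Z | i <- iota 0 n] ++ [seq k - 1 - i%:Z | i <- iota 0 n].

Lemma two_sided_uniq k n : uniq (two_sided k n).
Proof.
rewrite cat_uniq !map_inj_uniq ?iota_uniq ?andTb ?andbT.
- by apply/hasPn => _ /mapP[i _ ->]; apply/mapP => -[j _]; lia.
- by move=> i j; lia.
- by move=> i j; lia.
Qed.

Lemma two_sided_notin k n z : z \notin two_sided k n ->
  exists2 i, (n <= i)%N & z = k + i%:Z \/ z = k - 1 - i%:Z.
Proof.
rewrite mem_cat negb_or => /andP[h1 h2].
have [kz|zk] := leP k z.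
  exists (absz (z - k)%R); last by left; lia.
  rewrite leqNgt; apply: contra h1 => lt; apply/mapP; exists (absz (z - k)%R); last by lia.
  by rewrite mem_iota add0n lt.
exists (absz (k - 1 - z)%R); last by right; lia.
rewrite leqNgt; apply: contra h2 => lt; apply/mapP; exists (absz (k - 1 - z)%R); last by lia.
by rewrite mem_iota add0n lt.
Qed.

(** phi is nonincreasing on [0, oo) and vanishes after 1, Phi is a primitive of phi,
    and I is the integral of the even function phi |.| on the real line; everything
    is phrased by inequalities between increments, without integrals. *)
Definition profile (phi Phi : R -> R) (I : R) :=
  [/\ Phi 0 = 0, forall t, 0 <= t -> 0 <= phi t,
      forall s t, 0 <= s -> s <= t ->
        phi t * (t - s) <= Phi t - Phi s <= phi s * (t - s)
    & forall t, 1 < t -> phi t = 0 /\ Phi t = I / 2].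

(** Comparison of a sum with an integral for a nonincreasing function: each step of
    the primitive Phi lies between two consecutive values of phi. *)
Lemma half_sum (phi Phi : R -> R) J a (L : nat) : 0 <= a <= 1 ->
  Phi 0 = 0 -> (forall t, 0 <= t -> 0 <= phi t) ->
  (forall s t, 0 <= s -> s <= t ->
        phi t * (t - s) <= Phi t - Phi s <= phi s * (t - s)) ->
  (forall t, L%:R <= t -> Phi t = J) ->
  J - Phi a <= \sum_(i < L.+1) phi (a + i%:R) <= J - Phi a + phi 0.
Proof.
move=> /andP[a0 a1] P0 ph0 mono PJ.
have ai (i : nat) : 0 <= a + i%:R by rewrite addr_ge0.
have step i : phi (a + i.+1%:R) <= Phi (a + i.+1%:R) - Phi (a + i%:R) <= phi (a + i%:R).
  have := mono (a + i%:R) (a + i.+1%:R) (ai i).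
  have -> : a + i.+1%:R - (a + i%:R) = 1 by rewrite -natr1; ring.
  by rewrite !mulr1; apply; rewrite lerD2l ler_nat.
have tele n : \sum_(i < n) (Phi (a + i.+1%:R) - Phi (a + i%:R)) = Phi (a + n%:R) - Phi a.
  elim: n => [|n IH]; first by rewrite big_ord0 addr0 subrr.
  by rewrite big_ord_recr IH /=; ring.
have pa : phi a <= phi 0.
  have := mono 0 a (lexx _) a0; rewrite subr0 => /andP[h1 h2].
  move: a0; rewrite le_eqVlt => /orP[/eqP <- //|a0].
  by rewrite -(ler_pM2r a0); exact: le_trans h1 h2.
apply/andP; split.
  have -> : J - Phi a = Phi (a + L.+1%:R) - Phi a.
    rewrite (PJ (a + L.+1%:R)) //; have : (L%:R : R) <= L.+1%:R by rewrite ler_nat.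
    by lra.
  by rewrite -tele; apply: ler_sum => i _; case/andP: (step i).
rewrite big_ord_recl addr0 addrC; apply: lerD => //.
have -> : J - Phi a = Phi (a + L%:R) - Phi a by rewrite (PJ (a + L%:R)) //; lra.
by rewrite -tele; apply: ler_sum => i _; case/andP: (step i).
Qed.

(** The two half lines from -d start at distances a and 1 - a from it; the integral
    of the profile over the gap between the two first points, of length 1, is at
    most its maximum, and each half line contributes one further maximum. *)
Lemma profile_sum (phi Phi : R -> R) I (h w d : R) M : profile phi Phi I ->
  0 <= h -> 0 < w -> (forall z : int, h * phi (`|z%:~R + d| / w) != 0 -> (`|z| <= M)%N) ->
  `|\sum_(z <- irange M) h * phi (`|z%:~R + d| / w) - h * w * I| <= 2 * h * phi 0.
Proof.
move=> [P0 ph0 mono Pend] h0 w0 supp.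
have w0' : 0 <= w^-1 by rewrite invr_ge0 ltW.
move: h0; rewrite le_eqVlt => /orP[/eqP <-|h0].
  by rewrite big1 ?mulr0 ?mul0r ?subr0 ?normr0 // => z _; rewrite mul0r.
pose f t := phi (t / w); pose F t := w * Phi (t / w).
have f0 t : 0 <= t -> 0 <= f t by move=> t0; rewrite ph0 // mulr_ge0.
have F0 : F 0 = 0 by rewrite /F mul0r P0 mulr0.
have fF s t : 0 <= s -> s <= t -> f t * (t - s) <= F t - F s <= f s * (t - s).
  move=> s0 st; have := mono (s / w) (t / w) (mulr_ge0 s0 w0') (ler_wpM2r w0' st).
  rewrite -mulrBl => /andP[a b]; rewrite /f /F -mulrBr.
  have e : t - s = w * ((t - s) / w) by rewrite mulrC divfK ?gt_eqF.
  by rewrite e !(mulrCA _ w) !ler_pM2l // a b.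
pose k : int := Num.ceil (- d).
have [kd1 kd2] : 0 <= k%:~R + d /\ k%:~R + d < 1.
  have := ceil_itv (- d); rewrite -/k; rewrite intrB => /andP[]; lra.
pose a := k%:~R + d; pose b := 1 - a.
have [L wL] : exists L : nat, w < L%:R.
  by exists (Num.bound w); have := archi_boundP (ltW w0).
have Fend t : L%:R <= t -> F t = w * (I / 2) /\ f t = 0.
  move=> tL; have : 1 < t / w by rewrite ltr_pdivlMr // mul1r; lra.
  by move/Pend; rewrite /F /f => -[-> ->].
have a01 : 0 <= a <= 1 by rewrite /a kd1 ltW.
have b01 : 0 <= b <= 1 by rewrite /b; lra.
have /andP[la ua] := half_sum a01 F0 f0 fF (fun t tL => (Fend t tL).1).
have /andP[lb ub] := half_sum b01 F0 f0 fF (fun t tL => (Fend t tL).1).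
have ks (i : nat) : `|(k + i%:Z)%:~R + d| = a + i%:R :> R.
  by rewrite intrD /a ger0_norm; [rewrite -[i%:~R]pmulrn addrAC | rewrite addrAC addr_ge0].
have ks' (i : nat) : `|(k - 1 - i%:Z)%:~R + d| = b + i%:R :> R.
  rewrite !intrB /b /a ler0_norm.
    by rewrite -[i%:~R]pmulrn; ring.
  by rewrite -[i%:~R]pmulrn; have : 0 <= (i%:R : R) by []; lra.
have -> : \sum_(z <- irange M) h * phi (`|z%:~R + d| / w) =
    h * (\sum_(i < L.+1) f (a + i%:R) + \sum_(i < L.+1) f (b + i%:R)).
  rewrite (@sum_support _ _ _ (two_sided k L.+1)) ?irange_uniq ?two_sided_uniq //.
  - rewrite big_cat !big_map mulrDr !mulr_sumr -!(big_mkord xpredT (fun i => h * f (_ + i%:R))).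
    by congr (_ + _); rewrite /index_iota subn0; apply: eq_bigr => i _; rewrite ?ks ?ks'.
  - by move=> z /supp; rewrite mem_irange.
  move=> z; apply: contraNT => /two_sided_notin[i Li zE].
  have iL : (L%:R : R) <= i%:R by rewrite ler_nat ltnW.
  by case: zE => ->; rewrite ?ks ?ks' -/(f _) (Fend _ _).2 ?mulr0 //; lra.
have Fab : 0 <= F a + F b <= f 0.
  case/andP: a01 => a0 a1; case/andP: b01 => b0 b1.
  have /andP[A1 A2] := fF 0 a (lexx _) a0; have /andP[B1 B2] := fF 0 b (lexx _) b0.
  rewrite F0 !subr0 in A1 A2 B1 B2; apply/andP; split.
    by rewrite addr_ge0 //; [apply: le_trans A1 | apply: le_trans B1]; rewrite mulr_ge0 ?f0.
  by apply: le_trans (lerD A2 B2) _; rewrite -mulrDr /b addrC subrK mulr1.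
have f00 : f 0 = phi 0 by rewrite /f mul0r.
rewrite -!mulrA -mulrBr normrM (gtr0_norm h0) mulrCA ler_pM2l // -f00.
case/andP: Fab => Fab1 Fab2; move: la ua lb ub.
set Sa := \sum_(i < _) f (a + _); set Sb := \sum_(i < _) f (b + _).
by move=> la ua lb ub; rewrite ler_norml; lra.
Qed.

Lemma profile_indicator : profile (fun t : R => (t <= 1)%R%:R) (fun t => Num.min t 1) 2.
Proof.
split=> //.
- by rewrite min_l.
- move=> s t s0 st.
  have [t1|t1] := leP t 1; have [s1|s1] := leP s 1; rewrite /= ?mul1r ?mul0r; lra.
- move=> t t1; rewrite leNgt t1 /=; split=> //.
  by rewrite min_r ?ltW // divff // pnatr_eq0.
Qed.

Lemma profile_parabola : profile (fun t : R => Num.max 0 (1 - t ^+ 2))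
  (fun t => Num.min t 1 - Num.min t 1 ^+ 3 / 3) (4 / 3).
Proof.
split=> //.
- by rewrite min_l // expr0n mul0r subr0.
- by move=> t _; rewrite le_max lexx.
- move=> s t s0 st.
  have [t1|t1] := leP t 1; have [s1|s1] := leP s 1; try lra.
  + have t0 := le_trans s0 st.
    have p (u : R) : 0 <= u <= 1 -> Num.max 0 (1 - u ^+ 2) = 1 - u ^+ 2.
      by move=> /andP[u0 u1]; rewrite max_r // subr_ge0 -[leRHS](expr1n _ 2) lerXn2r // nnegrE.
    rewrite !p ?s0 ?t0 ?s1 ?t1 //.
    have -> : t - t ^+ 3 / 3 - (s - s ^+ 3 / 3) = (1 - (t ^+ 2 + t * s + s ^+ 2) / 3) * (t - s) by field.
    have ts : 0 <= t - s by rewrite subr_ge0.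
    by apply/andP; split; apply: ler_wpM2r => //; nra.
  + have -> : Num.max 0 (1 - t ^+ 2) = 0 by rewrite max_l // subr_le0 -[leLHS](expr1n _ 2) lerXn2r ?nnegrE //; lra.
    have -> : Num.max 0 (1 - s ^+ 2) = 1 - s ^+ 2.
      by rewrite max_r // subr_ge0 -[leRHS](expr1n _ 2) lerXn2r // nnegrE.
    rewrite mul0r expr1n; apply/andP; split.
      have -> : 1 - 1 / 3 - (s - s ^+ 3 / 3) = (1 - (1 + s + s ^+ 2) / 3) * (1 - s) by field.
      by apply: mulr_ge0; nra.
    apply: (@le_trans _ _ ((1 - s ^+ 2) * (1 - s))).
      have -> : 1 - 1 / 3 - (s - s ^+ 3 / 3) = (1 - (1 + s + s ^+ 2) / 3) * (1 - s) by field.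
      by apply: ler_wpM2r; nra.
    by apply: ler_wpM2l; nra.
  + have m u : 1 < u -> Num.max 0 (1 - u ^+ 2) = 0 :> R.
      by move=> u1; rewrite max_l // subr_le0 -[leLHS](expr1n _ 2) lerXn2r ?nnegrE //; lra.
    by rewrite !m // !mul0r subrr lexx.
- move=> t t1; rewrite min_r ?ltW // expr1n; split; last lra.
  by rewrite max_l // subr_le0 -[leLHS](expr1n _ 2) lerXn2r ?nnegrE //; lra.
Qed.

End Profiles.

Section Circle.
Variable R : realType.

(** With t = sin u, the area under the circle is (u + sin u cos u) / 2; this is the
    mean value theorem for twice the difference of this area and k t. *)
Lemma arc_bounds (u v k : R) : 0 <= u -> u <= v -> v <= pi / 2 ->
  exists2 c, u <= c <= v &
   (v + sin v * cos v - 2 * k * sin v) - (u + sin u * cos u - 2 * k * sin u)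
   = 2 * cos c * (cos c - k) * (v - u).
Proof.
move=> u0 uv vp.
pose f := (fun t : R => t + sin t * cos t - 2 * k * sin t).
have df (t : R) : is_derive t (1 : R) f (2 * cos t * (cos t - k)).
  apply: is_derive_eq.
  rewrite /GRing.scale /=; have := cos2Dsin2 t; move: (cos t) (sin t) => C S E.
  transitivity (C ^+ 2 + S ^+ 2 + (S * - S + C * C) - 2 * k * C); first by rewrite E.
  ring.
have cf : {within `[u, v], continuous f}.
  by apply: derivable_within_continuous => x _; have [] := df x.
have [c cI E] := MVT_segment uv (fun x _ => df x) cf.
by exists c => //; move: cI; rewrite in_itv.
Qed.

Lemma profile_circle : profile (fun t : R => Num.sqrt (1 - t ^+ 2))
  (fun t => (asin (Num.min t 1) + Num.min t 1 * Num.sqrt (1 - Num.min t 1 ^+ 2)) / 2) (pi / 2).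
Proof.
have pih0 : 0 <= pi / 2 :> R by rewrite divr_ge0 // pi_ge0.
have as1 : asin 1 = pi / 2 :> R.
  have := @sinK R (pi / 2); rewrite sin_pihalf; apply.
  by rewrite in_itv /= lexx andbT; lra.
have as0 : asin 0 = 0 :> R.
  have := @sinK R 0; rewrite sin0; apply.
  by rewrite in_itv /= pih0 andbT; lra.
have key (s t : R) : 0 <= s -> s <= t -> t <= 1 ->
   Num.sqrt (1 - t ^+ 2) * (t - s) <= 
     (asin t + t * Num.sqrt (1 - t ^+ 2)) / 2 - (asin s + s * Num.sqrt (1 - s ^+ 2)) / 2
     <= Num.sqrt (1 - s ^+ 2) * (t - s).
  move=> s0 st t1.
  have tI : -1 <= t <= 1 by lra.
  have sI : -1 <= s <= 1 by lra.
  rewrite -!cos_asin //.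
  have st' : sin (asin t) = t by apply: asinK; rewrite in_itv.
  have ss' : sin (asin s) = s by apply: asinK; rewrite in_itv.
  have at_le := asin_lepi2 tI; have as_le := asin_lepi2 sI.
  have at_ge := asin_geNpi2 tI; have as_ge := asin_geNpi2 sI.
  have mono : {in `[(- (pi / 2)), (pi / 2)] &, {mono (@sin R) : x y / x <= y}}.
    by apply: le_mono_in => x y xI yI; rewrite ltr_sin.
  have inI (x : R) : - (pi/2) <= x -> x <= pi/2 -> x \in `[(- (pi / 2)), (pi / 2)].
    by move=> a b; rewrite in_itv /= a.
  have ast : asin s <= asin t by rewrite -mono ?inI // st' ss'.
  have as_0 : 0 <= asin s by rewrite -mono ?inI ?sin0 ?ss' //; lra.
  have cosmono (x y : R) : 0 <= x -> x <= y -> y <= pi / 2 -> cos y <= cos x /\ 0 <= cos y.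
    move=> x0 xy yp; split; last by apply: cos_ge0_pihalf; lra.
    have [->//|ne] := eqVneq x y; apply: ltW; rewrite ltr_cos.
    - by rewrite lt_neqAle ne.
    - by rewrite in_itv /=; apply/andP; split; lra.
    - by rewrite in_itv /=; apply/andP; split; lra.
  apply/andP; split.
    have [c /andP[c1 c2] E] := arc_bounds (cos (asin t)) as_0 ast at_le.
    have [h1 h2] := cosmono c (asin t) (le_trans as_0 c1) c2 at_le.
    have h3 : 0 <= cos c by apply: le_trans h1.
    have : 0 <= 2 * cos c * (cos c - cos (asin t)) * (asin t - asin s).
      by rewrite !mulr_ge0 // subr_ge0.
    by rewrite -E st' ss'; lra.
  have [c /andP[c1 c2] E] := arc_bounds (cos (asin s)) as_0 ast at_le.
  have [h1 h2] := cosmono (asin s) c as_0 c1 (le_trans c2 at_le).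
  have : 0 <= 2 * cos c * (cos (asin s) - cos c) * (asin t - asin s).
    by rewrite !mulr_ge0 // subr_ge0.
  have -> : 2 * cos c * (cos (asin s) - cos c) * (asin t - asin s)
     = - (2 * cos c * (cos c - cos (asin s)) * (asin t - asin s)) by ring.
  by rewrite -E st' ss'; lra.
have sq1 (u : R) : 1 <= u -> Num.sqrt (1 - u ^+ 2) = 0.
  move=> u1; apply: ler0_sqrtr; rewrite subr_le0 -[leLHS](expr1n _ 2) lerXn2r ?nnegrE //; lra.
split.
- by rewrite min_l // mul0r addr0 as0 mul0r.
- by move=> t _; exact: sqrtr_ge0.
- move=> s t s0 st.
  have [t1|t1] := leP t 1; have [s1|s1] := leP s 1; try lra.
  + exact: key.
  + have /andP[] := key s 1 s0 s1 (lexx _).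
    rewrite (sq1 1 (lexx _)) (sq1 t (ltW t1)) !mul0r => a b; rewrite a /=; apply: le_trans b _.
    by apply: ler_wpM2l; [exact: sqrtr_ge0 | lra].
  + by rewrite (sq1 t (ltW t1)) (sq1 s (ltW s1)) !mul0r subrr lexx.
- move=> t t1; rewrite min_r ?ltW // (sq1 t (ltW t1)) (sq1 1 (lexx _)) mulr0 addr0 as1; split=> //.
Qed.

End Circle.

(** * Lattice points in an ellipsoid *)

Section EllipsoidCount.
Variable R : realType.
Implicit Types (A B C X Z d : R) (M : nat).

Lemma pi_bound : pi <= 4 :> R.
Proof.
by have := @pihalf_lt2 R; rewrite ltr_pdivrMr // => /ltW; have -> : 2 * 2 = 4 :> R by ring.
Qed.

Lemma sqr_le_sqrt A Z u : 0 < A -> 0 < Z -> (A * u ^+ 2 <= Z) = (`|u| / Num.sqrt (Z / A) <= 1).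
Proof.
move=> A0 Z0; have ZA : 0 < Z / A by rewrite divr_gt0.
rewrite ler_pdivrMr ?sqrtr_gt0 // mul1r -[in RHS]sqrtr_sqr ler_sqrt ?(ltW ZA) //.
by rewrite ler_pdivlMr // mulrC.
Qed.

Lemma interval_count A Z d M : 0 < A -> 0 <= Z ->
  (forall x : int, A * (x%:~R + d) ^+ 2 <= Z -> (`|x| <= M)%N) ->
  `|\sum_(x <- irange M) (A * (x%:~R + d) ^+ 2 <= Z)%R%:R - 2 * Num.sqrt (Z / A)| <= 3.
Proof.
move=> A0; rewrite le_eqVlt => /orP[/eqP Z0|Z0] H.
  rewrite -Z0 mul0r sqrtr0 mulr0 subr0.
  have E x : (A * (x%:~R + d) ^+ 2 <= 0) = (x%:~R + d == 0).
    by rewrite pmulr_rle0 // -sqrf_eq0 eq_le sqr_ge0 andbT.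
  under eq_bigr do rewrite E.
  case: (pselect (exists2 x0 : int, x0 \in irange M & x0%:~R + d = 0)) => [[x0 x0M x0d]|nx].
    rewrite (bigD1_seq x0) ?irange_uniq //= x0d eqxx big1 => [|x xx0].
      by rewrite addr0 normr1; lra.
    case: eqP => // xd; case/eqP: xx0; apply: (@intr_inj R); lra.
  rewrite big_seq big1 ?normr0 // => x xM; case: eqP => // xd.
  by case: nx; exists x.
have w0 : 0 < Num.sqrt (Z / A) by rewrite sqrtr_gt0 divr_gt0.
have := @profile_sum R _ _ _ 1 (Num.sqrt (Z / A)) d M (profile_indicator R) ler01 w0.
have E (x : int) : 1 * (`|x%:~R + d| / Num.sqrt (Z / A) <= 1)%R%:R
    = (A * (x%:~R + d) ^+ 2 <= Z)%R%:R :> R by rewrite mul1r sqr_le_sqrt.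
under eq_bigr do rewrite E.
have -> : 1 * Num.sqrt (Z / A) * 2 = 2 * Num.sqrt (Z / A) by ring.
have -> : 2 * 1 * (0 <= 1 :> R)%R%:R = 2 :> R by rewrite ler01 !mulr1.
move=> h; have {}h : `|\sum_(x <- irange M) (A * (x%:~R + d) ^+ 2 <= Z)%R%:R
    - 2 * Num.sqrt (Z / A)| <= 2.
  by apply: h => x; rewrite E; case: (boolP (_ <= _)) => [/H //|_]; rewrite eqxx.
lra.
Qed.

Lemma disc_sum A B Z d M : 0 < A -> 0 < B -> 0 <= Z ->
  (forall y : int, B * (y%:~R + d) ^+ 2 <= Z -> (`|y| <= M)%N) ->
  `|\sum_(y <- irange M) 2 * Num.sqrt ((Z - B * (y%:~R + d) ^+ 2) / A)
     - pi * (Num.sqrt (Z / A) * Num.sqrt (Z / B))| <= 4 * Num.sqrt (Z / A).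
Proof.
move=> A0 B0; rewrite le_eqVlt => /orP[/eqP Z0|Z0] H.
  rewrite -Z0 mul0r sqrtr0 mul0r !mulr0 subr0 big1 ?normr0 // => y _.
  rewrite ler0_sqrtr ?mulr0 // sub0r mulNr oppr_le0 divr_ge0 ?(ltW A0) //.
  by rewrite mulr_ge0 ?sqr_ge0 // ltW.
have w0 : 0 < Num.sqrt (Z / B) by rewrite sqrtr_gt0 divr_gt0.
have h0 : 0 <= 2 * Num.sqrt (Z / A) by rewrite mulr_ge0 ?sqrtr_ge0.
have := @profile_sum R _ _ _ (2 * Num.sqrt (Z / A)) (Num.sqrt (Z / B)) d M (profile_circle R) h0 w0.
have E (y : int) : 2 * Num.sqrt (Z / A) * Num.sqrt (1 - (`|y%:~R + d| / Num.sqrt (Z / B)) ^+ 2)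
    = 2 * Num.sqrt ((Z - B * (y%:~R + d) ^+ 2) / A).
  rewrite -mulrA -sqrtrM ?divr_ge0 ?ltW //; congr (_ * Num.sqrt _).
  rewrite expr_div_n sqr_sqrtr ?divr_ge0 ?ltW // real_normK ?num_real //.
  by field; rewrite !gt_eqF.
under eq_bigr do rewrite E.
have -> : 2 * Num.sqrt (Z / A) * Num.sqrt (Z / B) * (pi / 2)
  = pi * (Num.sqrt (Z / A) * Num.sqrt (Z / B)) by field.
have -> : 2 * (2 * Num.sqrt (Z / A)) * Num.sqrt (1 - 0 ^+ 2) = 4 * Num.sqrt (Z / A).
  by rewrite expr0n subr0 sqrtr1; ring.
apply=> y; rewrite E => nz; apply: H.
rewrite leNgt; apply: contraNN nz => lt; rewrite ler0_sqrtr ?mulr0 //.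
by rewrite pmulr_lle0 ?invr_gt0 // subr_le0 ltW.
Qed.

Lemma ball_sum C X M : 0 < C -> 0 < X ->
  (forall z : int, C * z%:~R ^+ 2 <= X ^+ 2 -> (`|z| <= M)%N) ->
  `|\sum_(z <- irange M) Num.max 0 (X ^+ 2 - C * z%:~R ^+ 2)
     - X ^+ 2 * (X / Num.sqrt C) * (4 / 3)| <= 2 * X ^+ 2.
Proof.
move=> C0 X0 H; have w0 : 0 < X / Num.sqrt C by rewrite divr_gt0 ?sqrtr_gt0.
have := @profile_sum R _ _ _ (X ^+ 2) (X / Num.sqrt C) 0 M (profile_parabola R) (sqr_ge0 _) w0.
have E (z : int) : X ^+ 2 * Num.max 0 (1 - (`|z%:~R + 0| / (X / Num.sqrt C)) ^+ 2)
    = Num.max 0 (X ^+ 2 - C * z%:~R ^+ 2).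
  rewrite maxr_pMr ?sqr_ge0 // mulr0 addr0; congr (Num.max _ _).
  rewrite !expr_div_n sqr_sqrtr ?ltW // real_normK ?num_real //.
  by field; rewrite !gt_eqF ?sqrtr_gt0.
under eq_bigr do rewrite E.
rewrite expr0n subr0 (max_r ler01) mulr1; apply => z; rewrite E => nz; apply: H.
by rewrite leNgt; apply: contraNN nz => lt; rewrite max_l // subr_le0 ltW.
Qed.

(** Three nested one-variable sums. The inner sum counts an interval, of length
    proportional to sqrt (1 - t^2); the middle sum of these lengths gives the area
    of an ellipse, proportional to 1 - t^2; the outer sum of these areas gives the
    volume. The replacements cost O(1) for each (y, z), O(X) for each z and
    O(X^2), and nothing outside the projections of the ellipsoid. *)
Lemma ellipsoid_count A B C r s t X M : 1 <= A -> 1 <= B -> 1 <= C -> 1 <= X ->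
  (forall z : int, C * z%:~R ^+ 2 <= X ^+ 2 -> (`|z| <= M)%N) ->
  (forall y z : int, B * (y%:~R + t * z%:~R) ^+ 2 + C * z%:~R ^+ 2 <= X ^+ 2 -> (`|y| <= M)%N) ->
  (forall x y z : int, A * (x%:~R + r * y%:~R + s * z%:~R) ^+ 2
     + B * (y%:~R + t * z%:~R) ^+ 2 + C * z%:~R ^+ 2 <= X ^+ 2 -> (`|x| <= M)%N) ->
  `|\sum_(z <- irange M) \sum_(y <- irange M) \sum_(x <- irange M)
      (A * (x%:~R + r * y%:~R + s * z%:~R) ^+ 2
       + B * (y%:~R + t * z%:~R) ^+ 2 + C * z%:~R ^+ 2 <= X ^+ 2)%R%:R
    - 4 / 3 * pi * X ^+ 3 / Num.sqrt (A * B * C)| <= 103 * X ^+ 2.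
Proof.
move=> A1 B1 C1 X1 Hz Hy Hx.
have A0 : 0 < A by lra. have B0 : 0 < B by lra. have C0 : 0 < C by lra. have X0 : 0 < X by lra.
pose Y z := X ^+ 2 - C * z%:~R ^+ 2 : R.
pose Z y z := Y z - B * (y%:~R + t * z%:~R) ^+ 2 : R.
pose ind (z : int) : R := (C * z%:~R ^+ 2 <= X ^+ 2)%R%:R.
have YX z : Y z <= X ^+ 2 by rewrite /Y gerDl oppr_le0 mulr_ge0 ?sqr_ge0 // ltW.
have eX : Num.sqrt (X ^+ 2) = X by rewrite sqrtr_sqr gtr0_norm.
have sqX D z : 1 <= D -> Num.sqrt (Y z / D) <= X.
  move=> D1; rewrite -[leRHS]eX ler_wsqrtr // ler_pdivrMr; last lra.
  by apply: le_trans (YX z) _; rewrite ler_peMr // sqr_ge0.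
have indY z : ind z = (0 <= Y z)%R%:R by rewrite /ind /Y subr_ge0.
have Nind : \sum_(z <- irange M) ind z <= 5 * X.
  have le : Num.sqrt (X ^+ 2 / C) <= X.
    by rewrite -[leRHS]eX ler_wsqrtr // ler_pdivrMr // ler_peMr // sqr_ge0.
  have := @interval_count C (X ^+ 2) 0 M C0 (sqr_ge0 _).
  have E (z : int) : (C * (z%:~R + 0) ^+ 2 <= X ^+ 2) = (C * z%:~R ^+ 2 <= X ^+ 2) by rewrite addr0.
  under eq_bigr do rewrite E.
  move=> h; have {h} : `|\sum_(z <- irange M) ind z - 2 * Num.sqrt (X ^+ 2 / C)| <= 3.
    by apply: h => z; rewrite E; exact: Hz.
  rewrite ler_norml => /andP[_ h2].
  by lra.
have e1 y z : `|\sum_(x <- irange M) (A * (x%:~R + r * y%:~R + s * z%:~R) ^+ 2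
       + B * (y%:~R + t * z%:~R) ^+ 2 + C * z%:~R ^+ 2 <= X ^+ 2)%R%:R
     - 2 * Num.sqrt (Z y z / A)| <= 3 * (B * (y%:~R + t * z%:~R) ^+ 2 <= Y z)%R%:R.
  have E (x : int) : (A * (x%:~R + r * y%:~R + s * z%:~R) ^+ 2
       + B * (y%:~R + t * z%:~R) ^+ 2 + C * z%:~R ^+ 2 <= X ^+ 2) =
       (A * (x%:~R + (r * y%:~R + s * z%:~R)) ^+ 2 <= Z y z).
    by rewrite /Z /Y addrA; apply/idP/idP; lra.
  have [le|lt] := leP (B * (y%:~R + t * z%:~R) ^+ 2) (Y z); last first.
    rewrite /= mulr0 ler0_sqrtr; last first.
      by rewrite pmulr_lle0 ?invr_gt0 // /Z subr_le0 ltW.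
    rewrite mulr0 subr0 big1 ?normr0 // => x _; rewrite E leNgt.
    have -> // : Z y z < A * (x%:~R + (r * y%:~R + s * z%:~R)) ^+ 2.
    apply: (@lt_le_trans _ _ 0); first by rewrite /Z subr_lt0.
    by rewrite mulr_ge0 ?sqr_ge0 // ltW.
  rewrite mulr1; under eq_bigr do rewrite E; apply: interval_count => //.
    by rewrite /Z subr_ge0.
  by move=> x; rewrite -E; exact: Hx.
have e2 z : `|\sum_(y <- irange M) \sum_(x <- irange M) (A * (x%:~R + r * y%:~R + s * z%:~R) ^+ 2
       + B * (y%:~R + t * z%:~R) ^+ 2 + C * z%:~R ^+ 2 <= X ^+ 2)%R%:R
     - \sum_(y <- irange M) 2 * Num.sqrt (Z y z / A)| <= 15 * X * ind z.
  rewrite -sumrB; apply: le_trans (ler_norm_sum _ _ _) _.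
  apply: le_trans (ler_sum _ (fun y _ => e1 y z)) _; rewrite -mulr_sumr.
  rewrite indY; have [Y0|Y0] := leP 0 (Y z); last first.
    rewrite mulr0 big1 ?mulr0 // => y _; rewrite leNgt.
    have -> // : Y z < B * (y%:~R + t * z%:~R) ^+ 2.
    by apply: (lt_le_trans Y0); rewrite mulr_ge0 ?sqr_ge0 // ltW.
  have := @interval_count B (Y z) (t * z%:~R) M B0 Y0.
  have sup y : B * (y%:~R + t * z%:~R) ^+ 2 <= Y z -> (`|y| <= M)%N.
    by rewrite /Y => h; apply: (Hy y z); lra.
  move=> /(_ sup); rewrite ler_norml => /andP[_].
  by have := sqX B z B1; rewrite mulr1; lra.
have e3 z : `|\sum_(y <- irange M) 2 * Num.sqrt (Z y z / A)
     - pi / (Num.sqrt A * Num.sqrt B) * Num.max 0 (Y z)| <= 4 * X * ind z.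
  rewrite indY; have [Y0|Y0] := leP 0 (Y z); last first.
    rewrite !mulr0 subr0 big1 ?normr0 // => y _.
    rewrite ler0_sqrtr ?mulr0 // pmulr_lle0 ?invr_gt0 // /Z subr_le0.
    by apply: (le_trans (ltW Y0)); rewrite mulr_ge0 ?sqr_ge0 // ltW.
  have := @disc_sum A B (Y z) (t * z%:~R) M A0 B0 Y0.
  have sup y : B * (y%:~R + t * z%:~R) ^+ 2 <= Y z -> (`|y| <= M)%N.
    by rewrite /Y => h; apply: (Hy y z); lra.
  move=> /(_ sup); rewrite mulr1.
  have -> : pi * (Num.sqrt (Y z / A) * Num.sqrt (Y z / B))
     = pi / (Num.sqrt A * Num.sqrt B) * Y z.
    rewrite !sqrtrM // !sqrtrV ?ltW // -[in RHS](sqr_sqrtr Y0).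
    by field; rewrite !gt_eqF ?sqrtr_gt0.
  by move/le_trans; apply; rewrite ler_pM2l //; exact: sqX.
pose kap := pi / (Num.sqrt A * Num.sqrt B) : R.
have pi0 : 0 < pi :> R by exact: pi_gt0.
have kap0 : 0 <= kap by rewrite divr_ge0 ?mulr_ge0 ?sqrtr_ge0 // ltW.
have kap4 : kap <= 4.
  rewrite /kap ler_pdivrMr ?mulr_gt0 ?sqrtr_gt0 //.
  have sA : 1 <= Num.sqrt A by rewrite -[leLHS]sqrtr1 ler_wsqrtr.
  have sB : 1 <= Num.sqrt B by rewrite -[leLHS]sqrtr1 ler_wsqrtr.
  apply: le_trans pi_bound _; rewrite ler_peMr //; nra.
have e4 : `|\sum_(z <- irange M) kap * Num.max 0 (Y z)
   - 4 / 3 * pi * X ^+ 3 / Num.sqrt (A * B * C)| <= 8 * X ^+ 2.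
  have -> : 4 / 3 * pi * X ^+ 3 / Num.sqrt (A * B * C)
     = kap * (X ^+ 2 * (X / Num.sqrt C) * (4 / 3)).
    rewrite /kap !sqrtrM ?mulr_ge0 ?ltW //.
    by field; rewrite !gt_eqF ?sqrtr_gt0.
  rewrite -mulr_sumr -mulrBr normrM ger0_norm //.
  have -> : 8 * X ^+ 2 = 4 * (2 * X ^+ 2) by ring.
  by apply: ler_pM => //; apply: ball_sum.
set N := \sum_(z <- _) _; set L := _ / _.
have d1 : `|N - \sum_(z <- irange M) \sum_(y <- irange M) 2 * Num.sqrt (Z y z / A)| <= 75 * X ^+ 2.
  rewrite /N -sumrB; apply: le_trans (ler_norm_sum _ _ _) _.
  apply: le_trans (ler_sum _ (fun z _ => e2 z)) _; rewrite -mulr_sumr.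
  by have := ler_wpM2l (ltW X0) Nind; rewrite mulrCA -expr2; lra.
have d2 : `|\sum_(z <- irange M) \sum_(y <- irange M) 2 * Num.sqrt (Z y z / A)
   - \sum_(z <- irange M) kap * Num.max 0 (Y z)| <= 20 * X ^+ 2.
  rewrite -sumrB; apply: le_trans (ler_norm_sum _ _ _) _.
  apply: le_trans (ler_sum _ (fun z _ => e3 z)) _; rewrite -mulr_sumr.
  by have := ler_wpM2l (ltW X0) Nind; rewrite mulrCA -expr2; lra.
move: d1 d2 e4; rewrite -/L; set S1 := \sum_(z <- _) _; set S2 := \sum_(z <- _) _.
by rewrite !ler_norml => /andP[? ?] /andP[? ?] /andP[? ?]; lra.
Qed.

End EllipsoidCount.

(** * Primitive lattice points *)

Section Boxes.

Definition box (M : nat) : seq (int * int * int) :=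
  [seq (u, z) | u <- [seq (x, y) | x <- irange M, y <- irange M], z <- irange M].

Lemma box_uniq M : uniq (box M).
Proof.
apply: allpairs_uniq => [||[? ?] [? ?] _ _ [-> ->]//]; last exact: irange_uniq.
by apply: allpairs_uniq => [||[? ?] [? ?] _ _ [-> ->]//]; exact: irange_uniq.
Qed.

Lemma mem_box M v : (v \in box M) = [&& (`|v.1.1| <= M)%N, (`|v.1.2| <= M)%N & (`|v.2| <= M)%N].
Proof.
case: v => -[x y] z /=; rewrite -!mem_irange /box; apply/idP/idP.
  case/allpairsPdep => u [w [uM wM [Eu ->]]].
  case/allpairsPdep: uM => a [b [aM bM E]].
  by move: Eu; rewrite E => -[-> ->]; rewrite aM bM.
move=> /and3P[xM yM zM]; apply/allpairsPdep; exists (x, y), z; split=> //.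
by apply/allpairsPdep; exists x, y.
Qed.

Lemma sum_box (R : zmodType) M (f : int * int * int -> R) :
  \sum_(v <- box M) f v =
  \sum_(z <- irange M) \sum_(y <- irange M) \sum_(x <- irange M) f (x, y, z).
Proof.
rewrite big_allpairs exchange_big; apply: eq_bigr => z _.
by rewrite big_allpairs exchange_big.
Qed.

Definition gcd3 (v : int * int * int) : nat := gcdn (gcdn `|v.1.1| `|v.1.2|) `|v.2|.

Definition scale3 (d : nat) (v : int * int * int) := (d%:Z * v.1.1, d%:Z * v.1.2, d%:Z * v.2).

Lemma gcd3_scale d v : gcd3 (scale3 d v) = (d * gcd3 v)%N.
Proof. by rewrite /gcd3 /= !abszM /= !muln_gcdr. Qed.

Lemma gcd3_eq0 v : (gcd3 v == 0%N) = (v == (0, 0, 0)).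
Proof.
case: v => -[x y] z; rewrite /gcd3 /= -!leqn0 leqNgt gcdn_gt0 negb_or -leqNgt.
rewrite leqNgt gcdn_gt0 negb_or -!leqNgt !leqn0 !absz_eq0.
by rewrite !xpair_eqE.
Qed.

Lemma gcd3_split v d : (0 < d)%N -> gcd3 v = d -> exists2 w, gcd3 w = 1%N & v = scale3 d w.
Proof.
move=> d0 g; have dvd : [/\ (d %| `|v.1.1|)%N, (d %| `|v.1.2|)%N & (d %| `|v.2|)%N].
  rewrite -g /gcd3; split; last exact: dvdn_gcdr.
    exact: dvdn_trans (dvdn_gcdl _ _) (dvdn_gcdl _ _).
  exact: dvdn_trans (dvdn_gcdl _ _) (dvdn_gcdr _ _).
have E : v = scale3 d ((v.1.1 %/ d%:Z)%Z, (v.1.2 %/ d%:Z)%Z, (v.2 %/ d%:Z)%Z).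
  case: dvd => d1 d2 d3; case: v {g} d1 d2 d3 => -[x y] z /= d1 d2 d3.
  by rewrite /scale3 /= !(mulrC d%:Z) !divzK // dvdzE.
exists ((v.1.1 %/ d%:Z)%Z, (v.1.2 %/ d%:Z)%Z, (v.2 %/ d%:Z)%Z) => //.
have gE := g; rewrite E gcd3_scale in gE.
by apply/eqP; rewrite -(eqn_pmul2l d0) gE muln1.
Qed.

Lemma gcd3_le v M : v \in box M -> v != (0, 0, 0) -> (0 < gcd3 v <= M)%N.
Proof.
rewrite -gcd3_eq0 -lt0n => vM g0; rewrite g0 /=.
move: vM g0; rewrite mem_box /gcd3 => /and3P[a b c].
case: v a b c => -[x y] z /= a b c.
have [z0|z0] := posnP `|z|; last by move=> _; apply: leq_trans c; rewrite dvdn_leq // dvdn_gcdr.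
rewrite z0 gcdn0 => g0; have [y0|y0] := posnP `|y|; last by apply: leq_trans b; rewrite dvdn_leq // dvdn_gcdr.
by move: g0; rewrite y0 gcdn0.
Qed.

End Boxes.

Lemma sum_indicator (R : pzSemiRingType) (T : Type) (s : seq T) (P Q : pred T) :
  \sum_(v <- s | P v) (Q v)%:R = (size [seq v <- s | P v && Q v])%:R :> R.
Proof.
rewrite size_filter -sum1_count natr_sum -big_filter big_mkcond /= big_filter_cond.
rewrite [RHS]big_mkcond big_mkcond; apply: eq_bigr => v _.
by case: (P v); case: (Q v).
Qed.

Section Zeta.
Variable R : realType.

Lemma series_zeta3 n : series (riemannR (3 : R)) n = \sum_(1 <= d < n.+1) (d%:R ^+ 3)^-1.
Proof.
rewrite /series /= big_add1 /=; apply: eq_bigr => i _.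
by rewrite /riemannR powR_mulrn.
Qed.

Lemma inv_cube_le (n : nat) : (0 < n)%N -> (n.+1%:R ^+ 3)^-1 <= n%:R^-1 - n.+1%:R^-1 :> R.
Proof.
move=> n0; have n1 : 1 <= n%:R :> R by rewrite ler1n.
rewrite -natr1; move: n%:R n1 => x x1.
have -> : x^-1 - (x + 1)^-1 = (x * (x + 1))^-1 by field; rewrite !gt_eqF //; lra.
rewrite lef_pV2 ?posrE; nra.
Qed.

Lemma zeta3_bounds (D : nat) : (0 < D)%N ->
  \sum_(1 <= d < D.+1) (d%:R ^+ 3)^-1 <= zeta3 R
    <= \sum_(1 <= d < D.+1) (d%:R ^+ 3)^-1 + D%:R^-1.
Proof.
move=> D0; rewrite -series_zeta3; set u := series (riemannR (3 : R)).
have uS n : u n.+1 = u n + (n.+1%:R ^+ 3)^-1.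
  by rewrite /u !series_zeta3 big_nat_recr.
have up n : u (D + n)%N <= u D + D%:R^-1 - (D + n)%:R^-1.
  elim: n => [|n IH]; first by rewrite addn0; lra.
  rewrite addnS uS; have Dn : (0 < D + n)%N by rewrite addn_gt0 D0.
  move: IH (inv_cube_le Dn).
  move: ((D + n).+1%:R ^+ 3)^-1 (D + n).+1%:R^-1 (D + n)%:R^-1 (D%:R^-1 : R) => a b c e.
  by lra.
have nd : nondecreasing_seq u.
  by apply/nondecreasing_seqP => n; rewrite uS lerDl invr_ge0 exprn_ge0.
have ub n : u n <= u D + D%:R^-1.
  have [le|lt] := leqP n D; first by apply: le_trans (nd _ _ le) _; rewrite lerDl invr_ge0.
  have := up (n - D)%N; rewrite subnKC ?(ltnW lt) // => h; apply: le_trans h _.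
  by rewrite gerDl oppr_le0 invr_ge0.
have cu : cvgn u.
  apply: nondecreasing_is_cvgn => //; exists (u D + D%:R^-1) => _ [n _ <-]; exact: ub.
apply/andP; split; first exact: nondecreasing_cvgn_le.
by apply: limr_le => //; apply: nearW.
Qed.

Lemma zeta3_ge1 : 1 <= zeta3 R.
Proof.
have /andP[+ _] := zeta3_bounds (ltn0Sn 0); apply: le_trans.
by rewrite big_nat1 expr1n invr1.
Qed.

Lemma sum_inv_squares (D : nat) : \sum_(2 <= d < D.+1) (d%:R ^+ 2)^-1 <= 3 / 4 :> R.
Proof.
have [D2|D2] := leqP D.+1 2; first by rewrite big_geq // divr_ge0.
suff : \sum_(2 <= d < D.+1) (d%:R ^+ 2)^-1 <= 3 / 4 - D%:R^-1 :> R.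
  have : 0 <= D%:R^-1 :> R by rewrite invr_ge0.
  by lra.
have -> : D = (D - 2 + 2)%N by lia.
elim: (D - 2)%N => [|n IH]; first by rewrite add0n big_nat1 (_ : (2 ^+ 2)^-1 = 1 / 4); [lra | field].
rewrite addSn big_nat_recr; last lia.
have n0 : 0 < (n + 2)%:R :> R by rewrite ltr0n addn2.
have : ((n + 2).+1%:R ^+ 2)^-1 <= (n + 2)%:R^-1 - (n + 2).+1%:R^-1 :> R.
  rewrite -natr1; move: (n + 2)%:R n0 => x x0.
  have -> : x^-1 - (x + 1)^-1 = (x * (x + 1))^-1 by field; rewrite !gt_eqF //; lra.
  rewrite lef_pV2 ?posrE; nra.
move: IH; move: ((n + 2).+1%:R ^+ 2)^-1 (n + 2).+1%:R^-1 (n + 2)%:R^-1 => a b c.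
by move=> /= IH h; lra.
Qed.

End Zeta.

Section PrimitiveCount.
Variables (R : realType) (A B C r s t : R) (M : nat).
Hypotheses (A1 : 1 <= A) (B1 : 1 <= B) (C1 : 1 <= C).

Definition form3 (v : int * int * int) : R :=
  A * (v.1.1%:~R + r * v.1.2%:~R + s * v.2%:~R) ^+ 2
  + B * (v.1.2%:~R + t * v.2%:~R) ^+ 2 + C * v.2%:~R ^+ 2.

(** The box contains the ellipsoid form3 <= X^2 and its two iterated projections. *)
Definition box_covers (X : R) : Prop :=
  [/\ forall z : int, C * z%:~R ^+ 2 <= X ^+ 2 -> (`|z| <= M)%N,
      forall y z : int, B * (y%:~R + t * z%:~R) ^+ 2 + C * z%:~R ^+ 2 <= X ^+ 2 -> (`|y| <= M)%N
    & forall v, form3 v <= X ^+ 2 -> (`|v.1.1| <= M)%N].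

Let ge0 (Q u : R) : 1 <= Q -> 0 <= Q * u ^+ 2.
Proof. by move=> Q1; rewrite mulr_ge0 ?sqr_ge0 //; lra. Qed.

Lemma box_covers_le X Y : 0 <= Y -> Y <= X -> box_covers X -> box_covers Y.
Proof.
move=> Y0 YX [h1 h2 h3].
have YX2 : Y ^+ 2 <= X ^+ 2 by rewrite lerXn2r ?nnegrE //; lra.
split=> [z le|y z le|v le]; [apply: h1|apply: (h2 y z)|apply: h3]; exact: le_trans le YX2.
Qed.

Lemma box_covers_mem X v : box_covers X -> form3 v <= X ^+ 2 -> v \in box M.
Proof.
move=> [h1 h2 h3] le; rewrite mem_box h3 //=; move: le; rewrite /form3 => le.
have := ge0 (v.1.1%:~R + r * v.1.2%:~R + s * v.2%:~R) A1.
have := ge0 (v.1.2%:~R + t * v.2%:~R) B1; have := ge0 v.2%:~R C1 => a b c.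
by rewrite (h2 v.1.2 v.2) ?h1 //; lra.
Qed.

Lemma form3_scale d v : form3 (scale3 d v) = d%:R ^+ 2 * form3 v.
Proof. by rewrite /form3 /scale3 /= !intrM -!pmulrn; ring. Qed.

Lemma int_sqr_ge1 (z : int) : z != 0 -> 1 <= z%:~R ^+ 2 :> R.
Proof.
move=> z0; rewrite -rmorphXn /= ler1z; have : 0 < z ^+ 2 by rewrite exprn_even_gt0.
by [].
Qed.

Lemma form3_ge1 v : v != (0, 0, 0) -> 1 <= form3 v.
Proof.
case: v => -[x y] z; rewrite /form3 /= => nz.
have a := ge0 (x%:~R + r * y%:~R + s * z%:~R) A1.
have b := ge0 (y%:~R + t * z%:~R) B1; have c := ge0 z%:~R C1.
have g (Q : R) (k : int) : 1 <= Q -> k != 0 -> 1 <= Q * k%:~R ^+ 2.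
  by move=> Q1 k0; have := int_sqr_ge1 k0; nra.
have [z0|z0] := eqVneq z 0; last by have := g C z C1 z0; lra.
rewrite z0 !mulr0 !addr0 in a b *.
have [y0|y0] := eqVneq y 0; last first.
  by have := g B y B1 y0; rewrite expr0n mulr0 addr0; lra.
rewrite y0 !mulr0 !addr0 in a b *.
have x0 : x != 0 by apply: contra nz => /eqP ->; rewrite y0 z0.
by have := g A x A1 x0; rewrite !expr0n !mulr0 !addr0.
Qed.

Definition prim_count (X : R) : R :=
  \sum_(v <- box M | gcd3 v == 1%N) (form3 v <= X ^+ 2)%R%:R.

(** A nonzero vector of the ellipsoid of radius X with gcd d is d times a primitive
    vector of the ellipsoid of radius X / d. *)
Lemma count_by_gcd X D : 0 <= X -> box_covers X -> (M <= D)%N ->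
  \sum_(v <- box M | v != (0, 0, 0)) (form3 v <= X ^+ 2)%R%:R =
  \sum_(1 <= d < D.+1) prim_count (X / d%:R).
Proof.
move=> X0 cX MD.
transitivity (\sum_(v <- box M | v != (0, 0, 0)) \sum_(1 <= d < D.+1)
    (if gcd3 v == d then (form3 v <= X ^+ 2)%R%:R else 0 : R)).
  rewrite big_seq_cond [RHS]big_seq_cond; apply: eq_bigr => v /andP[vM v0].
  have /andP[g0 gM] := gcd3_le vM v0.
  rewrite (bigD1_seq (gcd3 v)) ?iota_uniq //=; last first.
    by rewrite mem_index_iota g0 /=; lia.
  by rewrite eqxx big1 ?addr0 // => d; rewrite eq_sym => /negbTE ->.
rewrite exchange_big big_nat [RHS]big_nat; apply: eq_bigr => d /andP[d0 dD].
have dR : 0 < d%:R :> R by rewrite ltr0n.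
have fd v : (form3 (scale3 d v) <= X ^+ 2) = (form3 v <= (X / d%:R) ^+ 2).
  by rewrite form3_scale expr_div_n ler_pdivlMr ?exprn_gt0 // mulrC.
have Xd : X / d%:R <= X by rewrite ler_pdivrMr // ler_peMr // ler1n.
have Xd0 : 0 <= X / d%:R by rewrite divr_ge0 // ltW.
rewrite /prim_count -big_mkcondr /= !sum_indicator; congr _%:R.
rewrite -[RHS](size_map (scale3 d)); apply: perm_size; apply: uniq_perm.
- by rewrite filter_uniq // box_uniq.
- rewrite map_inj_uniq ?filter_uniq ?box_uniq // => -[[x y] z] [[x' y'] z'].
  have dz : d%:Z != 0 by rewrite eqz_nat -lt0n.
  by case=> /(mulfI dz) -> /(mulfI dz) -> /(mulfI dz) ->.
move=> v; rewrite mem_filter; apply/idP/mapP => [/andP[/andP[/andP[v0 /eqP gv] fv] vM]|[w]].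
  have [w gw E] := gcd3_split d0 gv; exists w => //; rewrite mem_filter gw eqxx /=.
  have fw : form3 w <= (X / d%:R) ^+ 2 by rewrite -fd -E.
  by rewrite fw /=; apply: box_covers_mem fw; exact: box_covers_le cX.
rewrite mem_filter => /andP[/andP[/eqP gw fw] _] ->.
have fw' : form3 (scale3 d w) <= X ^+ 2 by rewrite fd.
rewrite fw' gcd3_scale gw muln1 eqxx andbT (box_covers_mem cX fw') andbT.
by rewrite -gcd3_eq0 gcd3_scale gw muln1 andbT -lt0n.
Qed.

Definition prim_const : R := 4 / 3 * pi / Num.sqrt (A * B * C) / zeta3 R.

Let sqABC : 1 <= Num.sqrt (A * B * C).
Proof.
rewrite -[leLHS]sqrtr1 ler_wsqrtr //.
by apply: mulr_ege1 => //; exact: mulr_ege1.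
Qed.

Lemma prim_const_bound : 0 <= prim_const <= 6.
Proof.
have z1 := zeta3_ge1 R; have p4 := pi_bound R; have p0 := pi_ge0 R.
apply/andP; split.
  by rewrite /prim_const !divr_ge0 // ?mulr_ge0 //; lra.
rewrite /prim_const ler_pdivrMr; last lra.
rewrite ler_pdivrMr; last by have := sqABC; lra.
have := sqABC; move: (Num.sqrt _) => q q1; nra.
Qed.

Lemma prim_count_small X : 0 <= X -> X < 1 -> prim_count X = 0.
Proof.
move=> X0 X1; rewrite /prim_count big1 // => v /eqP g1.
have v0 : v != (0, 0, 0) by rewrite -gcd3_eq0 g1.
case: (leP (form3 v) (X ^+ 2)) => // le; have := le_trans (form3_ge1 v0) le.
by rewrite leNgt exprn_ilt1.
Qed.

Lemma box_has_0 : (0, 0, 0) \in box M.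
Proof. by rewrite mem_box. Qed.

(** Induction on the scale X < 2^n, in place of Moebius inversion: in the sum over
    the gcd d, the terms d >= 2 are known, and their errors K (X / d)^2 add up to
    at most 3 K / 4 times X^2 because the sum of d^-2 over d >= 2 is at most 3/4.
    The constant K = 440 satisfies 104 + 6 + 3 K / 4 <= K, where 104 comes from
    [ellipsoid_count] and the origin and 6 from truncating zeta(3). *)
Lemma prim_count_asymp X : 0 <= X -> box_covers X ->
  `|prim_count X - prim_const * X ^+ 3| <= 440 * X ^+ 2.
Proof.
move=> X0; have [n Xn] : exists n : nat, X < 2 ^+ n.
  have [k Xk] : exists k : nat, X < k%:R.
    by exists (Num.bound X); exact: archi_boundP.
  exists k; apply: lt_trans Xk _; rewrite -natrX ltr_nat; exact: ltn_expl.
elim: n X X0 Xn => [|n IH] X X0 Xn cX.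
  have /andP[k0 k6] := prim_const_bound.
  rewrite prim_count_small ?(lt_le_trans Xn) ?expr0 // sub0r normrN ger0_norm; last first.
    by rewrite mulr_ge0 ?exprn_ge0.
  have X2 := sqr_ge0 X; have : X ^+ 3 <= X ^+ 2.
    by rewrite exprS ler_piMl // ltW // -[ltRHS](expr0 2).
  by nra.
have /andP[k0 k6] := prim_const_bound.
have [X1|X1] := ltP X 1.
  rewrite prim_count_small // sub0r normrN ger0_norm; last by rewrite mulr_ge0 ?exprn_ge0.
  have X2 := sqr_ge0 X; have : X ^+ 3 <= X ^+ 2 by rewrite exprS ler_piMl // ltW.
  by nra.
have [D [MD XD D0]] : exists D : nat, [/\ (M <= D)%N, X <= D%:R & (0 < D)%N].
  exists (maxn M (Num.bound X)).+1; split=> //; first by rewrite leqW ?leq_maxl.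
  apply: ltW; apply: (lt_le_trans (y := (Num.bound X)%:R)).
    exact: archi_boundP.
  by rewrite ler_nat leqW ?leq_maxr.
have X2 : 1 <= X ^+ 2 by rewrite expr_ge1.
have Nst : `|\sum_(v <- box M | v != (0, 0, 0)) (form3 v <= X ^+ 2)%R%:R
     - prim_const * zeta3 R * X ^+ 3| <= 104 * X ^+ 2.
  have [h1 h2 h3] := cX.
  have := ellipsoid_count A1 B1 C1 X1 h1 h2 (fun x y z => h3 ((x, y), z)).
  rewrite -(sum_box M (fun v => (form3 v <= X ^+ 2)%R%:R)) (bigD1_seq (0, 0, 0)) ?box_has_0 ?box_uniq //=.
  have -> : form3 (0, 0, 0) = 0 by rewrite /form3 /= !mulr0 !addr0 !expr0n !mulr0 !addr0.
  rewrite sqr_ge0 /=.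
  have -> : 4 / 3 * pi * X ^+ 3 / Num.sqrt (A * B * C) = prim_const * zeta3 R * X ^+ 3.
    have z1 := zeta3_ge1 R; rewrite /prim_const; field.
    by rewrite !gt_eqF //; [have := sqABC; lra | lra].
  by rewrite !ler_norml => /andP[a b]; apply/andP; split; lra.
move: Nst; rewrite (count_by_gcd X0 cX MD) big_ltn // divr1.
set S := \sum_(2 <= d < _) _ => Nst.
pose T : R := \sum_(2 <= d < D.+1) (d%:R ^+ 3)^-1.
have ST : `|S - prim_const * X ^+ 3 * T| <= 440 * X ^+ 2 * (3 / 4).
  rewrite /S /T mulr_sumr -sumrB; apply: le_trans (ler_norm_sum _ _ _) _.
  apply: (@le_trans _ _ (\sum_(2 <= d < D.+1) 440 * X ^+ 2 * (d%:R ^+ 2)^-1)).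
    rewrite big_nat [leRHS]big_nat; apply: ler_sum => d /andP[d2 dD].
    have dR : 2 <= d%:R :> R by rewrite ler_nat.
    have Xd2 : X / d%:R <= X / 2.
      by rewrite ler_wpM2l // lef_pV2 ?posrE //; lra.
    have Xd0 : 0 <= X / d%:R by rewrite divr_ge0.
    have := IH (X / d%:R) Xd0.
    have -> : prim_const * (X / d%:R) ^+ 3 = prim_const * X ^+ 3 * (d%:R ^+ 3)^-1.
      by rewrite expr_div_n mulrA.
    have -> : 440 * (X / d%:R) ^+ 2 = 440 * X ^+ 2 * (d%:R ^+ 2)^-1.
      by rewrite expr_div_n mulrA.
    apply; first by move: Xn; rewrite exprS; lra.
    by apply: box_covers_le cX => //; lra.
  rewrite -mulr_sumr; apply: ler_wpM2l; last exact: sum_inv_squares.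
  by rewrite mulr_ge0 ?ler0n ?sqr_ge0.
have /andP[z1 z2] := zeta3_bounds R D0.
rewrite big_ltn // expr1n invr1 -/T in z1 z2.
have zT : 0 <= zeta3 R - 1 - T by rewrite -addrA -opprD subr_ge0.
have zT' : zeta3 R - 1 - T <= D%:R^-1 by rewrite -addrA -opprD lerBlDr [leRHS]addrC.
have X3 : 0 <= X ^+ 3 by rewrite exprn_ge0.
have tail : X ^+ 3 * D%:R^-1 <= X ^+ 2.
  by rewrite exprSr -mulrA ler_piMr ?sqr_ge0 // ler_pdivrMr ?mul1r // ltr0n.
have kz : `|prim_const * X ^+ 3 * (zeta3 R - 1 - T)| <= 6 * X ^+ 2.
  have kX : 0 <= prim_const * X ^+ 3 by apply: mulr_ge0.
  rewrite ger0_norm; last exact: mulr_ge0.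
  rewrite -mulrA; apply: ler_pM => //; first exact: mulr_ge0.
  by apply: le_trans tail; rewrite ler_wpM2l.
move: Nst ST kz; rewrite !ler_norml.
have -> : prim_const * X ^+ 3 * (zeta3 R - 1 - T) =
  prim_const * zeta3 R * X ^+ 3 - prim_const * X ^+ 3 - prim_const * X ^+ 3 * T by ring.
by move=> /andP[? ?] /andP[? ?] /andP[? ?]; apply/andP; split; lra.
Qed.

End PrimitiveCount.

(** * Shells of lines and power sums *)

Section Shells.

Definition sup3 (v : int * int * int) : nat := maxn (maxn `|v.1.1| `|v.1.2|) `|v.2|.

Lemma mem_box_sup M v : (v \in box M) = (sup3 v <= M)%N.
Proof. by rewrite mem_box /sup3 !geq_max andbA. Qed.

Lemma size_box M : size (box M) = ((M.*2.+1) ^ 3)%N.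
Proof. by rewrite !size_allpairs !size_map !size_iota; rewrite !expnS expn0 muln1 mulnA. Qed.

Lemma sup3_eq0 v : (sup3 v == 0%N) = (v == (0, 0, 0)).
Proof.
by case: v => -[x y] z; rewrite /sup3 -!leqn0 !geq_max !leqn0 !absz_eq0 /= !xpair_eqE.
Qed.

Lemma shell_size M : size [seq v <- box M.+1 | sup3 v == M.+1] = (24 * M.+1 ^ 2 + 2)%N.
Proof.
have : size [seq v <- box M.+1 | (sup3 v <= M)%N] = size (box M).
  apply: perm_size; apply: uniq_perm; rewrite ?filter_uniq ?box_uniq // => v.
  by rewrite mem_filter !mem_box_sup; case: leqP => // le; rewrite leqW.
have := count_predC (fun v => (sup3 v <= M)%N) (box M.+1).
rewrite -!size_filter.
have -> : [seq v <- box M.+1 | predC (fun v => (sup3 v <= M)%N) v] =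
          [seq v <- box M.+1 | sup3 v == M.+1].
  by apply: eq_in_filter => v; rewrite mem_box_sup /= => le; rewrite -ltnNge eqn_leq le.
rewrite !size_box -!addnn => E1 E2; move: E1; rewrite E2 => E1; nia.
Qed.

(** The cubical shell of radius k has 24 k^2 + 2 <= 26 k^2 points. *)
Lemma shell_sum (R : realDomainType) (F : nat -> R) M : (forall k, 0 <= F k) ->
  \sum_(v <- box M | v != (0, 0, 0)) F (sup3 v) <= \sum_(1 <= k < M.+1) 26 * k%:R ^+ 2 * F k.
Proof.
move=> F0; elim: M => [|M IH].
  rewrite big_geq // big_seq_cond big1 // => v /andP[].
  by rewrite mem_box_sup leqn0 sup3_eq0 => ->.
rewrite big_nat_recr //= (bigID (fun v => (sup3 v <= M)%N)) /=; apply: lerD.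
  apply: le_trans IH; rewrite le_eqVlt; apply/orP; left; apply/eqP.
  rewrite -big_filter -[RHS]big_filter; apply: perm_big.
  apply: uniq_perm; rewrite ?filter_uniq ?box_uniq // => v.
  rewrite !mem_filter !mem_box_sup -andbA; congr (_ && _).
  by case: (leqP (sup3 v) M) => //= le; rewrite leqW.
apply: (@le_trans _ _ (\sum_(v <- [seq v <- box M.+1 | sup3 v == M.+1]) F M.+1)).
  rewrite -big_filter le_eqVlt; apply/orP; left; apply/eqP.
  have -> : [seq v <- box M.+1 | (v != (0, 0, 0)) && ~~ (sup3 v <= M)%N] =
            [seq v <- box M.+1 | sup3 v == M.+1].
    apply: eq_in_filter => v; rewrite mem_box_sup -ltnNge -sup3_eq0 [sup3 v == M.+1]eqn_leq => -> /=.
    by rewrite andbC; case: ltnP => // lt; rewrite -lt0n (leq_ltn_trans _ lt).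
  rewrite big_seq [RHS]big_seq; apply: eq_bigr => v.
  by rewrite mem_filter => /andP[/eqP ->].
rewrite big_const_seq count_predT shell_size iter_addr_0 -[leLHS]mulr_natl.
apply: ler_wpM2r => //; rewrite natrD natrM natrX.
have : 1 <= M.+1%:R ^+ 2 :> R by rewrite exprn_ege1 // ler1n.
lra.
Qed.

Lemma ler_sum_sub (R : realDomainType) (T : eqType) (s1 s2 : seq T) (f : T -> R) :
  uniq s1 -> uniq s2 -> {subset s1 <= s2} -> (forall x, 0 <= f x) ->
  \sum_(x <- s1) f x <= \sum_(x <- s2) f x.
Proof.
move=> u1 u2 sub f0; rewrite [leRHS](bigID (mem s1)) /= -[leLHS]addr0; apply: lerD.
  rewrite -[leRHS]big_filter le_eqVlt; apply/orP; left; apply/eqP; apply: perm_big.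
  apply: uniq_perm; rewrite ?filter_uniq // => x; rewrite mem_filter.
  by case: (boolP (x \in s1)) => // /sub ->.
by apply: sumr_ge0.
Qed.

End Shells.

Section PowerSums.
Variable R : realType.

Lemma ln_step (k : nat) : (0 < k)%N -> k.+1%:R^-1 <= ln k.+1%:R - ln k%:R :> R.
Proof.
move=> k0; have kR : 0 < k%:R :> R by rewrite ltr0n.
rewrite -lerN2 opprB -ln_div ?posrE ?ltr0n //.
have -> : k%:R / k.+1%:R = 1 + (- k.+1%:R^-1) :> R.
  by rewrite -natr1; field; rewrite gt_eqF //; lra.
apply: le_ln1Dx; rewrite ltrN2 invf_lt1 ?ltr0n // ltr1n.
by [].
Qed.

Lemma harmonic_le (n : nat) : (0 < n)%N -> \sum_(1 <= k < n.+1) k%:R^-1 <= 1 + ln n%:R :> R.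
Proof.
case: n => // n _; elim: n => [|n IH]; first by rewrite big_nat1 ln1 addr0 invr1.
rewrite big_nat_recr //=; apply: le_trans (lerD IH (ln_step (ltn0Sn n))) _.
have -> : forall x y z : R, x + y + (z - y) = x + z by move=> x y z; ring.
by [].
Qed.

Lemma power_step (eta : R) (k : nat) : 0 < eta -> (0 < k)%N ->
  eta * k.+1%:R `^ (- 1 - eta) <= k%:R `^ (- eta) - k.+1%:R `^ (- eta).
Proof.
move=> e0 k0; have kR : 0 < k%:R :> R by rewrite ltr0n.
have kR1 : 0 < k.+1%:R :> R by rewrite ltr0n.
have -> : k.+1%:R `^ (- 1 - eta) = k.+1%:R^-1 * k.+1%:R `^ (- eta) :> R.
  rewrite powRD; last by apply/implyP => _; rewrite gt_eqF.
  by rewrite powR_inv1 // ltW.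
have h : 1 + eta * k.+1%:R^-1 <= expR (eta * (ln k.+1%:R - ln k%:R)).
  apply: le_trans (expR_ge1Dx _); rewrite lerD2l ler_pM2l //; exact: ln_step.
have -> : k%:R `^ (- eta) = k.+1%:R `^ (- eta) * expR (eta * (ln k.+1%:R - ln k%:R)).
  rewrite /powR !gt_eqF // -expRD; congr expR; ring.
have := ler_wpM2l (powR_ge0 k.+1%:R (- eta)) h.
by move: (k.+1%:R `^ (- eta)) (expR _) (k.+1%:R^-1 : R) => p E q h2; lra.
Qed.

Lemma power_tail (eta : R) (V n : nat) : 0 < eta -> (0 < V)%N -> 
  \sum_(V.+1 <= k < V.+1 + n) k%:R `^ (- 1 - eta) <= eta^-1 * V%:R `^ (- eta).
Proof.
move=> e0 V0.
suff : \sum_(V.+1 <= k < V.+1 + n) k%:R `^ (- 1 - eta)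
  <= eta^-1 * (V%:R `^ (- eta) - (V + n)%:R `^ (- eta)).
  move/le_trans; apply; rewrite ler_pM2l ?invr_gt0 // gerDl oppr_le0; exact: powR_ge0.
elim: n => [|n IH]; first by rewrite !addn0 big_geq // subrr mulr0.
rewrite !addnS big_nat_recr /=; last by rewrite leq_addr.
have := @power_step eta (V + n) e0 _; rewrite addn_gt0 V0 -addSn => /(_ isT).
rewrite -ler_pdivlMl // => h; have := lerD IH h; rewrite -mulrDr.
move/le_trans; apply; rewrite ler_pM2l ?invr_gt0 // addrA addSn; lra.
Qed.

Lemma power_sum_conv (eta : R) (n : nat) : 0 < eta ->
  \sum_(1 <= k < n.+1) k%:R `^ (- 1 - eta) <= 1 + eta^-1 :> R.
Proof.
move=> e0; have e1 : 0 < eta^-1 by rewrite invr_gt0.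
case: n => [|n]; first by rewrite big_geq //; lra.
rewrite big_ltn // powR1; apply: lerD => //.
by have := @power_tail eta 1 n e0 isT; rewrite powR1 mulr1 add2n.
Qed.

End PowerSums.

(** * Quadratic forms of bounded height on a fixed line *)

Definition line_gram (v c : int * int * int) : int := \det (gram (basis2_fun v c)).

Definition intr3 (R : pzRingType) (v : int * int * int) : R * R * R :=
  (v.1.1%:~R, v.1.2%:~R, v.2%:~R).

Lemma prim_gcd3 v : primitive_triples v <-> gcd3 v = 1%N.
Proof. by rewrite /primitive_triples /= /gcdz /gcd3; split=> [[]|->]. Qed.

Section Casts.
Variable R : realType.

Lemma veronese_intr p k : veronese (intr3 R p) k = (veronese p k)%:~R.
Proof.
case: p => -[a b] c; rewrite /veronese /seqf /intr3 /=.
by move: k => [|[|[|[|[|[|k]]]]]] /=; rewrite ?nth_nil ?intrM.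
Qed.

Lemma polar_veronese_intr p p' k :
  polar_veronese (intr3 R p) (intr3 R p') k = (polar_veronese p p' k)%:~R.
Proof.
case: p => -[a b] c; case: p' => -[a' b'] c'; rewrite /polar_veronese /seqf /intr3 /=.
by move: k => [|[|[|[|[|[|k]]]]]] /=; rewrite ?nth_nil ?rmorphMn ?intrD /= ?intrM.
Qed.

Lemma dot6_intr (P Q : nat -> R) (P0 Q0 : nat -> int) :
  (forall k, P k = (P0 k)%:~R) -> (forall k, Q k = (Q0 k)%:~R) ->
  dot6 P Q = (dot6 P0 Q0)%:~R.
Proof. by move=> hP hQ; rewrite /dot6 !hP !hQ !intrD !intrM. Qed.

Lemma ternary_intr (a b c d e f x y z : int) : (ternary a b c d e f x y z)%:~R =
  ternary a%:~R b%:~R c%:~R d%:~R e%:~R f%:~R x%:~R y%:~R z%:~R :> R.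
Proof. by rewrite /ternary !mulr2n !expr2 !(intrD, mulrNz, intrM). Qed.

Lemma gram_form_intr p p' x y z : (gram_form p p' x y z)%:~R =
  gram_form (intr3 R p) (intr3 R p') x%:~R y%:~R z%:~R :> R.
Proof.
have h := veronese_intr p; have h' := veronese_intr p'; have h2 := polar_veronese_intr p p'.
rewrite /gram_form ternary_intr.
by rewrite (dot6_intr h h) (dot6_intr h h2) (dot6_intr h h') (dot6_intr h2 h2)
  (dot6_intr h2 h') (dot6_intr h' h').
Qed.

Lemma cross3_intr p p' : cross3 (intr3 R p) (intr3 R p') = intr3 R (cross3 p p').
Proof. by rewrite /cross3 /intr3 /= !intrB !intrM. Qed.

Lemma dot3_intr p p' : dot3 (intr3 R p) (intr3 R p') = (dot3 p p')%:~R.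
Proof. by rewrite /dot3 /intr3 /= !intrD !intrM. Qed.

Lemma dot3_ge1 v : gcd3 v = 1%N -> 1 <= (dot3 v v)%:~R :> R.
Proof.
move=> g; have nz : v != (0, 0, 0) by rewrite -gcd3_eq0 g.
rewrite ler1z; have : 0 < dot3 v v; last by [].
rewrite /dot3 -!expr2 lt_neqAle eq_sym !addr_ge0 ?sqr_ge0 // andbT.
apply: contra nz; rewrite !paddr_eq0 ?addr_ge0 ?sqr_ge0 // !sqrf_eq0.
by case: v {g} => -[x y] z /= /andP[/andP[/eqP -> /eqP ->] /eqP ->].
Qed.

Lemma plane_disc_gt0 v : gcd3 v = 1%N -> 0 < plane_disc (intr3 R v).
Proof.
move=> /dot3_ge1 n1; have := plane_disc_ge (intr3 R v); rewrite dot3_intr.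
have : 0 < (dot3 v v)%:~R ^+ 3 :> R by rewrite exprn_gt0 //; lra.
by lra.
Qed.

(** The pivots of [gram_form_ldl], divided by n / 12, are at least 1. *)
Lemma line_gram_form v : primitive_triples v -> exists A B C r s t : R,
  [/\ 1 <= A /\ 1 <= B, 1 <= C,
      Num.sqrt (A * B * C) = plane_disc (intr3 R v) * Num.sqrt ((12 / (dot3 v v)%:~R) ^+ 3)
    & forall c, (line_gram v c)%:~R = (dot3 v v)%:~R / 12 * form3 A B C r s t c].
Proof.
move=> pv; have [p [p' [[_ Ep Ep'] Cr bp bp']]] := line_frameP pv.
pose n : R := (dot3 v v)%:~R.
have n1' : 1 <= n by apply: dot3_ge1; apply/prim_gcd3.
have n0 : 0 < n by lra.
have [] := @gram_form_ldl R (intr3 R p) (intr3 R p') n.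
- by rewrite cross3_intr Cr dot3_intr.
- by [].
- by rewrite dot3_intr /n ler_int.
- by rewrite dot3_intr /n -[2]/(2%:~R) -intrM ler_int.
move=> a [b [c [r [s [t [[ha hb] hc E H]]]]]].
pose k := 12 / n; have k0 : 0 < k by rewrite divr_gt0.
have kn : k * (n / 12) = 1 by rewrite /k; field; rewrite gt_eqF.
have ge1 u : n / 12 <= u -> 1 <= k * u by move=> h; rewrite -kn ler_pM2l.
exists (k * a), (k * b), (k * c), r, s, t; split.
- by rewrite !ge1.
- by rewrite ge1.
- have -> : k * a * (k * b) * (k * c) = plane_disc (intr3 R v) ^+ 2 * k ^+ 3.
    by rewrite -Cr -cross3_intr -E; ring.
  by rewrite sqrtrM ?sqr_ge0 // sqrtr_sqr gtr0_norm // plane_disc_gt0; last exact/prim_gcd3.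
move=> d; rewrite /line_gram (gram2 _ pv Ep Ep' Cr) gram_form_intr H /form3 -/n.
by rewrite -[LHS]mul1r -[X in X * _ = _]kn; ring.
Qed.

Lemma box_covers_exists (B C r s t X : R) : 1 <= B -> 1 <= C -> 0 <= X ->
  forall A, 1 <= A -> exists M0, forall M, (M0 <= M)%N -> box_covers A B C r s t M X.
Proof.
move=> B1 C1 X0 A A1.
have root (Q u : R) : 1 <= Q -> Q * u ^+ 2 <= X ^+ 2 -> `|u| <= X.
  move=> Q1 h; rewrite -[leRHS]ger0_norm // -ler_sqr ?nnegrE // !real_normK ?num_real //.
  by apply: le_trans h; rewrite ler_peMl // sqr_ge0.
have pos (Q u : R) : 1 <= Q -> 0 <= Q * u ^+ 2 by move=> Q1; rewrite mulr_ge0 ?sqr_ge0 //; lra.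
pose Y := X + `|t| * X; pose Z := X + `|r| * Y + `|s| * X.
have Y0 : 0 <= Y by rewrite addr_ge0 ?mulr_ge0.
have Z0 : 0 <= Z by rewrite !addr_ge0 ?mulr_ge0.
have absR (z : int) : `|z%:~R| = `|z|%N%:R :> R by rewrite -intr_norm -abszE.
have nat_le (z : int) (W : R) (M : nat) : `|z%:~R| <= W -> W <= M%:R -> (`|z| <= M)%N.
  by move=> h1 h2; rewrite -(ler_nat R) -absR; exact: le_trans h2.
have tri1 (x y : R) : `|x| <= `|x + y| + `|y|.
  by rewrite -{1}(addrK y x); exact: ler_normB.
exists (maxn (Num.bound X) (maxn (Num.bound Y) (Num.bound Z))) => M.
rewrite !geq_max => /and3P[MX MY MZ].
have bd W N : 0 <= W -> (Num.bound W <= N)%N -> W <= N%:R.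
  by move=> W0 h; apply: le_trans (ltW (archi_boundP W0)) _; rewrite ler_nat.
have zX (z : int) : C * z%:~R ^+ 2 <= X ^+ 2 -> `|z%:~R : R| <= X by exact: root.
have yY (y z : int) : B * (y%:~R + t * z%:~R) ^+ 2 + C * z%:~R ^+ 2 <= X ^+ 2 -> `|y%:~R : R| <= Y.
  move=> h; have b := pos B (y%:~R + t * z%:~R) B1; have c := pos C z%:~R C1.
  apply: le_trans (tri1 _ (t * z%:~R)) _; apply: lerD; first by apply: (root B) => //; lra.
  by rewrite normrM ler_wpM2l // zX //; lra.
split.
- by move=> z /zX /nat_le; apply; exact: bd.
- by move=> y z /yY /nat_le; apply; exact: bd.
move=> [[x y] z]; rewrite /form3 /= => h.
have a := pos A (x%:~R + r * y%:~R + s * z%:~R) A1.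
have b := pos B (y%:~R + t * z%:~R) B1; have c := pos C z%:~R C1.
apply: (nat_le x Z) => //; last exact: bd.
apply: le_trans (tri1 _ (s * z%:~R)) _; rewrite /Z; apply: lerD.
  apply: le_trans (tri1 _ (r * y%:~R)) _; rewrite [X in `|X|]addrAC; apply: lerD.
    by apply: (root A) => //; lra.
  by rewrite normrM ler_wpM2l // (yY y z) //; lra.
by rewrite normrM ler_wpM2l // zX //; lra.
Qed.

Lemma sqrt_cube (u : R) : 0 <= u -> Num.sqrt (u ^+ 3) = Num.sqrt u ^+ 3.
Proof.
move=> u0; rewrite exprSr sqrtrM ?exprn_ge0 // sqrtr_sqr ger0_norm //.
by rewrite [in RHS]exprSr sqr_sqrtr.
Qed.

Definition leading : R := 4 / 3 * pi / zeta3 R.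

(** [prim_count_asymp] with radius sqrt (12 Y / n), so that 5280 = 12 * 440. Below radius 1 the ellipsoid
    contains no nonzero integral vector, whence the last clause. *)
Lemma line_count v (Y : R) : primitive_triples v -> 0 <= Y ->
  exists M0, forall M, (M0 <= M)%N ->
  [/\ forall c, (line_gram v c)%:~R <= Y -> c \in box M,
      `|\sum_(c <- box M | gcd3 c == 1%N) ((line_gram v c)%:~R <= Y)%R%:R
         - leading * Num.sqrt (Y ^+ 3) / plane_disc (intr3 R v)|
      <= 5280 * (Y / (dot3 v v)%:~R)
    & 12 * Y < (dot3 v v)%:~R -> forall c, gcd3 c = 1%N -> Y < (line_gram v c)%:~R].
Proof.
move=> pv Y0; have [A [B [C [r [s [t [[A1 B1] C1 E H]]]]]]] := line_gram_form pv.
set n : R := (dot3 v v)%:~R in E H *.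
have n1 : 1 <= n by apply: dot3_ge1; apply/prim_gcd3.
have n0 : 0 < n by lra.
pose X := Num.sqrt (12 / n * Y).
have k0 : 0 < 12 / n by rewrite divr_gt0.
have kY : 0 <= 12 / n * Y by rewrite mulr_ge0 // ltW.
have X0 : 0 <= X by rewrite sqrtr_ge0.
have X2 : X ^+ 2 = 12 / n * Y by rewrite sqr_sqrtr.
have GX c : ((line_gram v c)%:~R <= Y) = (form3 A B C r s t c <= X ^+ 2).
  rewrite H X2 -[in RHS](ler_pM2l (divr_gt0 n0 (ltr0n R 12))).
  by congr (_ <= _); field; rewrite gt_eqF.
have [M0 HM] := box_covers_exists r s t B1 C1 X0 A1.
exists M0 => M /HM cX; split.
- by move=> c; rewrite GX; exact: box_covers_mem cX.
- have -> : leading * Num.sqrt (Y ^+ 3) / plane_disc (intr3 R v) = prim_const A B C * X ^+ 3.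
    have D0 : 0 < plane_disc (intr3 R v) by apply: plane_disc_gt0; apply/prim_gcd3.
    have -> : X ^+ 3 = Num.sqrt ((12 / n) ^+ 3) * Num.sqrt (Y ^+ 3).
      rewrite -sqrtrM ?exprn_ge0 ?(ltW k0) // -exprMn /X.
      by rewrite sqrt_cube.
    rewrite /prim_const E /leading; field.
    have z1 := zeta3_ge1 R; rewrite !gt_eqF ?sqrtr_gt0 ?exprn_gt0 //; lra.
  have := prim_count_asymp A1 B1 C1 X0 cX; rewrite /prim_count X2.
  under eq_bigr do rewrite -X2 -GX.
  by move/le_trans; apply; rewrite [12 / n * Y]mulrAC; lra.
move=> lt c g1; rewrite ltNge GX; apply/negP => h.
have nz : c != (0, 0, 0) by rewrite -gcd3_eq0 g1.
have := le_trans (form3_ge1 r s t A1 B1 C1 nz) h; rewrite X2 mulrAC ler_pdivlMr // mul1r.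
by lra.
Qed.

End Casts.

(** * The height in terms of the two triples *)

Lemma gcd3_opp v : gcd3 (opp3 v) = gcd3 v.
Proof. by rewrite /gcd3 /opp3 /= !abszN. Qed.

Lemma opp3K : involutive opp3.
Proof. by case=> -[a b] c; rewrite /opp3 /= !opprK. Qed.

(** Of v and - v exactly one is counted on the left. *)
Lemma prim_half_sum (R : nmodType) M (f : int * int * int -> R) : (forall v, f (opp3 v) = f v) ->
  (\sum_(v <- box M | (gcd3 v == 1%N) && pos3 v) f v) *+ 2 = \sum_(v <- box M | gcd3 v == 1%N) f v.
Proof.
move=> fE; rewrite [RHS](bigID pos3) /= mulr2n; congr (_ + _).
have P : perm_eq (box M) [seq opp3 v | v <- box M].
  apply: uniq_perm; rewrite ?map_inj_uniq ?box_uniq //; first exact: inv_inj opp3K.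
  move=> v; rewrite -{2}(opp3K v) mem_map; last exact: inv_inj opp3K.
  by rewrite !mem_box /opp3 /= !abszN.
rewrite (perm_big _ P) big_map; apply: eq_big => [v|v _]; last exact: fE.
rewrite gcd3_opp; case: eqP => //= g; rewrite pos3_opp //.
by rewrite -gcd3_eq0 g.
Qed.

Section Height.
Variables (R : realType) (s t : R).
Hypothesis ht : 0 < t.

Definition nv (v : int * int * int) : R := (dot3 v v)%:~R.

Lemma nv_opp v : nv (opp3 v) = nv v.
Proof. by rewrite /nv /dot3 /opp3 /= !mulrNN. Qed.

Lemma cterm_nv v : cterm s t v = nv v `^ (3 / 2 - 3 / 2 * (s / t)) / plane_disc (intr3 R v).
Proof. by rewrite /nv -dot3_intr /dot3 -!expr2. Qed.

Lemma plane_disc_opp v : plane_disc (intr3 R (opp3 v)) = plane_disc (intr3 R v).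
Proof.
case: v => -[a b] c; rewrite /plane_disc /intr3 /opp3 /= !mulrNz.
by move: (a%:~R) (b%:~R) (c%:~R : R) => x y z; ring.
Qed.

Lemma cterm_opp v : cterm s t (opp3 v) = cterm s t v.
Proof. by rewrite !cterm_nv nv_opp plane_disc_opp. Qed.

Lemma line_gram_gt0 v c : gcd3 v = 1%N -> gcd3 c = 1%N -> 0 < (line_gram v c)%:~R :> R.
Proof.
move=> pv pc; have n1 := dot3_ge1 R pv.
have [A [B [C [r [s0 [t0 [[A1 B1] C1 _ ->]]]]]]] := line_gram_form R ((prim_gcd3 v).2 pv).
have c0 : c != (0, 0, 0) by rewrite -gcd3_eq0 pc.
by have := form3_ge1 r s0 t0 A1 B1 C1 c0 => f1; rewrite mulr_gt0 //; lra.
Qed.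

Lemma line_gram_opp v c : gcd3 v = 1%N ->
  (line_gram v (opp3 c))%:~R = (line_gram v c)%:~R :> R.
Proof.
move=> pv.
have [A [B [C [r [s0 [t0 [_ _ _ H]]]]]]] := line_gram_form R ((prim_gcd3 v).2 pv).
rewrite !H; congr (_ * _); case: c => -[x y] z; rewrite /form3 /opp3 /= !mulrNz.
by move: (x%:~R) (y%:~R) (z%:~R : R) => *; ring.
Qed.

Lemma height_pair v c : gcd3 v = 1%N -> gcd3 c = 1%N ->
  height s t (pair_int v c) =
  Num.sqrt (nv v) `^ (s - t) * Num.sqrt ((line_gram v c)%:~R) `^ t.
Proof.
move=> /prim_gcd3 pv /prim_gcd3 pc.
by rewrite /height (covol1 c R pv) (covolE _ (basis2 pv pc)).
Qed.

(** Solving H <= B for the Gram determinant in degree 2. *)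
Definition threshold (B : R) v : R := B `^ (2 / t) * nv v `^ (1 - s / t).

Lemma nv_ge1 v : gcd3 v = 1%N -> 1 <= nv v.
Proof. exact: dot3_ge1. Qed.

Lemma nv_gt0 v : gcd3 v = 1%N -> 0 < nv v.
Proof. by move=> /nv_ge1; lra. Qed.

Lemma height_gt0 v c : gcd3 v = 1%N -> gcd3 c = 1%N -> 0 < height s t (pair_int v c).
Proof.
move=> pv pc; rewrite height_pair // mulr_gt0 // powR_gt0 // sqrtr_gt0.
  exact: nv_gt0.
exact: line_gram_gt0.
Qed.

Lemma height_le B v c : 0 < B -> gcd3 v = 1%N -> gcd3 c = 1%N ->
  (height s t (pair_int v c) <= B) = ((line_gram v c)%:~R <= threshold B v).
Proof.
move=> B0 pv pc; have n0 := nv_gt0 pv; have G0 := line_gram_gt0 pv pc.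
have H0 := height_gt0 pv pc; rewrite height_pair // in H0 *.
have T0 : 0 < threshold B v by rewrite mulr_gt0 ?powR_gt0.
rewrite -ler_ln ?posrE // -[RHS]ler_ln ?posrE // /threshold.
rewrite !lnM ?posrE ?powR_gt0 ?sqrtr_gt0 // !ln_powR.
rewrite -!powR12_sqrt ?(ltW n0) ?(ltW G0) // !ln_powR.
move: (ln B) (ln (nv v)) (ln (line_gram v c)%:~R) => b n g.
rewrite -[RHS](ler_pM2l (divr_gt0 ht (ltr0n R 2))) -[LHS]subr_ge0 -[RHS]subr_ge0.
by congr (0 <= _); field; rewrite gt_eqF.
Qed.

Lemma threshold_gt0 B v : 0 < B -> gcd3 v = 1%N -> 0 < threshold B v.
Proof. by move=> B0 pv; rewrite mulr_gt0 // powR_gt0 // nv_gt0. Qed.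

Lemma threshold_main B v : 0 < B -> gcd3 v = 1%N ->
  Num.sqrt (threshold B v ^+ 3) / plane_disc (intr3 R v) = B `^ (3 / t) * cterm s t v.
Proof.
move=> B0 pv; have n0 := nv_gt0 pv; have T0 := threshold_gt0 B0 pv.
rewrite cterm_nv mulrA; congr (_ / _).
apply: ln_inj; rewrite ?posrE ?sqrtr_gt0 ?mulr_gt0 ?exprn_gt0 ?powR_gt0 //.
rewrite -powR12_sqrt ?exprn_ge0 ?(ltW T0) // ln_powR lnXn // /threshold.
rewrite !lnM ?posrE ?powR_gt0 // !ln_powR -[_ *+ 3]mulr_natl.
by move: (ln B) (ln (nv v)) => b n; field; rewrite gt_eqF.
Qed.

Lemma threshold_nv B v : 0 < B -> gcd3 v = 1%N ->
  threshold B v / nv v = B `^ (2 / t) * nv v `^ (- (s / t)).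
Proof.
move=> B0 pv; have n0 := nv_gt0 pv; rewrite /threshold -mulrA; congr (_ * _).
rewrite addrC powRD; last by rewrite (gt_eqF n0) implybT.
by rewrite powRr1 ?(ltW n0) // mulfK ?gt_eqF.
Qed.

Lemma sup3_sqr_le v : (sup3 v)%:R ^+ 2 <= nv v.
Proof.
have sq (z : int) : (`|z|%N%:R : R) ^+ 2 = z%:~R ^+ 2.
  by rewrite natr_absz intr_norm real_normK ?num_real.
rewrite /nv -dot3_intr /dot3 /sup3 /= -!expr2 /maxn.
have := sqr_ge0 (v.1.1%:~R : R); have := sqr_ge0 (v.1.2%:~R : R); have := sqr_ge0 (v.2%:~R : R).
by case: ifP => _; last case: ifP => _; rewrite sq; lra.
Qed.

Lemma sup3_gt0 v : gcd3 v = 1%N -> (0 < sup3 v)%N.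
Proof. by move=> pv; rewrite lt0n sup3_eq0 -gcd3_eq0 pv. Qed.

Lemma nv_powR_le (e : R) v : 0 <= e -> gcd3 v = 1%N ->
  nv v `^ (- e) <= (sup3 v)%:R `^ (- (2 * e)).
Proof.
move=> e0 pv; have k0 : 0 < (sup3 v)%:R :> R by rewrite ltr0n sup3_gt0.
have n0 := nv_gt0 pv; rewrite !powRN lef_pV2 ?posrE ?powR_gt0 // powRrM.
apply: ge0_ler_powR; rewrite ?nnegrE ?powR_ge0 ?(ltW n0) //.
by rewrite powR_mulrn ?(ltW k0) // sup3_sqr_le.
Qed.

End Height.

(** * The counting function as a sum over lines *)

Section Counting.
Variables (R : realType) (s t : R).
Hypotheses (hs : 0 < s) (ht : 0 < t).

Lemma points_le_pair (B : R) J : points_le s t B J -> exists v c,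
  [/\ gcd3 v = 1%N /\ pos3 v, gcd3 c = 1%N /\ pos3 c, J = pair_rat v c
    & height s t (pair_int v c) <= B].
Proof.
case=> HJ [I JI hI]; have [v [c [[pv v0] [pc c0] E]]] := hilb2_rat_pair HJ.
exists v, c; split=> //; try by split=> //; apply/prim_gcd3.
rewrite E in HJ JI; by rewrite (integral_model_unique HJ (pair_extends v pc) JI).
Qed.

Lemma points_le_pos (B : R) J : points_le s t B J -> 0 < B.
Proof.
by move=> /points_le_pair[v [c [[pv _] [pc _] _]]]; apply: lt_le_trans; exact: height_gt0.
Qed.

Lemma pair_points_le (B : R) v c : gcd3 v = 1%N -> gcd3 c = 1%N ->
  height s t (pair_int v c) <= B -> points_le s t B (pair_rat v c).
Proof.
move=> pv pc h; have pc' := (prim_gcd3 c).2 pc.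
by split; [exact: pair_rat_hilb | exists (pair_int v c) => //; exact: pair_extends].
Qed.

(** A line of sup norm k carries a point of height at most B only if
    12 B^(2/t) k^(-2s/t) >= 1. *)
Definition line_bound (B : R) : R := (12 * B `^ (2 / t)) `^ (t / (2 * s)).

Lemma line_bound_le (B : R) v c : 0 < B -> gcd3 v = 1%N -> gcd3 c = 1%N ->
  (line_gram v c)%:~R <= threshold s t B v -> (sup3 v)%:R <= line_bound B.
Proof.
move=> B0 pv pc le; have T0 := threshold_gt0 s t B0 pv; have n0 := nv_gt0 R pv.
have [M0 /(_ M0 (leqnn _))[_ _ H]] := line_count ((prim_gcd3 v).2 pv) (ltW T0).
have {H le} : nv R v <= 12 * threshold s t B v.
  by rewrite leNgt; apply/negP => /H /(_ c pc); rewrite ltNge le.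
rewrite -[leLHS]mul1r -ler_pdivlMr // -mulrA threshold_nv // => le.
have e0 : 0 <= s / t by rewrite divr_ge0 ?ltW.
have := nv_powR_le e0 pv; set k : R := (sup3 v)%:R => le2.
have k0 : 0 < k by rewrite ltr0n sup3_gt0.
have {le le2} le : 1 <= 12 * B `^ (2 / t) * k `^ (- (2 * (s / t))).
  apply: le_trans le _; rewrite -[leRHS]mulrA ler_pM2l // ler_pM2l ?powR_gt0 //.
move: le; rewrite powRN ler_pdivlMr ?powR_gt0 // mul1r => le.
have -> : k = (k `^ (2 * (s / t))) `^ (t / (2 * s)).
  rewrite -powRrM (_ : _ * (t / _) = 1) ?powRr1 ?ltW //.
  by field; rewrite !gt_eqF.
have q0 : 0 <= t / (2 * s) by rewrite divr_ge0 ?mulr_ge0 ?ltW.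
by apply: (ge0_ler_powR q0) => //; rewrite nnegrE ?mulr_ge0 ?powR_ge0.
Qed.

Definition line_range (B : R) : nat := Num.truncn (line_bound B).

Lemma line_range_box (B : R) v c : 0 < B -> gcd3 v = 1%N -> gcd3 c = 1%N ->
  (line_gram v c)%:~R <= threshold s t B v -> v \in box (line_range B).
Proof.
move=> B0 pv pc /(line_bound_le B0 pv pc) le.
have /truncn_itv/andP[_ lt] : 0 <= line_bound B by exact: powR_ge0.
by rewrite mem_box_sup -ltnS -(ltr_nat R); exact: le_lt_trans lt.
Qed.

Let prim_pos v := (gcd3 v == 1%N) && pos3 v.

Definition conic_count (B : R) M v : R :=
  \sum_(c <- box M | gcd3 c == 1%N) ((line_gram v c)%:~R <= threshold s t B v)%R%:R.

(** One box of triples c that serves for all the lines of a finite family. *)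
Lemma uniform_box (B : R) V : 0 < B -> exists M, forall v, v \in box V -> gcd3 v = 1%N ->
  (forall c, (line_gram v c)%:~R <= threshold s t B v -> c \in box M) /\
  `|conic_count B M v - leading R * (B `^ (3 / t) * cterm s t v)|
    <= 5280 * (B `^ (2 / t) * nv R v `^ (- (s / t))).
Proof.
move=> B0; have /choice[f Hf] : forall v, exists M0, gcd3 v = 1%N -> forall M, (M0 <= M)%N ->
    (forall c, (line_gram v c)%:~R <= threshold s t B v -> c \in box M) /\
    `|conic_count B M v - leading R * (B `^ (3 / t) * cterm s t v)|
      <= 5280 * (B `^ (2 / t) * nv R v `^ (- (s / t))).
  move=> v; have [pv|npv] := eqVneq (gcd3 v) 1%N; last first.
    by exists 0%N => pv; rewrite pv eqxx in npv.
  have T0 := threshold_gt0 s t B0 pv.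
  have [M0 H] := line_count ((prim_gcd3 v).2 pv) (ltW T0).
  exists M0 => _ M /H[h1 h2 _]; split=> //.
  by rewrite -threshold_main // -threshold_nv // [leading R * _]mulrA.
exists (\max_(v <- box V) f v)%N => v vV pv; apply: Hf => //.
exact: leq_bigmax_seq.
Qed.

Lemma points_le_seq (B : R) V M : 0 < B -> V = line_range B ->
  (forall v, v \in box V -> gcd3 v = 1%N -> forall c,
     (line_gram v c)%:~R <= threshold s t B v -> c \in box M) ->
  finite_set (points_le s t B) /\
  Ncount s t B = \sum_(v <- box V | prim_pos v) \sum_(c <- box M | prim_pos c)
     ((line_gram v c)%:~R <= threshold s t B v)%R%:R.
Proof.
move=> B0 EV HM.
pose P (p : (int * int * int) * (int * int * int)) := [&& prim_pos p.1, prim_pos p.2 &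
  ((line_gram p.1 p.2)%:~R <= threshold s t B p.1)].
pose W := [seq p <- [seq (v, c) | v <- box V, c <- box M] | P p].
pose L := [seq pair_rat p.1 p.2 | p <- W].
have uW : uniq W.
  apply: filter_uniq; apply: allpairs_uniq => [||[? ?] [? ?] _ _ [-> ->]//]; exact: box_uniq.
have uL : uniq L.
  rewrite map_inj_in_uniq // => -[v c] [v' c']; rewrite !mem_filter /P /prim_pos /=.
  move=> /andP[/and3P[/andP[/eqP/prim_gcd3 a b] /andP[/eqP/prim_gcd3 d e] _] _].
  move=> /andP[/and3P[/andP[/eqP/prim_gcd3 a' b'] /andP[/eqP/prim_gcd3 d' e'] _] _].
  by apply: pair_rat_inj.
have E : points_le s t B = [set` [fset x in L]%fset].
  apply/seteqP; split=> J /=; rewrite inE /=.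
    case/points_le_pair => v [c [[pv v0] [pc c0] -> h]].
    rewrite height_le // in h; apply/mapP; exists (v, c) => //.
    have vV : v \in box V by rewrite EV; apply: line_range_box h.
    rewrite mem_filter; apply/andP; split; first by rewrite /P /prim_pos /= pv v0 pc c0.
    by apply/allpairsPdep; exists v, c; split=> //; exact: HM h.
  case/mapP => -[v c]; rewrite mem_filter /P /prim_pos /=.
  move=> /andP[/and3P[/andP[/eqP pv _] /andP[/eqP pc _] h] _] ->.
  by apply: pair_points_le => //; rewrite height_le.
split; first by rewrite E; exact: finite_fset.
rewrite /Ncount E set_fsetK card_fseq undup_id // size_map size_filter -sum1_count natr_sum.
rewrite big_mkcond big_allpairs [RHS]big_mkcond; apply: eq_bigr => v _.
case: ifP => pv; last by rewrite big1 // => c _; rewrite /P /= pv.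
rewrite [RHS]big_mkcond; apply: eq_bigr => c _; rewrite /P /= pv /=. by case: (prim_pos c) => //=; case: (_ <= _).
Qed.

(** The factor 1/4 comes from the signs of v and c, and 2640 = 5280 / 2 from the sign
    of c. The error for the line v is a multiple of n^(-s/t), which is at most
    k^(-2s/t) on the shell of radius k. *)
Lemma count_error (B : R) : 0 < B ->
  finite_set (points_le s t B) /\
  `|Ncount s t B - leading R / 4 * B `^ (3 / t) *
      \sum_(v <- box (line_range B) | gcd3 v == 1%N) cterm s t v|
  <= 2640 * B `^ (2 / t) *
      \sum_(1 <= k < (line_range B).+1) 26 * k%:R ^+ 2 * k%:R `^ (- (2 * (s / t))).
Proof.
move=> B0; have [M HM] := uniform_box (line_range B) B0.
have [|fin ->] := @points_le_seq B _ M B0 erefl.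
  by move=> v vV pv; have [] := HM v vV pv.
split=> //; set V := line_range B in HM *.
have half v : gcd3 v = 1%N -> \sum_(c <- box M | prim_pos c)
    ((line_gram v c)%:~R <= threshold s t B v)%R%:R = conic_count B M v / 2.
  move=> pv; rewrite /conic_count -prim_half_sum; last by move=> c; rewrite line_gram_opp.
  by rewrite -[_ *+ 2]mulr_natr mulfK.
under eq_bigr => v /andP[/eqP pv _] do rewrite half //.
rewrite -prim_half_sum; last exact: cterm_opp.
have -> (S0 : R) : leading R / 4 * B `^ (3 / t) * (S0 *+ 2) = leading R / 2 * B `^ (3 / t) * S0.
  by rewrite -mulr_natr; field.
rewrite [leading R / 2 * _ * _]mulr_sumr -sumrB.
apply: (@le_trans _ _ (\sum_(v <- box V | prim_pos v)
   2640 * B `^ (2 / t) * (sup3 v)%:R `^ (- (2 * (s / t))))).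
  apply: le_trans (ler_norm_sum _ _ _) _; rewrite big_seq_cond [leRHS]big_seq_cond.
  apply: ler_sum => v /and3P[vV /eqP pv _]; have [_ h] := HM v vV pv.
  rewrite (_ : _ - _ = (conic_count B M v - leading R * (B `^ (3 / t) * cterm s t v)) / 2);
    last by field.
  rewrite normrM [Num.norm 2^-1]gtr0_norm ?invr_gt0 // ler_pdivrMr //.
  apply: le_trans h _; have e0 : 0 <= s / t by rewrite divr_ge0 ?ltW.
  rewrite (_ : _ * 2 = 5280 * (B `^ (2 / t) * (sup3 v)%:R `^ (- (2 * (s / t))))); last ring.
  rewrite ler_pM2l ?ltr0n // ler_pM2l ?powR_gt0 //; exact: nv_powR_le.
rewrite -mulr_sumr ler_pM2l ?mulr_gt0 ?powR_gt0 ?ltr0n //.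
apply: le_trans (shell_sum V (F := fun k => k%:R `^ (- (2 * (s / t)))) _).
  rewrite big_mkcond [leRHS]big_mkcond; apply: ler_sum => v _; rewrite /prim_pos.
  case: (eqVneq (gcd3 v) 1%N) => [pv|_] /=; last by case: ifP => // _; exact: powR_ge0.
  have -> : v != (0, 0, 0) by rewrite -gcd3_eq0 pv.
  by case: ifP => // _; exact: powR_ge0.
by move=> k; exact: powR_ge0.
Qed.

End Counting.

(** * Main term and error terms *)

Section MainTerm.
Variables (R : realType) (s t : R).
Hypotheses (hs : 0 < s) (ht : 0 < t).

Let eta := 3 * (s / t).
Let eta0 : 0 < eta.
Proof. by rewrite mulr_gt0 // divr_gt0. Qed.

Lemma cterm_ge0 v : gcd3 v = 1%N -> 0 <= cterm s t v.
Proof. by move=> pv; rewrite cterm_nv divr_ge0 ?powR_ge0 // ltW // plane_disc_gt0. Qed.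

(** The denominator is at least 2 n^3 / 3, and n is at least the square of the sup
    norm. *)
Lemma cterm_le v : gcd3 v = 1%N -> cterm s t v <= 3 / 2 * (sup3 v)%:R `^ (- (3 + eta)).
Proof.
move=> pv; have n0 := nv_gt0 R pv; have D0 := plane_disc_gt0 R pv.
have e0 : 0 <= (3 + eta) / 2 by have := eta0; lra.
have := nv_powR_le e0 pv; rewrite [2 * _]mulrC divfK // => le.
apply: le_trans (_ : 3 / 2 * nv R v `^ (- ((3 + eta) / 2)) <= _); last by rewrite ler_pM2l.
rewrite cterm_nv ler_pdivrMr //.
have -> : 3 / 2 - 3 / 2 * (s / t) = - ((3 + eta) / 2) + 3 by rewrite /eta; field; rewrite gt_eqF.
rewrite powRD ?(gt_eqF n0) ?implybT // powR_mulrn ?(ltW n0) //.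
have := plane_disc_ge (intr3 R v); rewrite dot3_intr -/(nv R v).
have := powR_gt0 (- ((3 + eta) / 2)) n0.
by move: (_ `^ _) (_ ^+ 3) (plane_disc _) => x y z x0 h; nra.
Qed.

Definition box_part (V : nat) : R := \sum_(v <- box V | gcd3 v == 1%N) cterm s t v.

Lemma power_prod (k : nat) : (0 < k)%N ->
  26 * k%:R ^+ 2 * (3 / 2 * k%:R `^ (- (3 + eta))) = 39 * k%:R `^ (- 1 - eta) :> R.
Proof.
move=> k0; have kR : 0 < k%:R :> R by rewrite ltr0n.
have -> : - 1 - eta = - (3 + eta) + 2 by ring.
by rewrite powRD ?(gt_eqF kR) ?implybT // powR_mulrn ?(ltW kR) //; field.
Qed.

Lemma box_part_tail V U : (V <= U)%N ->
  box_part U <= box_part V + 39 * \sum_(V.+1 <= k < U.+1) k%:R `^ (- 1 - eta).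
Proof.
move=> VU; rewrite /box_part (bigID (fun v => (sup3 v <= V)%N)) /=; apply: lerD.
  rewrite -big_filter -[leRHS]big_filter le_eqVlt; apply/orP; left; apply/eqP; apply: perm_big.
  apply: uniq_perm; rewrite ?filter_uniq ?box_uniq // => v; rewrite !mem_filter !mem_box_sup.
  by case: (_ == _) => //=; case: leqP => //= le; rewrite (leq_trans le VU).
pose F k : R := if (V < k)%N then 3 / 2 * k%:R `^ (- (3 + eta)) else 0.
have F0 k : 0 <= F k by rewrite /F; case: ifP => // _; rewrite mulr_ge0 ?powR_ge0.
apply: (@le_trans _ _ (\sum_(v <- box U | v != (0, 0, 0)) F (sup3 v))).
  rewrite big_mkcond [leRHS]big_mkcond; apply: ler_sum => v _; rewrite -gcd3_eq0 -ltnNge.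
  case: (eqVneq (gcd3 v) 1%N) => [pv|_] /=; last by case: ifP.
  by rewrite pv /= /F; case: ifP => // _; exact: cterm_le.
apply: le_trans (shell_sum U F0) _; rewrite (big_cat_nat (n := V.+1)) //=.
rewrite big_nat_cond big1 ?add0r; last first.
  by move=> k /andP[/andP[_ k2] _]; rewrite /F ltnNge -ltnS k2 mulr0.
rewrite mulr_sumr big_nat_cond [leRHS]big_nat_cond; apply: ler_sum => k /andP[/andP[k1 _] _].
by rewrite /F k1 power_prod // (leq_trans _ k1).
Qed.

Lemma box_part_bound U : box_part U <= 39 * (1 + eta^-1).
Proof.
apply: le_trans (box_part_tail (leq0n U)) _.
have -> : box_part 0 = 0.
  rewrite /box_part big_seq_cond big1 // => v /andP[].
  by rewrite mem_box_sup leqn0 sup3_eq0 -gcd3_eq0 => /eqP ->.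
by rewrite add0r ler_pM2l //; exact: power_sum_conv.
Qed.

Lemma box_part_le_tail V U : (0 < V)%N ->
  box_part U <= box_part V + 39 * (eta^-1 * V%:R `^ (- eta)).
Proof.
move=> V0; apply: (@le_trans _ _ (box_part (V + U))).
  pose f v := if gcd3 v == 1%N then cterm s t v else 0.
  have f0 v : 0 <= f v by rewrite /f; case: eqP => // /cterm_ge0.
  rewrite /box_part big_mkcond [leRHS]big_mkcond.
  apply: (@ler_sum_sub _ _ _ _ f); rewrite ?box_uniq // => v.
  by rewrite !mem_box_sup => /leq_trans; apply; exact: leq_addl.
apply: le_trans (box_part_tail (leq_addr _ _)) _; rewrite lerD2l ler_pM2l //.
by rewrite -addSn; exact: power_tail.
Qed.

Let T := \esum_(v in primitive_triples) (cterm s t v)%:E.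

Lemma esum_ge_box V : ((box_part V)%:E <= T)%E.
Proof.
apply: esum_ge; exists [set` [seq v <- box V | gcd3 v == 1%N]].
  split=> [|v]; first exact: finite_seq.
  by rewrite /mkset mem_filter => /andP[/eqP/prim_gcd3].
by rewrite -fsbig_seq ?filter_uniq ?box_uniq // big_filter sumEFin.
Qed.

Lemma esum_le_box x : (forall U, box_part U <= x) -> (T <= x%:E)%E.
Proof.
move=> H; apply: ge_ereal_sup => _ [X [fX XP]] <-.
rewrite fsbig_finite //= sumEFin lee_fin.
pose U := (\max_(v <- fset_set X) sup3 v)%N.
apply: le_trans (H U); rewrite /box_part [leRHS]big_mkcond big_seq.
pose f v := if gcd3 v == 1%N then cterm s t v else 0.
have f0 v : 0 <= f v by rewrite /f; case: eqP => // /cterm_ge0.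
rewrite (eq_bigr f) => [|v]; last first.
  by rewrite in_fset_set // inE => /XP/prim_gcd3 g; rewrite /f g.
rewrite -big_seq; apply: (@ler_sum_sub _ _ _ _ f); rewrite ?box_uniq ?fset_uniq // => v vX.
by rewrite mem_box_sup; exact: leq_bigmax_seq.
Qed.

Lemma esum_fin : T \is a fin_num.
Proof.
have := esum_le_box box_part_bound; have := esum_ge_box 0.
by case: T => [r| |].
Qed.

Lemma cterm_summable : summable primitive_triples (fun v => (cterm s t v)%:E).
Proof.
rewrite /summable (eq_esum (b := fun v => (cterm s t v)%:E)); last first.
  by move=> v /prim_gcd3 /cterm_ge0 h; rewrite gee0_abs // lee_fin.
by rewrite ltey_eq esum_fin.
Qed.

Lemma main_term_tail V : (0 < V)%N ->
  `|box_part V - fine T| <= 39 * (eta^-1 * V%:R `^ (- eta)).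
Proof.
move=> V0; have := esum_ge_box V; have := esum_le_box (fun U => box_part_le_tail U V0).
rewrite -(fineK esum_fin) !lee_fin => h1 h2; rewrite ler_norml; apply/andP; split; last first.
  by have := powR_ge0 V%:R (- eta); have : 0 < eta^-1; [rewrite invr_gt0 | nra].
by move: h1; set x := 39 * _; lra.
Qed.

Lemma expR1_ge1 : 1 <= expR 1 :> R.
Proof. by have := expR_ge1Dx (1 : R); lra. Qed.

Lemma line_bound_ge1 B : 1 <= B -> 1 <= line_bound s t B.
Proof.
have ge1 (x e : R) : 1 <= x -> 0 <= e -> 1 <= x `^ e.
  by move=> x1 e0; have := ler_powR x1 e0; rewrite powRr0.
move=> B1; have p1 : 1 <= B `^ (2 / t) by rewrite ge1 // divr_ge0 ?ltW.
by apply: ge1; [lra | rewrite divr_ge0 ?mulr_ge0 ?ltW].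
Qed.

Lemma line_bound_powR B (e : R) : 0 < B ->
  line_bound s t B `^ e = 12 `^ (t / (2 * s) * e) * B `^ (e / s).
Proof.
move=> B0; rewrite /line_bound -powRrM powRM ?powR_ge0 //; congr (_ * _).
by rewrite -powRrM; congr (_ `^ _); field; rewrite !gt_eqF.
Qed.

Lemma line_range_bounds B : 1 <= B -> (0 < line_range s t B)%N /\
  line_bound s t B / 2 <= (line_range s t B)%:R <= line_bound s t B.
Proof.
move=> /line_bound_ge1; set L := line_bound s t B => L1.
have L0 : 0 <= L by lra.
have /andP[h1 h2] := truncn_itv L0; rewrite /line_range -/L; move: h1 h2.
have [->|V0] := posnP (Num.truncn L); first by move=> _; rewrite ltNge L1.
move=> -> h; split=> //; rewrite andbT; move: h; rewrite -natr1.
have : 1 <= (Num.truncn L)%:R :> R by rewrite ler1n.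
by move: (_%:R) => x; lra.
Qed.

(** The bound V on the contributing lines grows like B^(1/s), so that the tail of the series, of order
    V^(-3s/t), is of order B^(-3/t). *)
Lemma main_term_error : exists2 C, 0 <= C & forall B, expR 1 <= B ->
  B `^ (3 / t) * `|box_part (line_range s t B) - fine T| <= C.
Proof.
exists (39 * (eta^-1 * (2 `^ eta * 12 `^ (t / (2 * s) * - eta)))).
  by rewrite !mulr_ge0 ?powR_ge0 // invr_ge0 ltW.
move=> B Be; have B1 : 1 <= B := le_trans expR1_ge1 Be.
have B0 : 0 < B by lra.
have [V0 /andP[h _]] := line_range_bounds B1; have L1 := line_bound_ge1 B1.
apply: le_trans (_ : B `^ (3 / t) * (39 * (eta^-1 * (line_bound s t B / 2) `^ (- eta))) <= _).
  rewrite ler_pM2l ?powR_gt0 //; apply: le_trans (main_term_tail V0) _.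
  rewrite ler_pM2l // ler_pM2l ?invr_gt0 // !powRN lef_pV2 ?posrE ?powR_gt0 ?ltr0n //; last lra.
  by apply: ge0_ler_powR => //; rewrite ?nnegrE ?ltW //; lra.
rewrite powRM ?invr_ge0 //; last lra.
rewrite line_bound_powR // -[2^-1]powR_inv1 // -powRrM mulN1r opprK.
have E : B `^ (3 / t) * B `^ (- eta / s) = 1.
  rewrite -powRD ?(gt_eqF B0) ?implybT // (_ : _ + _ = 0) ?powRr0 //.
  by rewrite /eta; field; rewrite !gt_eqF.
rewrite le_eqVlt; apply/orP; left; apply/eqP.
by rewrite -[RHS]mul1r -[X in _ = X * _]E; ring.
Qed.

(** If 2s/t > 3 the sum over shells converges. Otherwise k^(2 - 2s/t) is at most
    V^(3 - 2s/t) / k, the harmonic sum contributes the logarithm, and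
    B^(2/t) V^(3 - 2s/t) is of order B^(3/s). *)
Lemma shell_error : exists2 C, 0 <= C & forall B, expR 1 <= B ->
  B `^ (2 / t) * \sum_(1 <= k < (line_range s t B).+1) 26 * k%:R ^+ 2 * k%:R `^ (- (2 * (s / t)))
  <= C * (B `^ (2 / t) + B `^ (3 / s) * ln B).
Proof.
have st0 : 0 < s / t by rewrite divr_gt0.
have e1 (B : R) : expR 1 <= B -> [/\ 1 <= B, 0 < B & 1 <= ln B].
  move=> Be; have B1 : 1 <= B := le_trans expR1_ge1 Be.
  have B0 : 0 < B by lra.
  by split=> //; rewrite -(expRK 1) ler_ln ?posrE ?expR_gt0.
have kE (d : R) (k : nat) : (0 < k)%N -> k%:R ^+ 2 * k%:R `^ (- (2 * (s / t))) =
    k%:R `^ (2 - 2 * (s / t) - d) * k%:R `^ d.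
  move=> k0; have kR : 0 < k%:R :> R by rewrite ltr0n.
  by rewrite -powRD ?(gt_eqF kR) ?implybT // subrK addrC powRD ?(gt_eqF kR) ?implybT //
    powR_mulrn ?(ltW kR) // mulrC.
have [d3|d3] := ltP 3 (2 * (s / t)).
  pose g := 2 * (s / t) - 3; have g0 : 0 < g by rewrite /g; lra.
  exists (26 * (1 + g^-1)); first by rewrite mulr_ge0 // addr_ge0 // invr_ge0 ltW.
  move=> B /e1[B1 B0 lB].
  apply: le_trans (_ : B `^ (2 / t) * (26 * (1 + g^-1)) <= _); last first.
    rewrite mulrC ler_pM2l; last by rewrite mulr_gt0 // addr_gt0 // invr_gt0.
    by rewrite lerDl mulr_ge0 ?powR_ge0 //; lra.
  rewrite ler_pM2l ?powR_gt0 //.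
  apply: le_trans (_ : \sum_(1 <= k < (line_range s t B).+1) 26 * k%:R `^ (- 1 - g) <= _).
    rewrite big_nat_cond [leRHS]big_nat_cond; apply: ler_sum => k /andP[/andP[k0 _] _].
    rewrite -mulrA (kE 0 k k0) powRr0 mulr1.
    by rewrite (_ : 2 - _ - 0 = - 1 - g) // /g; ring.
  by rewrite -mulr_sumr ler_pM2l //; exact: power_sum_conv.
pose g := 3 - 2 * (s / t); have g0 : 0 <= g by rewrite /g; lra.
pose K : R := 1 + t / (2 * s) * ln 12 + s^-1.
have l12 : 0 <= ln (12 : R) by rewrite ln_ge0 // ler1n.
have ts0 : 0 <= t / (2 * s) by rewrite divr_ge0 ?mulr_ge0 ?ltW.
have K0 : 0 <= K.
  by apply: addr_ge0; [rewrite addr_ge0 // mulr_ge0 | rewrite invr_ge0 ltW].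
exists (26 * 12 `^ (t / (2 * s) * g) * K); first by rewrite !mulr_ge0 ?powR_ge0.
move=> B /e1[B1 B0 lB]; have [V0 /andP[_ VL]] := line_range_bounds B1.
set V := line_range s t B in V0 VL *; set L := line_bound s t B in VL.
have VR : 0 < V%:R :> R by rewrite ltr0n.
have L1 : 1 <= L := line_bound_ge1 B1.
apply: le_trans (_ : B `^ (2 / t) * (26 * L `^ g * (K * ln B)) <= _).
  rewrite ler_pM2l ?powR_gt0 //.
  apply: le_trans (_ : \sum_(1 <= k < V.+1) 26 * V%:R `^ g * k%:R^-1 <= _).
    rewrite big_nat_cond [leRHS]big_nat_cond; apply: ler_sum => k /andP[/andP[k0 kV] _].
    have kR : 0 < k%:R :> R by rewrite ltr0n.
    rewrite -[leLHS]mulrA -[leRHS]mulrA ler_pM2l // (kE (-1) k k0) powR_inv1 ?(ltW kR) //.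
    rewrite (_ : 2 - _ - -1 = g); last by rewrite /g; ring.
    rewrite ler_pM2r ?invr_gt0 //; apply: (ge0_ler_powR g0); rewrite ?nnegrE ?ler0n // ler_nat.
    by rewrite -ltnS.
  rewrite -mulr_sumr; apply: ler_pM.
  - by rewrite mulr_ge0 ?powR_ge0.
  - by apply: sumr_ge0 => k _; rewrite invr_ge0.
  - by rewrite ler_pM2l //; apply: (ge0_ler_powR g0); rewrite ?nnegrE ?ler0n //; lra.
  apply: le_trans (harmonic_le R V0) _.
  have : ln V%:R <= ln L by rewrite ler_ln ?posrE //; lra.
  have -> : ln L = t / (2 * s) * ln 12 + s^-1 * ln B.
    rewrite /L /line_bound ln_powR lnM ?posrE ?powR_gt0 // ln_powR.
    by field; rewrite !gt_eqF.
  have := mulr_ge0 ts0 l12; rewrite /K; move: (_ * ln 12) => x x0.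
  have : 0 < s^-1 by rewrite invr_gt0.
  by move: (s^-1) (ln B) lB (ln V%:R) => y b b1 w y0; nra.
rewrite /L line_bound_powR //.
have -> : B `^ (2 / t) * (26 * (12 `^ (t / (2 * s) * g) * B `^ (g / s)) * (K * ln B)) =
  26 * 12 `^ (t / (2 * s) * g) * K * ((B `^ (2 / t) * B `^ (g / s)) * ln B) by ring.
have -> : B `^ (2 / t) * B `^ (g / s) = B `^ (3 / s).
  rewrite -powRD ?(gt_eqF B0) ?implybT //; congr (_ `^ _).
  by rewrite /g; field; rewrite !gt_eqF.
by rewrite ler_wpM2l ?mulr_ge0 ?powR_ge0 // lerDr powR_ge0.
Qed.

End MainTerm.

(* The first two conjuncts make explicit that N_{s,t}(B) is a finite number
   and that the series defining c_{s,t} converges. *)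
Theorem mainTheorem1 (R : realType) (s t : R) (hs : 0 < s) (ht : 0 < t) :
  [/\ forall B : R, finite_set (points_le s t B),
      summable primitive_triples (fun v => (cterm s t v)%:E) &
      exists2 C : R, 0 < C & \forall B \near +oo_R,
        `|Ncount s t B - cconst s t * B `^ (3 / t)|
          <= C * (B `^ (2 / t) + B `^ (3 / s) * ln B)].
Proof.
split.
- move=> B; have [B0|B0] := ltP 0 B; first exact: (count_error hs ht B0).1.
  rewrite (_ : points_le s t B = set0) //; apply/seteqP; split=> // J /points_le_pos.
  by rewrite ltNge B0.
- exact: cterm_summable.
have [C1 C1p H1] := main_term_error hs ht; have [C2 C2p H2] := shell_error hs ht.
have l0 : 0 <= leading R / 4.
  rewrite divr_ge0 // /leading divr_ge0 ?mulr_ge0 ?pi_ge0 //.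
  exact: le_trans (zeta3_ge1 R).
exists (1 + leading R / 4 * C1 + 2640 * C2).
  by rewrite -addrA; apply: ltr_pwDl ltr01 _; exact: addr_ge0 (mulr_ge0 l0 C1p) (mulr_ge0 (ler0n R 2640) C2p).
near=> B.
have Be : expR 1 <= B by near: B; apply: nbhs_pinfty_ge; exact: num_real.
have B1 : 1 <= B := le_trans (expR1_ge1 R) Be.
have B0 : 0 < B by lra.
have [_ h] := count_error hs ht B0; have h1 := H1 B Be; have h2 := H2 B Be.
have -> : cconst s t = leading R / 4 * fine (\esum_(v in primitive_triples) (cterm s t v)%:E).
  rewrite /cconst /leading; congr (_ * _); field.
  by rewrite gt_eqF // (lt_le_trans _ (zeta3_ge1 R)).
move: h h1 h2; rewrite -/(box_part s t (line_range s t B)).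
have p2 : 1 <= B `^ (2 / t).
  have q : 0 <= 2 / t by rewrite divr_ge0 ?(ltW ht).
  by have := ler_powR B1 q; rewrite powRr0.
have p3 : 0 <= B `^ (3 / s) * ln B by rewrite mulr_ge0 ?powR_ge0 ?ln_ge0.
have p0 : 0 < B `^ (3 / t) by rewrite powR_gt0.
move: (Ncount s t B) (box_part _ _ _) (fine _) (\sum_(1 <= k < _) _) => N S T W.
move: (B `^ (2 / t)) (_ * ln B) (B `^ (3 / t)) (leading R / 4) p2 p3 p0 l0
  => x y z l x1 y0 z0 l0 h h1 h2.
rewrite (_ : N - l * T * z = (N - l * z * S) + l * (z * (S - T))); last by ring.
apply: le_trans (ler_normD _ _) _; rewrite [in X in _ + X]normrM [in X in _ + X]normrM.
rewrite (ger0_norm l0) (gtr0_norm z0).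
have {}h1 : l * (z * `|S - T|) <= l * C1 by rewrite ler_wpM2l.
have {}h : `|N - l * z * S| <= 2640 * (C2 * (x + y)).
  by apply: le_trans h _; rewrite -mulrA ler_wpM2l ?ler0n.
apply: le_trans (lerD h h1) _.
have : l * C1 * 1 <= l * C1 * (x + y) by rewrite ler_wpM2l ?mulr_ge0 //; lra.
by rewrite mulrA mulr1; lra.
Unshelve. all: by end_near.
Qed.
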